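(* Let $k\ge 6$ be even and not a power of $2$. (a) Suppose $k$ is not of the form $6n$ with $n$ a power of $2$ (including $n=1$). Then $v_2(W_{k,\mu(k)})=\lambda(k)$, and $v_2(W_{k,b})>\lambda(k)$ for every admissible $b$ with $b<\mu(k)$. (b) Suppose $k=6n$, where $n$ is a power of $2$ (including $n=1$). Then $v_2(W_{k,n})=0$; if $n\ge 2$ then $v_2(W_{k,0})=1$; and $v_2(W_{k,b})>1$ for every admissible $b\notin\{0,n\}$.
   Context: For even $k\ge 4$ and $z$ in the complex upper half-plane, let $E_k(z)=\frac12\sum_{(a,b)=1}\frac{1}{(az+b)^k}$ (sum over pairs of coprime integers $a,b$) and $G_k=2\zeta(k)E_k$, where $\zeta$ is the Riemann zeta function. The coefficients $w(a,k)\in\mathbb{Q}$ are the uniquely determined rational numbers with $G_k=\sum_{4a+6b=k} w(a,k)\,G_4^aG_6^b$, the sum being over integers $a,b\ge 0$ with $4a+6b=k$. For an integer $b\ge 0$ with $6b\le k$ and $4\mid k-6b$ (call such $b$ admissible for $k$), set $W_{k,b}:=w\left(\frac{k-6b}{4},k\right)$, i.e. the coefficient of $G_4^{(k-6b)/4}G_6^b$ in $G_k$. Let $v_2$ be the 2-adic valuation on $\mathbb{Q}$ (with $v_2(0)=+\infty$), and let $s(n)$ be the number of ones in the binary expansion of $n$. Define $$\lambda(k)=\begin{cases}0,& k\text{ is a power of }2,\\ s(k)-2,& k\text{ is not a power of }2,\end{cases}\qquad \mu(k)=\begin{cases}0,& k\text{ is a power of }2,\\ 2^{v_2(k)-1},&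 k\text{ is not a power of }2.\end{cases}$$ *)

(* Defs.v *)
(* MathComp / MathComp-Analysis *)
From HB Require Import structures.
From mathcomp Require Import all_boot all_order all_algebra finmap complex.
From mathcomp Require Import all_classical all_reals all_analysis.
From mathcomp Require summability.
Set Implicit Arguments.
Unset Strict Implicit.
Unset Printing Implicit Defensive.
Import Order.TTheory GRing.Theory Num.Theory.
Import numFieldNormedType.Exports.
Local Open Scope ring_scope.
Local Open Scope complex_scope.

(* [summability.sum] is the unconditional sum: the limit of the finite partial
   sums along the finite subsets of int * int ordered by inclusion.  The series
   converges absolutely for k >= 3 and z not real. [R[i]^o] is R[i] with the
   topology of its norm. *)
Definition eisE (R : realType) (k : nat) (z : R[i]) : R[i] :=
  (2^-1 : R[i]) * (summability.sum (fun ab : int * int =>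
    (if coprimez ab.1 ab.2 then (ab.1%:~R * z + ab.2%:~R) ^- k else 0) : R[i]^o)
    : R[i]).

(* Only meaningful for k >= 2, where the Dirichlet series converges. *)
Definition zeta (R : realType) (k : nat) : R :=
  limn (series (fun n => n.+1%:R ^- k : R)).

Definition eisG (R : realType) (k : nat) (z : R[i]) : R[i] :=
  (2 * zeta R k)%:C * eisE k z.

(* [w a] stands for w(a, k).  The bounds a, b <= k only make the range finite;
   they follow from 4a + 6b = k. *)
Definition eisenstein_coef (R : realType) (k : nat) (w : nat -> rat) : Prop :=
  forall z : R[i], 0 < complex.Im z ->
    eisG k z =
      \sum_(a < k.+1) \sum_(b < k.+1 | (4 * a + 6 * b == k)%N)
         ratr (w a) * eisG 4 z ^+ a * eisG 6 z ^+ b.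

Definition admissible (k b : nat) : bool :=
  ((6 * b <= k) && (4 %| k - 6 * b))%N.

Definition W (w : nat -> rat) (k b : nat) : rat := w ((k - 6 * b) %/ 4)%N.

Definition v2 (x : rat) : \bar int :=
  if x == 0 then +oo%E
  else ((logn 2 `|numq x|)%:Z - (logn 2 `|denq x|)%:Z)%:E%E.

(* The exponent bound m <= n loses nothing, since m < 2 ^ m. *)
Definition is_pow2 (n : nat) : bool := [exists m : 'I_n.+1, n == (2 ^ m)%N].

(* Number of binary digits 1; n < 2 ^ n, so the digits of rank >= n vanish. *)
Definition bin_ones (n : nat) : nat := (\sum_(i < n) (n %/ 2 ^ i) %% 2)%N.

Definition lambda (k : nat) : int :=
  if is_pow2 k then 0 else (bin_ones k)%:Z - 2.

Definition mu (k : nat) : nat :=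
  if is_pow2 k then 0%N else (2 ^ (logn 2 k).-1)%N.

(* Main.v *)
(* Put c_n = (2n-1) G_2n.  Partial fractions in sums over nonzero lattice points
   with x + y + z = 0 give (n-3)(2n+1) c_n = 3 sum_(2 <= p <= n-2) c_p c_(n-p),
   which computes c_n as a polynomial in G_4 and G_6.  These are the coefficients
   in question: on the imaginary axis G_4 > 0 while G_6 vanishes at i and is
   positive at 2i, so G_6^2 / G_4^3 takes infinitely many values and no nonzero
   weighted homogeneous polynomial vanishes at all (G_4(z), G_6(z)).

   The recurrence also governs the formal expansion of u^2 wp(u/2) for the cubic
   with roots 1, X, -1-X.  Written with the Jacobi-type solutions of
   n' = cd, c' = (e1-e2) nd, d' = (e1-e3) nc, that series is Hurwitz integral
   at 2, with coefficient of u^(2n) / (2n)! congruent to (1+X)^n + X^n + 1 mod 2.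
   Up to odd factors G_4 and G_6 become 1 + X + X^2 and X (1 + X), so comparing
   coefficients of X is a triangular system for those of c_n, and 2-adic
   valuations can be read off; the shift s(n) - 2 comes from Legendre's formula
   for (2n)!.

   For k = 6 * 2^j the second smallest valuation is also needed, hence c_n modulo
   4, which follows from c_2h = unit * (c_h^2 + 2 sum_(p < h) c_p c_(2h-p)) and
   from squaring, modulo 2, the sum on the right when h is doubled. *)
From HB Require Import structures.
Require Import Defs.
From mathcomp Require Import all_boot all_order all_algebra finmap complex.
From mathcomp Require Import all_classical all_reals all_analysis.
From mathcomp Require Import ring lra zify.
From mathcomp Require summability.
Set Implicit Arguments.
Unset Strict Implicit.
Unset Printing Implicit Defensive.
Import Order.TTheory GRing.Theory Num.Theory.
Import numFieldNormedType.Exports.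
Local Open Scope ring_scope.
Local Open Scope complex_scope.

(** * Formal power series *)

(** For odd m the recurrence for c_m divides by the even number m - 3, so induction on it alone can
    lose powers of 2; integrality has to come from a generating series. The series u^2 wp(u) = e1
    u^2 + (u/n)^2 is already Hurwitz integral, but this controls only (2m)! c_m. Halving the
    argument gains the factor 4^(m-1), and 4^(m-1) / (2m)! is 2^(s(m)-2) up to an odd factor. The
    system for n, c, d replaces sn, cn, dn because their usual normalisation by sqrt (e1 - e3) would
    leave Q[X]. The lattice sums and the formal series are never compared with each other: each
    satisfies the recurrence with its own values of G_4 and G_6, and [heval_eis_poly] says that any
    such sequence is given by the universal polynomials [eis_poly]. One parameter [X] suffices since
    these are weighted homogeneous, and the roots are placed so that at X = 0 the image of G_6 has a
    simple zero while that of G_4 is a unit at 2; this makes the comparison triangular. *)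

Definition fps (K : comNzRingType) : Type := nat -> K.

Section PowerSeries.
Variable K : comNzRingType.
Implicit Types f g h : fps K.

HB.instance Definition _ := gen_eqMixin (fps K).
HB.instance Definition _ := gen_choiceMixin (fps K).

Definition ser_add f g : fps K := fun n => f n + g n.
Definition ser_opp f : fps K := fun n => - f n.
Definition ser_mul f g : fps K := fun n => \sum_(i < n.+1) f i * g (n - i)%N.
Definition ser_cst (a : K) : fps K := fun n => if n is 0 then a else 0.

Lemma ser_addA : associative ser_add.
Proof. by move=> f g h; apply/funext=> n; rewrite /ser_add addrA. Qed.
Lemma ser_addC : commutative ser_add.
Proof. by move=> f g; apply/funext=> n; rewrite /ser_add addrC. Qed.
Lemma ser_add0 : left_id (ser_cst 0) ser_add.
Proof. by move=> f; apply/funext=> -[|n]; rewrite /ser_add add0r. Qed.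
Lemma ser_addN : left_inverse (ser_cst 0) ser_opp ser_add.
Proof. by move=> f; apply/funext=> -[|n]; rewrite /ser_add addNr. Qed.
HB.instance Definition _ :=
  GRing.isZmodule.Build (fps K) ser_addA ser_addC ser_add0 ser_addN.

Definition ser_trunc f n : {poly K} := \poly_(i < n.+1) f i.

(** A coefficient of a product depends only on truncations, so commutativity, associativity and the
    Leibniz rule are inherited from polynomials. *)
Lemma ser_mul_trunc f g n m :
  (n <= m)%N -> ser_mul f g n = (ser_trunc f m * ser_trunc g m)`_n.
Proof.
move=> nm; rewrite coefM; apply: eq_bigr => i _.
by rewrite !coef_poly !ifT // ltnS; [exact: leq_trans (leq_subr _ _) nm
  | exact: leq_trans (leq_ord i) nm].
Qed.

Lemma ser_mulC : commutative ser_mul.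
Proof.
by move=> f g; apply/funext=> n; rewrite !(ser_mul_trunc _ _ (leqnn n)) mulrC.
Qed.

Lemma ser_mulA : associative ser_mul.
Proof.
move=> f g h; apply/funext=> n.
have -> : ser_mul f (ser_mul g h) n =
    (ser_trunc f n * (ser_trunc g n * ser_trunc h n))`_n.
  rewrite coefM; apply: eq_bigr => i _; rewrite (@ser_mul_trunc _ _ _ n) ?leq_subr//.
  by rewrite coef_poly ltn_ord.
have -> : ser_mul (ser_mul f g) h n =
    (ser_trunc f n * ser_trunc g n * ser_trunc h n)`_n.
  rewrite coefM; apply: eq_bigr => i _; rewrite (@ser_mul_trunc _ _ _ n) ?leq_ord//.
  by rewrite coef_poly ltnS leq_subr.
by rewrite mulrA.
Qed.

Lemma ser_mul1 : left_id (ser_cst 1) ser_mul.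
Proof.
move=> f; apply/funext=> n; rewrite /ser_mul big_ord_recl subn0 mul1r big1 ?addr0//.
by move=> i _; rewrite mul0r.
Qed.

Lemma ser_mulD : left_distributive ser_mul +%R.
Proof.
move=> f g h; apply/funext=> n.
change (ser_mul (f + g) h n = ser_mul f h n + ser_mul g h n).
rewrite /ser_mul -big_split /=.
by apply: eq_bigr => i _; rewrite -mulrDl.
Qed.

Lemma ser_1_neq0 : ser_cst 1 != 0.
Proof.
by apply/eqP => /(congr1 (@^~ 0%N)) /eqP; rewrite /= oner_eq0.
Qed.

HB.instance Definition _ := GRing.Zmodule_isComNzRing.Build (fps K)
  ser_mulA ser_mulC ser_mul1 ser_mulD ser_1_neq0.

Definition ser_var : fps K := fun n => (n == 1%N)%:R.
Definition ser_deriv f : fps K := fun n => f n.+1 *+ n.+1.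

Lemma ser_addE f g n : (f + g) n = f n + g n. Proof. by []. Qed.
Lemma ser_oppE f n : (- f) n = - f n. Proof. by []. Qed.
Lemma ser_mulE f g n : (f * g) n = \sum_(i < n.+1) f i * g (n - i)%N.
Proof. by []. Qed.
Lemma ser_mul0E f g : (f * g) 0%N = f 0%N * g 0%N.
Proof. by rewrite ser_mulE big_ord_recl big_ord0 addr0. Qed.
Lemma ser_0E n : (0 : fps K) n = 0. Proof. by case: n. Qed.
Lemma ser_1E n : (1 : fps K) n = (n == 0%N)%:R. Proof. by case: n. Qed.

Lemma ser_cst_mulE a f n : (ser_cst a * f) n = a * f n.
Proof.
rewrite ser_mulE big_ord_recl subn0 /= big1 ?addr0// => i _.
by rewrite /= mul0r.
Qed.

Lemma ser_cstD a b : ser_cst (a + b) = ser_cst a + ser_cst b.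
Proof. by apply/funext=> -[|n]; rewrite ser_addE /= ?addr0. Qed.
Lemma ser_cstN a : ser_cst (- a) = - ser_cst a.
Proof. by apply/funext=> -[|n]; rewrite ser_oppE /= ?oppr0. Qed.
Lemma ser_cst1 : ser_cst 1 = 1.
Proof. by []. Qed.
Lemma ser_cstM a b : ser_cst (a * b) = ser_cst a * ser_cst b.
Proof. by apply/funext=> -[|n]; rewrite ser_cst_mulE //= mulr0. Qed.

Lemma ser_var_mulS f n : (ser_var * f) n.+1 = f n.
Proof.
rewrite ser_mulE big_ord_recl mul0r add0r big_ord_recl /= mul1r big1 ?addr0.
  by rewrite /bump /= subn1.
by move=> i _; rewrite /ser_var /= mul0r.
Qed.
Lemma ser_var_mul0 f : (ser_var * f) 0%N = 0.
Proof. by rewrite ser_mul0E mul0r. Qed.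

Lemma ser_derivD f g : ser_deriv (f + g) = ser_deriv f + ser_deriv g.
Proof. by apply/funext=> n; rewrite /ser_deriv !ser_addE mulrnDl. Qed.
Lemma ser_derivN f : ser_deriv (- f) = - ser_deriv f.
Proof. by apply/funext=> n; rewrite /ser_deriv !ser_oppE mulNrn. Qed.
Lemma ser_derivC a : ser_deriv (ser_cst a) = 0.
Proof. by apply/funext=> -[|n]; rewrite /ser_deriv /= mul0rn. Qed.
Lemma ser_derivX : ser_deriv ser_var = 1.
Proof.
by apply/funext=> -[|n]; rewrite /ser_deriv /ser_var ?mulr1n// mul0rn ser_1E.
Qed.

Lemma ser_trunc_deriv f n : (ser_trunc f n.+1)^`() = ser_trunc (ser_deriv f) n.
Proof.
by apply/polyP => i; rewrite coef_deriv !coef_poly /ser_deriv ltnS;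
  case: ifP => // _; rewrite mul0rn.
Qed.

Lemma ser_derivM f g : ser_deriv (f * g) = ser_deriv f * g + f * ser_deriv g.
Proof.
apply/funext=> n; rewrite ser_addE /ser_deriv.
have -> : (f * g) n.+1 = (ser_trunc f n.+1 * ser_trunc g n.+1)`_n.+1.
  exact: ser_mul_trunc (leqnn n.+1).
rewrite -coef_deriv derivM coefD.
rewrite !ser_trunc_deriv !coefM !ser_mulE.
by congr (_ + _); apply: eq_bigr => i _; rewrite /ser_deriv !coef_poly !ifT //;
  rewrite !ltnS ?leq_subr ?leq_ord ?(leq_trans (leq_ord i)) ?(leq_trans (leq_subr _ _)).
Qed.

End PowerSeries.

(** * Recursively defined sequences *)

Section Recursion.
Variables (T : Type) (x0 : T) (F : (nat -> T) -> nat -> T).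

(** Course-of-values recursion: stage [n] holds the entries below [n] and the filler [x0] elsewhere;
    causality of [F] keeps the filler from being read. *)
Fixpoint rec_stage n : nat -> T :=
  if n is m.+1 then fun i => if i == m then F (rec_stage m) m else rec_stage m i
  else fun=> x0.

Definition rec_seq n := rec_stage n.+1 n.

Hypothesis F_causal : forall f g m,
  (forall i, (i < m)%N -> f i = g i) -> F f m = F g m.

Lemma rec_stageE n i : (i < n)%N -> rec_stage n i = rec_seq i.
Proof.
elim: n => // n IH; rewrite ltnS leq_eqVlt => /orP[/eqP->//|lt_in] /=.
by rewrite ltn_eqF// IH.
Qed.

Lemma rec_seqE n : rec_seq n = F rec_seq n.
Proof.
by rewrite {1}/rec_seq /= eqxx; apply: F_causal => i; exact: rec_stageE.
Qed.

End Recursion.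

(** * Integrality at 2 *)

(** The localisation of Z at 2. Divisibility of x by 2^e is expressed as [int2] of x / 2^e, so
    closure under sums and products handles all congruences. *)
Definition int2 (x : rat) : Prop :=
  exists (a : int) (b : nat), odd b /\ x * b%:R = a%:~R.

Lemma int2_int (a : int) : int2 a%:~R.
Proof. by exists a, 1%N; rewrite mulr1. Qed.
Lemma int2_nat (n : nat) : int2 n%:R.
Proof. by rewrite -[n%:R]/((n%:Z)%:~R); exact: int2_int. Qed.
Lemma int2_0 : int2 0. Proof. exact: (int2_nat 0). Qed.
Lemma int2_1 : int2 1. Proof. exact: (int2_nat 1). Qed.
Hint Resolve int2_0 int2_1 int2_nat int2_int : core.

Lemma int2D x y : int2 x -> int2 y -> int2 (x + y).
Proof.
move=> [a [b [ob ab]]] [c [d [od cd]]]; exists (a * d%:Z + c * b%:Z), (b * d)%N.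
split; first by rewrite oddM ob od.
by rewrite natrM rmorphD !rmorphM /= -ab -cd; ring.
Qed.
Lemma int2N x : int2 x -> int2 (- x).
Proof. by move=> [a [b [ob ab]]]; exists (- a), b; rewrite rmorphN /= -ab mulNr. Qed.
Lemma int2B x y : int2 x -> int2 y -> int2 (x - y).
Proof. by move=> hx /int2N; exact: int2D. Qed.
Lemma int2M x y : int2 x -> int2 y -> int2 (x * y).
Proof.
move=> [a [b [ob ab]]] [c [d [od cd]]]; exists (a * c), (b * d)%N.
split; first by rewrite oddM ob od.
by rewrite natrM rmorphM /= -ab -cd; ring.
Qed.
Lemma int2_sum (I : Type) (r : seq I) (P : pred I) (F : I -> rat) :
  (forall i, P i -> int2 (F i)) -> int2 (\sum_(i <- r | P i) F i).
Proof. by move=> h; elim/big_ind: _ => //; exact: int2D. Qed.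
Lemma int2_oddV b : odd b -> int2 (b%:R^-1).
Proof.
move=> ob; exists 1, b; split => //; rewrite mulVf // pnatr_eq0.
by case: b ob.
Qed.

(* [pint t p]: the coefficients of [t *: p] are 2-integral; [pint 2^-1] is
   divisibility by 2. *)
Definition pint (t : rat) (p : {poly rat}) : Prop := forall i, int2 (t * p`_i).

Lemma pintD t p q : pint t p -> pint t q -> pint t (p + q).
Proof. by move=> hp hq i; rewrite coefD mulrDr; exact: int2D. Qed.
Lemma pintN t p : pint t p -> pint t (- p).
Proof. by move=> hp i; rewrite coefN mulrN; exact: int2N. Qed.
Lemma pintB t p q : pint t p -> pint t q -> pint t (p - q).
Proof. by move=> hp hq; apply: pintD => //; exact: pintN. Qed.
Lemma pintM s t p q : pint s p -> pint t q -> pint (s * t) (p * q).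
Proof.
move=> hp hq i; rewrite coefM mulr_sumr; apply: int2_sum => j _.
by rewrite mulrACA; exact: int2M.
Qed.
Lemma pint_1M t p q : pint 1 p -> pint t q -> pint t (p * q).
Proof. by move=> hp hq; rewrite -[t]mul1r; exact: pintM. Qed.
Lemma pint_M1 t p q : pint t p -> pint 1 q -> pint t (p * q).
Proof. by move=> hp hq; rewrite -[t]mulr1; exact: pintM. Qed.
Lemma pint_0 t : pint t 0.
Proof. by move=> i; rewrite coef0 mulr0. Qed.
Lemma pint_sum t (I : Type) (r : seq I) (P : pred I) (F : I -> {poly rat}) :
  (forall i, P i -> pint t (F i)) -> pint t (\sum_(i <- r | P i) F i).
Proof. by move=> h; elim/big_ind: _ => //; [exact: pint_0|exact: pintD]. Qed.
Lemma pint_C t a : int2 (t * a) -> pint t a%:P.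
Proof. by move=> h i; rewrite coefC; case: eqP => _; rewrite ?mulr0. Qed.
Lemma pint_1 : pint 1 1.
Proof. by apply: pint_C; rewrite mul1r. Qed.
Lemma pint_nat n : pint 1 n%:R.
Proof. by rewrite -polyC_natr; apply: pint_C; rewrite mul1r. Qed.
Lemma pint_X : pint 1 'X.
Proof. by move=> i; rewrite coefX mul1r. Qed.
Lemma pint_exp p n : pint 1 p -> pint 1 (p ^+ n).
Proof.
by move=> hp; elim: n => [|n IH]; rewrite ?expr0 ?exprS; [exact: pint_1|exact: pint_1M].
Qed.
Lemma pint_Z t a p : int2 a -> pint t p -> pint t (a *: p).
Proof. by move=> ha hp i; rewrite coefZ mulrCA; exact: int2M. Qed.
Lemma pint_half p : pint 2^-1 p -> pint 1 p.
Proof.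
by move=> hp i; have := int2M (int2_nat 2) (hp i); rewrite mulrA divff// .
Qed.
Lemma pint_natMl t n p : pint t p -> pint t (n%:R * p).
Proof. exact: pint_1M (pint_nat n). Qed.
Lemma pint_double p : pint 1 p -> pint 2^-1 (2 * p).
Proof.
move=> hp i; rewrite -(polyC_natr _ 2) coefCM mulrA mulVf ?mul1r//.
by have := hp i; rewrite mul1r.
Qed.
Lemma pint_cong_exp p q n : pint 1 p -> pint 1 q -> pint 2^-1 (p - q) ->
  pint 2^-1 (p ^+ n - q ^+ n).
Proof.
move=> hp hq h; rewrite subrXX; apply: pint_M1 => //.
by apply: pint_sum => i _; apply: pint_1M; exact: pint_exp.
Qed.

(* [hint t f]: [t *: f] is a Hurwitz series, i.e. it has 2-integral coefficients
   in the basis u ^ m / m!. *)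
Definition hint (t : rat) (f : fps {poly rat}) : Prop :=
  forall m, pint (t * m`!%:R) (f m).

Section HurwitzIntegral.
Implicit Types f g : fps {poly rat}.

Lemma hintD t f g : hint t f -> hint t g -> hint t (f + g).
Proof. by move=> hf hg m; exact: pintD. Qed.
Lemma hintN t f : hint t f -> hint t (- f).
Proof. by move=> hf m; exact: pintN. Qed.
Lemma hintB t f g : hint t f -> hint t g -> hint t (f - g).
Proof. by move=> hf hg; apply: hintD => //; exact: hintN. Qed.

(** The quotient m! / (i! (m-i)!) is a binomial coefficient. Only indices up to [m] are assumed, so
    that the statement can serve inside the induction that constructs the series. *)
Lemma hintM_coef s t (f g : fps {poly rat}) m :
  (forall i, (i <= m)%N -> pint (s * i`!%:R) (f i)) ->
  (forall i, (i <= m)%N -> pint (t * i`!%:R) (g i)) ->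
  pint (s * t * m`!%:R) ((f * g) m).
Proof.
move=> hf hg; rewrite ser_mulE; apply: pint_sum => i _ j.
have := pintM (hf i (leq_ord i)) (hg (m - i)%N (leq_subr _ _)).
move=> /(_ j) h; have := int2M (int2_nat 'C(m, i)) h.
rewrite -(bin_fact (leq_ord i)) !natrM.
by congr int2; ring.
Qed.

Lemma hintM s t f g : hint s f -> hint t g -> hint (s * t) (f * g).
Proof. by move=> hf hg m; exact: hintM_coef. Qed.
Lemma hint_1M t f g : hint 1 f -> hint t g -> hint t (f * g).
Proof. by move=> hf hg; rewrite -[t]mul1r; exact: hintM. Qed.
Lemma hint_M1 t f g : hint t f -> hint 1 g -> hint t (f * g).
Proof. by move=> hf hg; rewrite -[t]mulr1; exact: hintM. Qed.
Lemma hint_cst t a : pint t a -> hint t (ser_cst a).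
Proof.
by move=> ha [|m]; rewrite /= ?mulr1//; exact: pint_0.
Qed.
Lemma hint_1 : hint 1 1.
Proof. by rewrite -ser_cst1; apply: hint_cst; exact: pint_1. Qed.

Lemma pint_factS t m (p : {poly rat}) :
  pint (t * m`!%:R) (p *+ m.+1) <-> pint (t * (m.+1)`!%:R) p.
Proof.
by split=> h i; move: (h i); rewrite coefMn factS natrM -mulr_natr;
  congr int2; ring.
Qed.

Lemma hint_integ t f : pint t (f 0%N) -> hint t (ser_deriv f) -> hint t f.
Proof. by move=> h0 h [|m]; [rewrite mulr1|apply/pint_factS; exact: h]. Qed.
Lemma hint_deriv t f : hint t f -> hint t (ser_deriv f).
Proof. by move=> h m; apply/pint_factS; exact: h. Qed.
Lemma hint_var : hint 1 (@ser_var {poly rat}).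
Proof.
by apply: hint_integ; [exact: pint_0|rewrite ser_derivX; exact: hint_1].
Qed.
Lemma hint_double f : hint 1 f -> hint 2^-1 (f + f).
Proof.
by move=> hf m i; have := hf m i; rewrite ser_addE coefD; congr int2; field.
Qed.
(** The derivative 2 f f' is twice a Hurwitz series, and integration only shifts coefficients in the
    basis u^m / m!. *)
Lemma hint_sqr f : f 0%N = 0 -> hint 1 f -> hint 2^-1 (f * f).
Proof.
move=> f0 hf; apply: hint_integ; first by rewrite ser_mul0E f0 mul0r; exact: pint_0.
rewrite ser_derivM [_ * f]mulrC; apply: hint_double.
by apply: hint_1M => //; exact: hint_deriv.
Qed.

(** In the basis u^m / m! two derivations shift the index by 2, so f'' = a f modulo 2 means that
    each coefficient is [a] times the one two places before. *)
Lemma hint_recur2 (f : fps {poly rat}) (a : {poly rat}) (i : nat) :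
  pint 1 a -> hint 2^-1 (ser_deriv (ser_deriv f) - ser_cst a * f) ->
  forall m, pint 2^-1 (f (i + 2 * m)%N *+ (i + 2 * m)`! - a ^+ m * (f i *+ i`!)).
Proof.
move=> ha hf; elim=> [|m IH]; first by rewrite muln0 addn0 mul1r subrr; exact: pint_0.
set j := (i + 2 * m)%N in IH *.
have -> : (i + 2 * m.+1 = j.+2)%N by rewrite /j; lia.
have E : pint 2^-1 (f j.+2 *+ j.+2`! - a * (f j *+ j`!)).
  have <- : (ser_deriv (ser_deriv f) - ser_cst a * f) j *+ j`! =
      f j.+2 *+ j.+2`! - a * (f j *+ j`!).
    rewrite ser_addE ser_oppE ser_cst_mulE /ser_deriv mulrnBl mulrnAr -!mulrnA.
    by congr (_ *+ _ - _); rewrite !factS; lia.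
  by move=> k; have := hf j k; rewrite coefMn -[in X in _ -> X]mulr_natr; congr int2; ring.
have -> : f j.+2 *+ j.+2`! - a ^+ m.+1 * (f i *+ i`!) =
  (f j.+2 *+ j.+2`! - a * (f j *+ j`!)) + a * (f j *+ j`! - a ^+ m * (f i *+ i`!)).
  by rewrite exprS; ring.
by apply: pintD => //; exact: pint_1M.
Qed.

End HurwitzIntegral.

(** * The elliptic function attached to three roots *)

Lemma poly_mulrnI m (x y : {poly rat}) : x *+ m.+1 = y *+ m.+1 -> x = y.
Proof.
rewrite -!scaler_nat => /(congr1 ( *:%R m.+1%:R^-1)).
by rewrite !scalerA mulVf ?pnatr_eq0// !scale1r.
Qed.

Lemma ser_ext (f g : fps {poly rat}) :
  f 0%N = g 0%N -> ser_deriv f = ser_deriv g -> f = g.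
Proof.
move=> h0 h; apply/funext=> -[//|m]; apply: (@poly_mulrnI m).
exact: (congr1 (@^~ m) h).
Qed.

(** [true] stands for odd series and [false] for even ones, which turns the parity of a product into
    an exclusive or. *)
Definition ser_parity (b : bool) (f : fps {poly rat}) := forall m, odd m = ~~ b -> f m = 0.

Lemma ser_parityM_coef b b' (f g : fps {poly rat}) m :
  (forall i, (i <= m)%N -> odd i = ~~ b -> f i = 0) ->
  (forall i, (i <= m)%N -> odd i = ~~ b' -> g i = 0) ->
  odd m = ~~ (b (+) b') -> (f * g) m = 0.
Proof.
move=> hf hg om; rewrite ser_mulE big1// => i _.
have [oi|] := boolP (odd i == ~~ b).
  by rewrite hf ?mul0r ?leq_ord//; exact/eqP.
move=> oi; rewrite hg ?mulr0 ?leq_subr// oddB ?leq_ord// om.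
by clear -oi; move: oi; case: (odd i); case: b; case: b'.
Qed.

Lemma ser_parityM b b' (f g : fps {poly rat}) :
  ser_parity b f -> ser_parity b' g -> ser_parity (b (+) b') (f * g).
Proof. by move=> hf hg m; apply: ser_parityM_coef => i _; [exact: hf|exact: hg]. Qed.

Lemma ser_inverse (f : fps {poly rat}) : f 0%N = 1 -> hint 1 f -> ser_parity false f ->
  exists g : fps {poly rat},
    [/\ f * g = 1, g 0%N = 1, hint 1 g & ser_parity false g].
Proof.
move=> f0 hf pf.
pose F (g : nat -> {poly rat}) m : {poly rat} :=
  if m is m'.+1 then - \sum_(i < m'.+1) f i.+1 * g (m' - i)%N else 1.
have Fc (g1 g2 : nat -> {poly rat}) m :
    (forall i, (i < m)%N -> g1 i = g2 i) -> F g1 m = F g2 m.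
  case: m => // m h; congr (- _); apply: eq_bigr => i _.
  by rewrite h // ltnS leq_subr.
pose g : fps {poly rat} := rec_seq 0 F.
have gE m : g m = F g m by exact: (rec_seqE 0 Fc).
exists g; split.
- apply/funext => -[|m]; first by rewrite ser_mul0E f0 gE mulr1.
  rewrite ser_mulE big_ord_recl f0 mul1r subn0 [X in X + _]gE /= ser_1E.
  apply/eqP; rewrite addrC subr_eq0; apply/eqP; apply: eq_bigr => i _.
  by rewrite /bump /= add1n subSS.
- by rewrite gE.
- elim/ltn_ind => -[_|m IH]; first by rewrite gE /= mulr1; exact: pint_1.
  rewrite gE /=; apply: pintN; apply: pint_sum => i _ j.
  have h1 := hf i.+1; have h2 := IH (m - i)%N (leq_subr _ _).
  have := int2M (int2_nat 'C(m.+1, i.+1)) (pintM h1 h2 j).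
  rewrite -(@bin_fact m.+1 i.+1) ?ltnS ?leq_ord// subSS !natrM.
  by congr int2; ring.
- elim/ltn_ind => -[_//|m IH] om; rewrite gE /= big1 ?oppr0// => i _.
  have [oi|oi] := boolP (odd i.+1); first by rewrite pf ?mul0r.
  rewrite IH ?mulr0// ?ltnS ?leq_subr// oddB ?leq_ord//.
  by move: om oi => /=; case: (odd m); case: (odd i).
Qed.

(** The triple is found by recursion on the Taylor coefficients. Relative to u^m / m! the equations
    involve no division, whence integrality. *)
Lemma jacobi_ode (a b : {poly rat}) : pint 1 a -> pint 1 b ->
  exists n c d : fps {poly rat},
  [/\ [/\ n 0%N = 0, c 0%N = 1 & d 0%N = 1],
      [/\ ser_deriv n = c * d, ser_deriv c = ser_cst a * (n * d)
        & ser_deriv d = ser_cst b * (n * c)],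
      [/\ hint 1 n, hint 1 c & hint 1 d]
    & [/\ ser_parity true n, ser_parity false c & ser_parity false d]].
Proof.
move=> ha hb.
pose F (s : nat -> {poly rat} * {poly rat} * {poly rat}) m :
    {poly rat} * {poly rat} * {poly rat} :=
  let n : fps {poly rat} := fun i => (s i).1.1 in
  let c : fps {poly rat} := fun i => (s i).1.2 in
  let d : fps {poly rat} := fun i => (s i).2 in
  if m is m'.+1 then
    (m'.+1%:R^-1 *: (c * d) m', m'.+1%:R^-1 *: (a * (n * d) m'),
     m'.+1%:R^-1 *: (b * (n * c) m'))
  else (0, 1, 1).
have Fc s1 s2 m : (forall i, (i < m)%N -> s1 i = s2 i) -> F s1 m = F s2 m.
  case: m => // m h; congr (_ *: _, _ *: (_ * _), _ *: (_ * _)); apply: eq_bigr => i _;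
  by rewrite !h // ltnS ?leq_subr ?leq_ord.
pose s := rec_seq (0, 0, 0) F.
have sE m : s m = F s m by exact: (rec_seqE _ Fc).
pose n : fps {poly rat} := fun i => (s i).1.1.
pose c : fps {poly rat} := fun i => (s i).1.2.
pose d : fps {poly rat} := fun i => (s i).2.
have scaleK (x : {poly rat}) m : m.+1%:R^-1 *: x *+ m.+1 = x.
  by rewrite -scaler_nat scalerA mulfV ?pnatr_eq0// scale1r.
have nS m : n m.+1 *+ m.+1 = (c * d) m by rewrite /n sE scaleK.
have cS m : c m.+1 *+ m.+1 = a * (n * d) m by rewrite /c sE scaleK.
have dS m : d m.+1 *+ m.+1 = b * (n * c) m by rewrite /d sE scaleK.
have n0 : n 0%N = 0 by rewrite /n sE.
have c0 : c 0%N = 1 by rewrite /c sE.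
have d0 : d 0%N = 1 by rewrite /d sE.
exists n, c, d; split; first by split.
- by split; apply/funext => m; rewrite /ser_deriv ?nS ?cS ?dS ?ser_cst_mulE.
- suff H m : [/\ pint (1 * m`!%:R) (n m), pint (1 * m`!%:R) (c m)
               & pint (1 * m`!%:R) (d m)] by split=> m; case: (H m).
  elim/ltn_ind: m => -[_|m IH].
    by rewrite n0 c0 d0 mulr1; split; [exact: pint_0|exact: pint_1|exact: pint_1].
  have step (f g : fps {poly rat}) :
      (forall i, (i <= m)%N -> pint (1 * i`!%:R) (f i)) ->
      (forall i, (i <= m)%N -> pint (1 * i`!%:R) (g i)) ->
      pint (1 * m`!%:R) ((f * g) m).
    by move=> hf hg; have := hintM_coef hf hg; rewrite mulr1.
  have hn i : (i <= m)%N -> pint (1 * i`!%:R) (n i) by case/IH.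
  have hc i : (i <= m)%N -> pint (1 * i`!%:R) (c i) by case/IH.
  have hd i : (i <= m)%N -> pint (1 * i`!%:R) (d i) by case/IH.
  by split; apply/pint_factS; rewrite ?nS ?cS ?dS; [|apply: pint_1M..];
    rewrite //; exact: step.
- suff H m : [/\ odd m = ~~ true -> n m = 0, odd m = ~~ false -> c m = 0
               & odd m = ~~ false -> d m = 0] by split=> m; case: (H m).
  elim/ltn_ind: m => -[_|m IH]; first by split.
  have hn i : (i <= m)%N -> odd i = ~~ true -> n i = 0 by case/IH.
  have hc i : (i <= m)%N -> odd i = ~~ false -> c i = 0 by case/IH.
  have hd i : (i <= m)%N -> odd i = ~~ false -> d i = 0 by case/IH.
  have E (x : {poly rat}) : x *+ m.+1 = 0 -> x = 0.
    by move=> h; apply: (@poly_mulrnI m); rewrite h mul0rn.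
  split=> om; apply: E; rewrite ?nS ?cS ?dS.
  + apply: (ser_parityM_coef hc hd); move: om => /=; by case: (odd m).
  + rewrite (ser_parityM_coef hn hd) ?mulr0//; move: om => /=; by case: (odd m).
  + rewrite (ser_parityM_coef hn hc) ?mulr0//; move: om => /=; by case: (odd m).
Qed.

Local Notation U := (ser_var {poly rat}).

(** The Euler operator u d/du replaces d/du because the half-period functions have a pole at 0:
    multiplied by u they are power series, and their equations in this operator have no
    denominators. *)
Lemma euler_derivM (f g : fps {poly rat}) :
  U * ser_deriv (f * g) = (U * ser_deriv f) * g + f * (U * ser_deriv g).
Proof. rewrite ser_derivM; ring. Qed.

Lemma euler_derivD (f g : fps {poly rat}) :
  U * ser_deriv (f + g) = U * ser_deriv f + U * ser_deriv g.
Proof. by rewrite ser_derivD mulrDr. Qed.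

Lemma jacobi_first_integral (a : {poly rat}) (n c d : fps {poly rat}) :
  n 0%N = 0 -> c 0%N = 1 -> ser_deriv n = c * d -> ser_deriv c = ser_cst a * (n * d) ->
  c * c = 1 + ser_cst a * (n * n).
Proof.
move=> n0 c0 Dn Dc; apply: ser_ext.
  by rewrite ser_addE ser_cst_mulE !ser_mul0E n0 c0 !mulr0 addr0 mulr1.
rewrite ser_derivD !ser_derivM !ser_derivC Dn Dc; ring.
Qed.

(* P1 = u/n, P2 = uc/n, P3 = ud/n are u times the three half-period functions
   sqrt (wp - e_i); [half_wp] is u^2 wp(u/2), expressed through them by the
   halving formula wp(u/2) - e1 = (P1 + P2) (P1 + P3) / u^2. *)
Section HalfPeriodProduct.
Variables (E1 E2 E3 P1 P2 P3 : fps {poly rat}).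
Hypothesis E0 : E1 + E2 + E3 = 0.
Hypothesis DE : ser_deriv E1 = 0.
Hypothesis DP1 : U * ser_deriv P1 = P1 - P2 * P3.
Hypothesis DP2 : U * ser_deriv P2 = P2 - P1 * P3.
Hypothesis DP3 : U * ser_deriv P3 = P3 - P1 * P2.
Hypothesis P12 : P2 * P2 - P1 * P1 = (E1 - E2) * (U * U).
Hypothesis P13 : P3 * P3 - P1 * P1 = (E1 - E3) * (U * U).

Definition half_wp : fps {poly rat} := E1 * (U * U) + (P1 + P2) * (P1 + P3).
(** In terms of the elliptic function this is - u^3 wp'(u/2) / 2. *)
Let Pi := (P1 + P2) * (P2 + P3) * (P1 + P3).

Lemma euler_half_wp : U * ser_deriv half_wp = 2 * half_wp - Pi.
Proof.
rewrite /half_wp /Pi !(euler_derivD, euler_derivM) DE DP1 DP2 DP3 ser_derivX; ring.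
Qed.

Lemma euler_half_wp' : U * ser_deriv Pi = Pi * (3 - (P1 + P2 + P3)).
Proof. rewrite /Pi !(euler_derivD, euler_derivM) DP1 DP2 DP3; ring. Qed.

(** This is wp'' = 6 wp^2 - g_2 / 2 at u/2, multiplied by u^4 / 2; the left-hand side is 2 (D - 2)
    (D - 3) applied to [half_wp], where D = u d/du. *)
Lemma half_wp_quadratic :
  2 * (U * ser_deriv (U * ser_deriv half_wp) - 5 * (U * ser_deriv half_wp)
       + 6 * half_wp)
  = 3 * (half_wp * half_wp) + (E1 * E2 + E1 * E3 + E2 * E3) * (U * U * (U * U)).
Proof.
have -> : 2 * (U * ser_deriv (U * ser_deriv half_wp) - 5 * (U * ser_deriv half_wp)
       + 6 * half_wp) = 2 * (Pi * (P1 + P2 + P3)).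
  rewrite euler_half_wp euler_derivD.
  have -> : 2 * half_wp = half_wp + half_wp by ring.
  rewrite euler_derivD ser_derivN mulrN euler_half_wp' euler_half_wp; ring.
pose A1 := E1 * (U * U); pose A2 := E2 * (U * U); pose A3 := E3 * (U * U).
have hA2 : A2 = A1 - (P2 * P2 - P1 * P1) by rewrite P12 /A1 /A2; ring.
have hA3 : A3 = A1 - (P3 * P3 - P1 * P1) by rewrite P13 /A1 /A3; ring.
have R0 : 3 * A1 - (P2 * P2 - P1 * P1 + (P3 * P3 - P1 * P1)) = 0.
  transitivity (A1 + A2 + A3); first by rewrite hA2 hA3; ring.
  by rewrite /A1 /A2 /A3 -!mulrDl E0 mul0r.
have -> : (E1 * E2 + E1 * E3 + E2 * E3) * (U * U * (U * U)) =
  A1 * A2 + A1 * A3 + A2 * A3 by rewrite /A1 /A2 /A3; ring.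
(* The identity holds modulo the relation [R0], with cofactor 2 [half_wp]. *)
rewrite -[RHS]subr0 -(mulr0 (2 * (A1 + (P1 + P2) * (P1 + P3)))) -R0 hA2 hA3.
rewrite /half_wp -/A1 /Pi; ring.
Qed.

(** Each half_wp - e_i u^2 is a product of two of the three sums P_i + P_j, so the product of all
    three is the square of [Pi]. The cubic equation is needed because the quadratic one leaves the
    coefficient of u^6 undetermined. *)
Lemma half_wp_cubic :
  (U * ser_deriv half_wp - 2 * half_wp) * (U * ser_deriv half_wp - 2 * half_wp)
  = half_wp * half_wp * half_wp
    + (E1 * E2 + E1 * E3 + E2 * E3) * (half_wp * (U * U * (U * U)))
    - (E1 * E2 * E3) * (U * U * (U * U * (U * U))).
Proof.
have x1 : half_wp - E1 * (U * U) = (P1 + P2) * (P1 + P3) by rewrite /half_wp; ring.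
have x2 : half_wp - E2 * (U * U) = (P1 + P2) * (P2 + P3).
  transitivity ((P1 + P2) * (P1 + P3) + (E1 - E2) * (U * U)).
    by rewrite /half_wp; ring.
  by rewrite -P12; ring.
have x3 : half_wp - E3 * (U * U) = (P1 + P3) * (P2 + P3).
  transitivity ((P1 + P2) * (P1 + P3) + (E1 - E3) * (U * U)).
    by rewrite /half_wp; ring.
  by rewrite -P13; ring.
transitivity ((half_wp - E1 * (U * U)) * (half_wp - E2 * (U * U)) *
  (half_wp - E3 * (U * U))).
  rewrite x1 x2 x3 euler_half_wp /Pi; ring.
have -> : E3 = - (E1 + E2) by apply/eqP; rewrite -addr_eq0 addrC E0.
ring.
Qed.

End HalfPeriodProduct.

(** The two equations serve to identify the coefficients of [xi], the last two clauses to control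
    them at 2. The congruence is symmetric in the roots, since 3 e1 equals e2 - e3 modulo 2. *)
Lemma half_wp_hurwitz (e1 e2 e3 : {poly rat}) :
  e1 + e2 + e3 = 0 -> pint 1 e1 -> pint 1 e2 -> pint 1 e3 ->
  let A := e1 * e2 + e1 * e3 + e2 * e3 in
  exists xi : fps {poly rat},
  [/\ xi 0%N = 4 /\ ser_parity false xi,
      2 * (U * ser_deriv (U * ser_deriv xi) - 5 * (U * ser_deriv xi) + 6 * xi)
        = 3 * (xi * xi) + ser_cst A * (U * U * (U * U)),
      (U * ser_deriv xi - 2 * xi) * (U * ser_deriv xi - 2 * xi)
        = xi * xi * xi + ser_cst A * (xi * (U * U * (U * U)))
          - ser_cst (e1 * e2 * e3) * (U * U * (U * U * (U * U))),
      hint 1 xi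
    & forall m, (0 < m)%N -> pint 2^-1
       (xi (2 * m)%N *+ (2 * m)`! - ((e1 - e2) ^+ m + (e1 - e3) ^+ m + (3 * e1) ^+ m))].
Proof.
move=> e0 h1 h2 h3 A; pose a := e1 - e2; pose b := e1 - e3.
have ha : pint 1 a by exact: pintB.
have hb : pint 1 b by exact: pintB.
have [n [c [d [[n0 c0 d0] [Dn Dc Dd] [hn hc hd] [pn pc pd]]]]] := jacobi_ode ha hb.
have Ic := jacobi_first_integral n0 c0 Dn Dc.
have Id : d * d = 1 + ser_cst b * (n * n).
  by apply: (jacobi_first_integral n0 d0 _ Dd); rewrite Dn mulrC.
pose N : fps {poly rat} := fun m => n m.+1.
have UN : U * N = n.
  by apply/funext => -[|m]; rewrite ?ser_var_mul0 ?ser_var_mulS.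
have N0 : N 0%N = 1.
  by have /(congr1 (@^~ 0%N)) := Dn; rewrite /ser_deriv ser_mul0E c0 d0 mulr1n mulr1.
have pN : ser_parity false N by move=> m om; apply: pn; rewrite /= om.
have hN : hint 1 N.
  (* Passing from n to n/u divides the Hurwitz coefficient of index m + 1 by m + 1, which is odd for
     the even m that occur. *)
  move=> m; have [om|em] := boolP (odd m); first by rewrite pN //; exact: pint_0.
  move=> i; have := int2M (int2_oddV (_ : odd m.+1)) (hn m.+1 i); move=> /(_ em).
  by rewrite factS natrM !mul1r -!mulrA mulKf ?pnatr_eq0.
have [V [NV V0 hV pV]] := ser_inverse N0 hN pN.
have DN : U * ser_deriv N = c * d - N.
  by apply/eqP; rewrite eq_sym subr_eq -Dn -UN ser_derivM ser_derivX; apply/eqP; ring.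
have DV : U * ser_deriv V = V - c * V * (d * V).
  have : ser_deriv (N * V) = 0 by rewrite NV; exact: ser_derivC.
  rewrite ser_derivM => h.
  transitivity (N * V * (U * ser_deriv V)); first by rewrite NV mul1r.
  transitivity (U * V * (ser_deriv N * V + N * ser_deriv V) - V * V * (U * ser_deriv N)).
    ring.
  rewrite h DN mulr0 sub0r -[V in RHS]mul1r -{1}NV; ring.
pose P2 := c * V; pose P3 := d * V.
have nV : n * V = U by rewrite -UN -mulrA NV mulr1.
have DP (a' : {poly rat}) (c' d' : fps {poly rat}) :
    ser_deriv c' = ser_cst a' * (n * d') -> c' * c' = 1 + ser_cst a' * (n * n) ->
    c' * d' = c * d ->
    U * ser_deriv (c' * V) = c' * V - V * (d' * V).
  move=> Dc' Ic' cd'; rewrite euler_derivM DV Dc'.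
  transitivity (c' * V + ser_cst a' * (U * (n * V)) * d' - c' * V * (c * d) * V).
    ring.
  rewrite -cd' nV.
  transitivity (c' * V + ser_cst a' * (U * U) * d' - (c' * c') * (V * V) * d').
    ring.
  rewrite Ic' -{1 2}nV; ring.
have DP2 := DP _ _ _ Dc Ic erefl; have DP3 := DP _ _ _ Dd Id (mulrC _ _).
rewrite -/P2 -/P3 in DP2 DP3.
have cst0 : ser_cst e1 + ser_cst e2 + ser_cst e3 = 0 :> fps {poly rat}.
  by rewrite -!ser_cstD e0.
have Pd (a' : {poly rat}) (c' : fps {poly rat}) : c' * c' = 1 + ser_cst a' * (n * n) ->
    (c' * V) * (c' * V) - V * V = ser_cst a' * (U * U).
  move=> Ic'; transitivity (c' * c' * (V * V) - V * V); first ring.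
  rewrite Ic' -nV; ring.
have P12 : P2 * P2 - V * V = (ser_cst e1 - ser_cst e2) * (U * U).
  by rewrite -ser_cstN -ser_cstD; exact: Pd.
have P13 : P3 * P3 - V * V = (ser_cst e1 - ser_cst e3) * (U * U).
  by rewrite -ser_cstN -ser_cstD; exact: Pd.
have DE1 : ser_deriv (ser_cst e1) = 0 by exact: ser_derivC.
exists (half_wp (ser_cst e1) V P2 P3); split.
- split.
    rewrite /half_wp ser_addE ser_cst_mulE !ser_mul0E /= !mulr0 add0r !ser_addE.
    by rewrite /P2 /P3 !ser_mul0E V0 c0 d0; ring.
  have pU : ser_parity true U by move=> [|[|m]].
  have pC : ser_parity false (ser_cst e1) by move=> [|m].
  have pP2 : ser_parity false P2 := ser_parityM pc pV.
  have pP3 : ser_parity false P3 := ser_parityM pd pV.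
  have pD (f g : fps {poly rat}) :
      ser_parity false f -> ser_parity false g -> ser_parity false (f + g).
    by move=> hf hg m om; rewrite ser_addE hf// hg// addr0.
  apply: (pD); first exact: ser_parityM pC (ser_parityM pU pU).
  exact: ser_parityM (pD _ _ pV pP2) (pD _ _ pV pP3).
- rewrite (half_wp_quadratic cst0 DE1 DV DP2 _ P12 P13).
    by rewrite /A !ser_cstD !ser_cstM.
  by rewrite DP3 [V * P2]mulrC [P2 * V]mulrC.
- rewrite (half_wp_cubic cst0 DE1 DV DP2 _ P12 P13) ?DP3//.
  by rewrite /A !ser_cstD !ser_cstM.
- have hE : hint 1 (ser_cst e1) by apply: hint_cst.
  have hP2 : hint 1 P2 by exact: hint_1M.
  have hP3 : hint 1 P3 by exact: hint_1M.
  apply: hintD; first by apply: hint_1M => //; apply: hint_1M; exact: hint_var.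
  by apply: hint_1M; exact: hintD.
move=> m m0.
(* Modulo 2 one has V * V = 1 and U * U = 0, and n, c, d satisfy the linear
   equations n'' = 3 e1 n, c'' = a c, d'' = b d. *)
have hsum : hint 2^-1 (half_wp (ser_cst e1) V P2 P3 - (1 + c + d + ser_deriv n)).
  have -> : half_wp (ser_cst e1) V P2 P3 - (1 + c + d + ser_deriv n) =
     ser_cst e1 * (U * U) + ((V - 1) * (V - 1) + ((V - 1) + (V - 1))) * ((1 + c) * (1 + d)).
    by rewrite /half_wp Dn /P2 /P3; ring.
  have hV1 : hint 1 (V - 1) by apply: hintB => //; exact: hint_1.
  apply: hintD.
    apply: hint_1M; first exact: hint_cst.
    by apply: hint_sqr; [|exact: hint_var].
  apply: hint_M1; last by apply: hint_1M; apply: hintD => //; exact: hint_1.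
  apply: hintD; last exact: hint_double.
  by apply: hint_sqr => //; rewrite ser_addE ser_oppE V0 subrr.
have rc : hint 2^-1 (ser_deriv (ser_deriv c) - ser_cst a * c).
  have -> : ser_deriv (ser_deriv c) - ser_cst a * c =
    (ser_cst (a * b) * (n * n) * c + ser_cst (a * b) * (n * n) * c).
    rewrite Dc !ser_derivM ser_derivC Dn Dd ser_cstM.
    transitivity (ser_cst a * (c * (d * d) + ser_cst b * (n * n) * c) - ser_cst a * c).
      ring.
    by rewrite Id; ring.
  apply: hint_double; apply: hint_1M => //; apply: hint_1M; last exact: hint_1M.
  by apply: hint_cst; exact: pint_1M.
have rd : hint 2^-1 (ser_deriv (ser_deriv d) - ser_cst b * d).
  have -> : ser_deriv (ser_deriv d) - ser_cst b * d =
    (ser_cst (a * b) * (n * n) * d + ser_cst (a * b) * (n * n) * d).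
    rewrite Dd !ser_derivM ser_derivC Dn Dc ser_cstM.
    transitivity (ser_cst b * (d * (c * c) + ser_cst a * (n * n) * d) - ser_cst b * d).
      ring.
    by rewrite Ic; ring.
  apply: hint_double; apply: hint_1M => //; apply: hint_1M; last exact: hint_1M.
  by apply: hint_cst; exact: pint_1M.
have rn : hint 2^-1 (ser_deriv (ser_deriv n) - ser_cst (3 * e1) * n).
  have -> : ser_deriv (ser_deriv n) - ser_cst (3 * e1) * n =
    (ser_cst (a * b) * (n * n) * n + ser_cst (a * b) * (n * n) * n).
    have -> : 3 * e1 = a + b by rewrite /a /b -[LHS]subr0 -e0; ring.
    rewrite Dn !ser_derivM Dc Dd ser_cstM (ser_cstD a b).
    transitivity (n * (ser_cst a * (d * d) + ser_cst b * (c * c)) -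
       (ser_cst a + ser_cst b) * n).
      ring.
    by rewrite Ic Id; ring.
  apply: hint_double; apply: hint_1M => //; apply: hint_1M; last exact: hint_1M.
  by apply: hint_cst; exact: pint_1M.
have h3e : pint 1 (3 * e1) by exact: pint_natMl.
have := hsum (2 * m)%N.
have := hint_recur2 1 h3e rn m; have := hint_recur2 0 hb rd m.
have := hint_recur2 0 ha rc m.
rewrite add0n add1n c0 d0.
have -> : n 1%N = 1 by rewrite -UN ser_var_mulS N0.
rewrite fact0 (factS 0) fact0 muln1 !mulr1n !mulr1 => kc kd kn ks.
have {}ks : pint 2^-1 ((half_wp (ser_cst e1) V P2 P3 - (1 + c + d + ser_deriv n)) (2 * m)%N
     *+ (2 * m)`!).
  move=> i; have := ks i; rewrite coefMn; congr int2.
  by rewrite -[in RHS]mulr_natr; ring.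
have := pintD ks (pintD kc (pintD kd kn)).
congr (pint _ _).
rewrite ser_addE ser_oppE !ser_addE ser_1E muln_eq0 /= (gtn_eqF m0) add0r.
have -> : n (2 * m).+1 *+ (2 * m).+1`! = ser_deriv n (2 * m)%N *+ (2 * m)`!.
  by rewrite /ser_deriv -mulrnA -factS.
by rewrite mulrnBl !mulrnDl; ring.
Qed.

(** * The polynomials expressing (2n-1) G_2n through G_4 and G_6 *)

Definition eis_const (n : nat) : rat := 3 / ((n - 3) * (2 * n).+1)%:R.

(** The starting values are 3 G_4 and 5 G_6 with G_4 replaced by 1 and G_6 by X; the entries 0 and 1
    are fillers outside the range of the convolution. *)
Definition eis_step (f : nat -> {poly rat}) (n : nat) : {poly rat} :=
  if n == 2%N then 3%:P else if n == 3%N then 5 *: 'X else if (n < 4)%N then 0 else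
  eis_const n *: \sum_(2 <= p < n.-1) f p * f (n - p)%N.

(* [(eis_poly n)`_b] is the coefficient of G_4 ^ ((n - 3 b) / 2) * G_6 ^ b in
   (2 n - 1) G_(2 n), that is (2 n - 1) times w((n - 3 b) / 2, 2 n). *)
Definition eis_poly : nat -> {poly rat} := rec_seq 0 eis_step.

Lemma eis_polyE n : eis_poly n = eis_step eis_poly n.
Proof.
apply: rec_seqE => f g m h; rewrite /eis_step.
case: ifP => // _; case: ifP => // _; case: ifP => // m4; congr (_ *: _).
rewrite !big_nat; apply: eq_bigr => p /andP[p2 pm].
by rewrite !h //; lia.
Qed.

Lemma eis_poly2 : eis_poly 2 = 3%:P. Proof. by rewrite eis_polyE. Qed.
Lemma eis_poly3 : eis_poly 3 = 5 *: 'X. Proof. by rewrite eis_polyE. Qed.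
Lemma eis_polyS n : (4 <= n)%N ->
  eis_poly n = eis_const n *: \sum_(2 <= p < n.-1) eis_poly p * eis_poly (n - p)%N.
Proof.
move=> n4; rewrite eis_polyE /eis_step ltnNge n4 /=.
by do 2 (case: ifP => [/eqP|_]; first by lia).
Qed.

(** X^b stands for G_4^a G_6^b with 2a + 3b = n; such an a exists exactly under this condition on
    b. *)
Definition weighted (n : nat) (p : {poly rat}) :=
  forall b, p`_b != 0 -> (3 * b <= n)%N && ~~ odd (n - 3 * b)%N.

Lemma weightedM m n p q : weighted m p -> weighted n q -> weighted (m + n) (p * q).
Proof.
move=> hp hq b; apply: contraR => hb; rewrite coefM big1// => i _.
have [p0|/hp /andP[p1 p2]] := eqVneq p`_i 0; first by rewrite p0 mul0r.
have [q0|/hq /andP[q1 q2]] := eqVneq q`_(b - i) 0; first by rewrite q0 mulr0.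
by have := ltn_ord i; move: hb p1 p2 q1 q2; lia.
Qed.

Lemma weighted_eis_poly n : weighted n (eis_poly n).
Proof.
elim/ltn_ind: n => n IH; have [n4|n4] := leqP 4 n; last first.
  move=> b; rewrite eis_polyE /eis_step.
  case: ifP => [/eqP-> |_]; first by rewrite coefC; case: b => //= b; rewrite eqxx.
  case: ifP => [/eqP-> |_].
    by rewrite coefZ coefX; case: b => [|[|b]] //=; rewrite ?mulr0 eqxx.
  by rewrite n4 coef0 eqxx.
rewrite eis_polyS// => b; rewrite coefZ => h.
have {h} : (\sum_(2 <= p < n.-1) eis_poly p * eis_poly (n - p))`_b != 0.
  by apply: contraNneq h => ->; rewrite mulr0.
apply: contraR => hb; rewrite coef_sum big_nat big1// => p hp.
apply/eqP; apply: contraR hb => hpb.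
have -> : n = (p + (n - p))%N by lia.
by apply: (weightedM _ _ hpb); apply: IH; lia.
Qed.

Section HomogeneousEvaluation.
Variables (K : comNzRingType) (phi : {rmorphism rat -> K}) (X Y : K).

(** Restores the power of G_4 suppressed in the dehomogenised polynomial. For [weighted n]
    polynomials the division by 2 is exact and no coefficient is cut off, whence
    multiplicativity. *)
Definition heval (n : nat) (p : {poly rat}) : K :=
  \sum_(b < n.+1) phi p`_b * X ^+ ((n - 3 * b) %/ 2) * Y ^+ b.

Lemma heval_sum n (I : Type) (r : seq I) (P : pred I) (F : I -> {poly rat}) :
  heval n (\sum_(i <- r | P i) F i) = \sum_(i <- r | P i) heval n (F i).
Proof.
rewrite /heval exchange_big /=; apply: eq_bigr => b _.
by rewrite coef_sum rmorph_sum !mulr_suml.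
Qed.

Lemma hevalZ n a p : heval n (a *: p) = phi a * heval n p.
Proof.
by rewrite /heval mulr_sumr; apply: eq_bigr => b _; rewrite coefZ rmorphM !mulrA.
Qed.

Lemma heval_Xn n b : (b <= n)%N -> heval n 'X^b = X ^+ ((n - 3 * b) %/ 2) * Y ^+ b.
Proof.
move=> bn; rewrite /heval (bigD1 (Ordinal (bn : (b < n.+1)%N))) //= big1 ?addr0.
  by rewrite coefXn eqxx rmorph1 mul1r.
move=> i /eqP ib; rewrite coefXn; case: eqP => [e|_]; last by rewrite rmorph0 !mul0r.
by case: ib; exact: val_inj.
Qed.

Lemma weighted_sumXn n p : weighted n p -> p = \sum_(b < n.+1) p`_b *: 'X^b.
Proof.
move=> hp; rewrite -poly_def; apply/polyP => b; rewrite coef_poly.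
case: ltnP => // nb; apply/eqP; apply: contraLR nb => /hp /andP[h _].
by rewrite -ltnNge ltnS; lia.
Qed.

Lemma hevalM m n p q : weighted m p -> weighted n q ->
  heval (m + n) (p * q) = heval m p * heval n q.
Proof.
move=> hp hq; rewrite {1}(weighted_sumXn hp) {1}(weighted_sumXn hq) mulr_suml.
rewrite heval_sum [in RHS]/heval mulr_suml; apply: eq_bigr => b _.
rewrite !mulr_sumr heval_sum; apply: eq_bigr => c _.
have [-> |/hp /andP[b1 b2]] := eqVneq p`_b 0.
  by rewrite scale0r mul0r rmorph0 !mul0r -(scale0r 0) hevalZ rmorph0 mul0r.
have [-> |/hq /andP[c1 c2]] := eqVneq q`_c 0.
  by rewrite scale0r rmorph0 !mul0r !mulr0 -(scale0r 0) hevalZ rmorph0 mul0r.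
rewrite -scalerAl -scalerAr -exprD !hevalZ heval_Xn; last by lia.
have -> : ((m + n - 3 * (b + c)) %/ 2 = (m - 3 * b) %/ 2 + (n - 3 * c) %/ 2)%N by lia.
by rewrite !exprD; ring.
Qed.

(** The meeting point of the two halves: [K] is [R[i]] for lattice sums at a point of the upper
    half-plane, and [{poly rat}] for the Taylor coefficients of the formal elliptic function. *)
Lemma heval_eis_poly (g : nat -> K) :
  g 2%N = 3 * X -> g 3%N = 5 * Y ->
  (forall n, (4 <= n)%N -> ((n - 3) * (2 * n).+1)%:R * g n =
     3 * \sum_(2 <= p < n.-1) g p * g (n - p)%N) ->
  forall n, (2 <= n)%N -> g n = heval n (eis_poly n).
Proof.
move=> g2 g3 gS; elim/ltn_ind => n IH n2.
have [n4|] := leqP 4 n; last first.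
  case: n n2 IH => [|[|[|[|n]]]] // _ _ _.
    rewrite g2 eis_poly2 /heval big_ord_recl big1 => [|i _]; last first.
      by rewrite coefC /= rmorph0 !mul0r.
    by rewrite coefC /= rmorph_nat expr0 mulr1 expr1 addr0.
  rewrite g3 eis_poly3 hevalZ -['X]expr1 heval_Xn //.
  by rewrite rmorph_nat expr0 mul1r expr1.
rewrite eis_polyS// hevalZ heval_sum.
have -> : \sum_(2 <= p < n.-1) heval n (eis_poly p * eis_poly (n - p)) =
   \sum_(2 <= p < n.-1) g p * g (n - p)%N.
  rewrite !big_nat; apply: eq_bigr => p hp.
  have := hevalM (@weighted_eis_poly p) (@weighted_eis_poly (n - p)).
  rewrite subnKC => [->|]; last by lia.
  by rewrite -!IH //; lia.
have e : phi ((n - 3) * (2 * n).+1)%:R^-1 * ((n - 3) * (2 * n).+1)%:R = 1.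
  by rewrite -(rmorph_nat phi) -rmorphM mulVf ?rmorph1 // pnatr_eq0 -lt0n muln_gt0 subn_gt0 n4.
by rewrite /eis_const rmorphM rmorph_nat mulrAC -gS// mulrC mulrA e mul1r.
Qed.

End HomogeneousEvaluation.

Lemma euler_coef (f : fps {poly rat}) m : (U * ser_deriv f) m = f m *+ m.
Proof. by case: m => [|m]; rewrite ?ser_var_mul0 ?mulr0n ?ser_var_mulS. Qed.

Lemma ser_natmulE (f : fps {poly rat}) k m : (k%:R * f : fps {poly rat}) m = k%:R * f m.
Proof.
elim: k => [|k IH]; first by rewrite !mul0r ser_0E.
by rewrite -!natr1 !mulrDl !mul1r ser_addE IH.
Qed.

Lemma big_even (V : nmodType) (F : nat -> V) n : (forall i, odd i -> F i = 0) ->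
  \sum_(i < (2 * n).+1) F i = \sum_(i < n.+1) F (2 * i)%N.
Proof.
move=> hF; elim: n => [|n IH]; first by rewrite !big_ord1.
have -> : (2 * n.+1 = (2 * n).+2)%N by lia.
rewrite 2!big_ord_recr /= IH [in RHS]big_ord_recr /= hF ?addr0 /=; last by lia.
by congr (_ + F _); lia.
Qed.

(* The roots 1, X, -1-X turn 15 G_4 into 1 + X + X^2 and 35 G_6 into -(X + X^2). *)
Lemma eis_poly_hurwitz n : (2 <= n)%N ->
  exists E : {poly rat},
    pint 2^-1 (E - ((1 - 'X) ^+ n + (2 + 'X) ^+ n + 3 ^+ n)) /\
    (4 ^+ n.-1 / (2 * n)`!%:R) *: E =
      heval polyC (15^-1 *: (1 + 'X + 'X ^+ 2)) (- (35^-1 *: ('X + 'X ^+ 2))) n (eis_poly n).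
Proof.
pose e2 : {poly rat} := 'X; pose e3 : {poly rat} := - 1 - 'X.
have e0 : 1 + e2 + e3 = 0 by rewrite /e2 /e3; ring.
have he2 : pint 1 e2 by exact: pint_X.
have he3 : pint 1 e3 by apply: pintB; [apply: pintN; exact: pint_1|exact: pint_X].
have [xi [[x0 px] ode cub hx hmod]] := half_wp_hurwitz e0 pint_1 he2 he3.
pose A : {poly rat} := 1 * e2 + 1 * e3 + e2 * e3.
have u4 m : (U * U * (U * U)) m = (m == 4)%N%:R.
  by rewrite -mulrA; case: m => [|[|[|[|m]]]]; rewrite ?ser_var_mulS ?ser_var_mul0.
have odeE m : 2 * (xi m *+ m *+ m - 5 * (xi m *+ m) + 6 * xi m) =
    3 * (xi * xi) m + A * (m == 4)%N%:R.
  have h := congr1 (@^~ m) ode; cbv beta in h; move: h.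
  rewrite (ser_natmulE _ 2) !ser_addE !ser_oppE (ser_natmulE _ 5) (ser_natmulE _ 6).
  rewrite (ser_natmulE _ 3) !euler_coef => ->.
  by rewrite ser_cst_mulE u4.
have sqE m : (xi * xi) (2 * m)%N =
    \sum_(0 <= p < m.+1) xi (2 * p)%N * xi (2 * (m - p))%N.
  rewrite ser_mulE (big_even (F := fun i => xi i * xi (2 * m - i)%N)).
    by rewrite big_mkord; apply: eq_bigr => i _; rewrite mulnBr.
  by move=> i oi; rewrite px ?mul0r.
have x2 : xi 2%N = 0.
  have := odeE 2%N; rewrite (sqE 1%N) 2?big_nat_recl// big_geq//= x0 => h.
  apply: (@poly_mulrnI 23); rewrite mul0rn -[LHS]mulr_natl.
  transitivity (3 * (4 * xi 2%N + (xi 2%N * 4 + 0)) + A * 0); first ring.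
  by rewrite -h; ring.
have x4 : -20 * xi 4%N = A.
  have := odeE 4%N; rewrite (sqE 2%N) 3?big_nat_recl// big_geq//= x0 x2 => h.
  transitivity (2 * (xi 4%N *+ 4 *+ 4 - 5 * (xi 4%N *+ 4) + 6 * xi 4%N) - 24 * xi 4%N).
    ring.
  by rewrite h; ring.
have mul6 (f g : fps {poly rat}) : ser_parity false f ->
    (f * g) 6%N = f 0%N * g 6%N + f 2%N * g 4%N + f 4%N * g 2%N + f 6%N * g 0%N.
  move=> pf; rewrite ser_mulE (@big_even _ (fun i => f i * g (6 - i)%N) 3).
    by rewrite !big_ord_recr big_ord0 /= add0r.
  by move=> i oi; rewrite pf ?mul0r.
(* At u^6 both sides of the quadratic equation contribute 24 xi_6, hence the recourse to the cubic
   one. This is the factor n - 3 of the recurrence, which vanishes at n = 3. *)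
have x6 : 112 * xi 6%N = 1 * e2 * e3.
  pose f : fps {poly rat} := U * ser_deriv xi - 2 * xi.
  have fE m : f m = xi m *+ m - 2 * xi m.
    by rewrite /f ser_addE ser_oppE (ser_natmulE _ 2) euler_coef.
  have pf : ser_parity false f by move=> m om; rewrite fE px// mul0rn mulr0 subr0.
  have h := congr1 (@^~ 6%N) cub; cbv beta in h; move: h.
  have -> : (ser_cst A * (xi * (U * U * (U * U))) : fps {poly rat}) =
      ser_cst A * (U * (U * (U * (U * xi)))) by ring.
  have -> : U * U * (U * U * (U * U)) = U * (U * (U * (U * (U * (U * 1))))) by ring.
  rewrite !ser_addE !ser_oppE !ser_cst_mulE !ser_var_mulS x2 ser_1E mulr1 mulr0 addr0.
  have s2 : (xi * xi) 2%N = 0.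
    by rewrite (sqE 1%N) !big_nat_recl// big_geq//= x2 mul0r mulr0 !addr0.
  have s4 : (xi * xi) 4%N = xi 0%N * xi 4%N + (xi 2%N * xi 2%N + (xi 4%N * xi 0%N + 0)).
    by rewrite (sqE 2%N) !big_nat_recl// big_geq.
  rewrite -/f (mul6 _ _ pf) !fE (mul6 _ _ (ser_parityM px px)) ser_mul0E s2 s4.
  rewrite (mul6 _ _ px) x0 x2 => h.
  pose l := (4 *+ 0 - 2 * 4) * (xi 6%N *+ 6 - 2 * xi 6%N) +
    (0 *+ 2 - 2 * 0) * (xi 4%N *+ 4 - 2 * xi 4%N) +
    (xi 4%N *+ 4 - 2 * xi 4%N) * (0 *+ 2 - 2 * 0) +
    (xi 6%N *+ 6 - 2 * xi 6%N) * (4 *+ 0 - 2 * 4).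
  transitivity (48 * xi 6%N - l); first by rewrite /l; ring.
  by rewrite /l h; ring.
case: n => [|[|n]] // _; set m := n.+2.
(* Expanding wp(u/2) divides c_k by 2^(2k-2) relative to wp(u); the power of 4 undoes this. *)
pose g k : {poly rat} := 4 ^+ k.-1 * xi (2 * k)%N.
have gE : g m = heval polyC (15^-1 *: (1 + 'X + 'X ^+ 2)) (- (35^-1 *: ('X + 'X ^+ 2))) m (eis_poly m).
  apply: heval_eis_poly; [| |move=> k k4|by []].
  - rewrite /g /= expr1 -scalerAr; apply: (@scalerI _ _ 15) => //.
    rewrite scalerA divff// scale1r scaler_nat.
    transitivity (- 3 * A); first by rewrite -x4; ring.
    by rewrite /A /e2 /e3; ring.
  - rewrite /g /= -scalerN -scalerAr; apply: (@scalerI _ _ 35) => //.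
    rewrite scalerA divff// scale1r scaler_nat.
    transitivity (5 * (112 * xi 6%N)); first ring.
    by rewrite x6 /e2 /e3; ring.
  pose S := \sum_(2 <= p < k.-1) xi (2 * p)%N * xi (2 * (k - p))%N.
  (* The outer terms, with xi_0 = 4 and xi_2 = 0, split off 8 xi_2k; moved to the left-hand side of
     the quadratic equation, they produce the factor (k - 3) (2k + 1). *)
  have sqS : (xi * xi) (2 * k)%N = 8 * xi (2 * k)%N + S.
    rewrite sqE (_ : k.+1 = k.-1.+2); last by lia.
    rewrite big_ltn// big_ltn// big_nat_recr/= ?[X in _ + (_ + (X + _))]big_nat_recr//=; [|lia..].
    rewrite -/S (_ : k.-1.+1 = k) ?subnn ?subn0 ?x0 ?x2 ?mul0r; last by lia.
    have -> : (k - k.-1 = 1)%N by lia.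
    by rewrite ?muln0 muln1 ?x0 x2; ring.
  have odeS : 4 * (((k - 3) * (2 * k).+1)%:R * xi (2 * k)%N) = 3 * S.
    have := odeE (2 * k)%N; rewrite sqS.
    have -> : (2 * k == 4)%N = false by lia.
    have -> : ((k - 3) * (2 * k).+1)%:R = (k%:R - 3) * (2 * k%:R + 1) :> {poly rat}.
      by rewrite natrM natrB ?(ltnW k4)// -[(2 * k).+1%:R]natr1 natrM.
    have nE (x : {poly rat}) : x *+ (2 * k) = 2 * k%:R * x by rewrite -natrM mulr_natl.
    rewrite !nE mulr0 addr0 => h.
    apply/eqP; rewrite -subr_eq0; apply/eqP.
    transitivity (3 * (8 * xi (2 * k)%N + S) - 24 * xi (2 * k)%N - 3 * S); last by ring.
    by rewrite -h; ring.
  have -> : \sum_(2 <= p < k.-1) g p * g (k - p)%N = 4 ^+ (k - 2) * S.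
    rewrite mulr_sumr !big_nat; apply: eq_bigr => p hp; rewrite /g mulrACA -exprD.
    by congr (_ ^+ _ * _); lia.
  rewrite [RHS]mulrCA -odeS /g (_ : k.-1 = (k - 2).+1)%N ?exprS; last by lia.
  ring.
exists (xi (2 * m)%N *+ (2 * m)`!); split.
  by have := hmod m isT; have -> : 1 - e3 = 2 + 'X by [rewrite /e3; ring]; rewrite mulr1.
rewrite -gE /g -scaler_nat scalerA divfK ?pnatr_eq0 -?lt0n ?fact_gt0//.
by rewrite -mul_polyC rmorphXn rmorph_nat.
Qed.

(** * Binary digits *)

(** Legendre's formula: floor(m / 2^i) = 2 floor(m / 2^(i+1)) + digit is summed over i < m, and the
    last quotient vanishes since m < 2^m. *)
Lemma logn2_fact_bin_ones m : (logn 2 m`! + bin_ones m = m)%N.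
Proof.
have tele : (\sum_(i < m) m %/ 2 ^ i =
    2 * (\sum_(i < m) m %/ 2 ^ i.+1) + bin_ones m)%N.
  rewrite /bin_ones big_distrr -big_split; apply: eq_bigr => i _ /=.
  by rewrite {1}(divn_eq (m %/ 2 ^ i) 2) -divnMA -expnSr mulnC.
have -> : logn 2 m`! = (\sum_(i < m) m %/ 2 ^ i.+1)%N.
  by rewrite logn_fact// big_add1 /= big_mkord.
case: m tele => [|m]; first by rewrite big_ord0 /bin_ones big_ord0.
rewrite big_ord_recl expn0 divn1 [in X in _ -> X]big_ord_recr.
rewrite [X in (_ = 2 * X + _)%N -> _]big_ord_recr /=.
rewrite (@divn_small m.+1 (2 ^ m.+1)); last exact: ltn_expl.
by rewrite /bump /= /index_enum /=; under eq_bigr do rewrite add1n; lia.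
Qed.

Lemma bin_ones_widen n N : (n <= N)%N -> bin_ones n = (\sum_(i < N) (n %/ 2 ^ i) %% 2)%N.
Proof.
move=> nN; rewrite -(subnKC nN) big_split_ord /= [X in (_ + X)%N]big1 ?addn0//.
move=> i _; rewrite divn_small ?mod0n//; apply: leq_trans (ltn_expl n (ltnSn 1)) _.
by rewrite leq_exp2l ?leq_addr.
Qed.

Lemma bin_onesE n : bin_ones n = (n %% 2 + bin_ones (n %/ 2))%N.
Proof.
case: n => [|n]; first by rewrite /bin_ones big_ord0.
rewrite (@bin_ones_widen n.+1 n.+2)// (@bin_ones_widen _ n.+1); last by lia.
rewrite big_ord_recl expn0 divn1; congr addn; apply: eq_bigr => i _.
by rewrite /= expnS divnMA.
Qed.

Lemma bin_ones0 : bin_ones 0 = 0%N.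
Proof. by rewrite /bin_ones big_ord0. Qed.

Lemma bin_ones_double n : bin_ones (2 * n) = bin_ones n.
Proof. by rewrite bin_onesE mulKn// modnMr. Qed.

Lemma bin_ones_gt0 n : (0 < n)%N -> (0 < bin_ones n)%N.
Proof.
elim/ltn_ind: n => n IH n0; rewrite bin_onesE.
have [ev|od] := eqVneq (n %% 2)%N 0%N; last by lia.
by rewrite ev add0n IH; lia.
Qed.

Lemma bin_ones_le1 n : (bin_ones n <= 1)%N -> n = 0%N \/ exists a, n = (2 ^ a)%N.
Proof.
elim/ltn_ind: n => n IH; rewrite bin_onesE => h.
have [->|n0] := eqVneq n 0%N; first by left.
right; have [ev|od] := eqVneq (n %% 2)%N 0%N.
  have lt2 : (n %/ 2 < n)%N by lia.
  have le1 : (bin_ones (n %/ 2) <= 1)%N by lia.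
  have [z|[a na]] := IH _ lt2 le1; first by lia.
  by exists a.+1; rewrite expnS -na; lia.
have := @bin_ones_gt0 (n %/ 2)%N; case: (posnP (n %/ 2)%N) => [z|z]; last by lia.
by exists 0%N; rewrite expn0; lia.
Qed.

Lemma is_pow2P n : reflect (exists a, n = (2 ^ a)%N) (is_pow2 n).
Proof.
apply: (iffP existsP) => [[m /eqP e]|[a e]]; first by exists m.
have h : (a < n.+1)%N by rewrite ltnS e ltnW// ltn_expl.
by exists (Ordinal h); rewrite /= -e.
Qed.

(** * Units at 2 and the valuation *)

Definition unit2 (x : rat) : Prop :=
  exists (a : int) (b : nat), [/\ odd `|a|, odd b & x * b%:R = a%:~R].

Lemma unit2_int2 x : unit2 x -> int2 x.
Proof. by move=> [a [b [_ ob e]]]; exists a, b. Qed.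
Lemma unit2_odd n : odd n -> unit2 n%:R.
Proof. by move=> on; exists n%:Z, 1%N; rewrite mulr1. Qed.
Lemma unit2M x y : unit2 x -> unit2 y -> unit2 (x * y).
Proof.
move=> [a [b [oa ob ab]]] [c [d [oc od cd]]]; exists (a * c), (b * d)%N; split.
- by rewrite abszM oddM oa oc.
- by rewrite oddM ob od.
- by rewrite natrM rmorphM /= -ab -cd; ring.
Qed.
Lemma unit2N x : unit2 x -> unit2 (- x).
Proof.
by move=> [a [b [oa ob ab]]]; exists (- a), b; rewrite abszN rmorphN /= -ab mulNr.
Qed.
Lemma unit2X x n : unit2 x -> unit2 (x ^+ n).
Proof.
move=> hx; elim: n => [|n IH]; first by rewrite expr0; exact: (unit2_odd (n := 1)).
by rewrite exprS; exact: unit2M.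
Qed.
Lemma unit2_neq0 x : unit2 x -> x != 0.
Proof.
move=> [a [b [oa ob ab]]]; apply: contraTneq oa => x0.
by move: ab; rewrite x0 mul0r => /esym/eqP; rewrite intr_eq0 => /eqP->.
Qed.
Lemma unit2V x : unit2 x -> unit2 x^-1.
Proof.
move=> ux; have x0 := unit2_neq0 ux; case: ux => [a [b [oa ob ab]]].
have b0 : b%:R != 0 :> rat by rewrite pnatr_eq0; case: b ob {ab}.
case: a oa ab => n on ab.
  exists b%:Z, n; split => //.
  by apply: (mulfI x0); rewrite mulrA mulfV// mul1r -[n%:R]/(n%:Z%:~R) -ab.
exists (- b%:Z), n.+1; split => //; first by rewrite abszN.
apply: (mulfI x0); rewrite mulrA mulfV// mul1r rmorphN mulrN ab NegzE rmorphN opprK.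
by [].
Qed.
Lemma unit2_1D x : int2 x -> unit2 (1 + 2 * x).
Proof.
move=> [a [b [ob ab]]]; exists (b%:Z + 2 * a), b; split => //.
  by lia.
by rewrite rmorphD rmorphM /= -ab; ring.
Qed.
Lemma unit2_cong x y : unit2 x -> int2 (2^-1 * (y - x)) -> unit2 y.
Proof.
move=> ux h; have x0 := unit2_neq0 ux.
have -> : y = x * (1 + 2 * (2^-1 * (y - x) * x^-1)) by field.
apply: unit2M => //; apply: unit2_1D; apply: int2M => //.
by apply: unit2_int2; exact: unit2V.
Qed.

Lemma v2_frac (a : int) (b : nat) : a != 0 -> (0 < b)%N ->
  v2 (a%:~R / b%:R) = ((logn 2 `|a|)%:Z - (logn 2 b)%:Z)%:E%E.
Proof.
move=> a0 b0; have b0' : b%:R != 0 :> rat by rewrite pnatr_eq0 -lt0n.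
pose x : rat := a%:~R / b%:R.
have x0 : x != 0 by rewrite mulf_neq0 ?invr_eq0 ?intr_eq0.
rewrite /v2 -/x (negPf x0); congr ((_)%:E%E).
have e : (`|numq x| * b = `|a| * `|denq x|)%N.
  have : (numq x * b%:Z)%:~R = (a * denq x)%:~R :> rat.
    by rewrite !rmorphM /= numqE {1}/x mulrAC divfK.
  by move=> /intr_inj /(congr1 absz); rewrite !abszM.
have := congr1 (logn 2) e; rewrite !lognM ?absz_gt0 ?numq_eq0 ?denq_neq0//; lia.
Qed.

Lemma logn2_odd n : odd n -> logn 2 n = 0%N.
Proof. by move=> on; rewrite logn_coprime ?coprime2n. Qed.

Lemma v2_unit2 (e : nat) (x : rat) : unit2 x -> v2 (2 ^+ e * x) = (e%:Z)%:E%E.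
Proof.
move=> [a [b [oa ob ab]]]; have b0 : b%:R != 0 :> rat.
  by rewrite pnatr_eq0; case: b ob {ab}.
have -> : 2 ^+ e * x = ((2 ^ e)%N%:Z * a)%:~R / b%:R.
  by rewrite rmorphM /= -ab -[(_%:Z)%:~R]/((2 ^ e)%:R) natrX; field.
rewrite v2_frac; [|apply: contraTneq oa|by case: b ob {ab b0}].
  rewrite abszM absz_nat lognM ?expn_gt0 ?absz_gt0//; last by apply: contraTneq oa => ->.
  rewrite (pfactorK e (isT : prime 2)) !logn2_odd ?addn0 ?subr0//.
by move=> /eqP; rewrite mulf_eq0 => /orP[|/eqP->//]; rewrite eqz_nat expn_eq0.
Qed.

Lemma v2_int2 (e : nat) (x : rat) : int2 x -> (e%:Z%:E <= v2 (2 ^+ e * x))%E.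
Proof.
move=> [a [b [ob ab]]]; have [->|a0] := eqVneq x 0; first by rewrite mulr0 /v2 eqxx leey.
have b0 : b%:R != 0 :> rat by rewrite pnatr_eq0; case: b ob {ab}.
have {}a0 : a != 0.
  by apply: contraNneq a0 => az; move/eqP: ab; rewrite az mulf_eq0 (negPf b0) orbF.
have -> : 2 ^+ e * x = ((2 ^ e)%N%:Z * a)%:~R / b%:R.
  by rewrite rmorphM /= -ab -[(_%:Z)%:~R]/((2 ^ e)%:R) natrX; field.
rewrite v2_frac; [|by rewrite mulf_neq0 // eqz_nat expn_eq0|by case: b ob {ab b0}].
rewrite abszM absz_nat lognM ?expn_gt0 ?absz_gt0// (pfactorK e (isT : prime 2)).
by rewrite (logn2_odd ob) lee_fin; lia.
Qed.

(* As [(Q b)`_0] is a unit, [c b] is determined by F`_0, ..., F`_b. *)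
Section Triangular.
Variables (t : rat) (M : nat) (c : nat -> rat) (Q : nat -> {poly rat}).
Hypothesis Q_int : forall b, pint 1 (Q b).
Hypothesis Q_unit : forall b, unit2 (Q b)`_0.
Let F : {poly rat} := \sum_(b < M) c b *: ('X^b * Q b).

Lemma triangular_coef N : (N < M)%N -> (forall b, (b < N)%N -> int2 (t * c b)) ->
  int2 (t * (F`_N - c N * (Q N)`_0)).
Proof.
move=> NM hc; rewrite coef_sum (bigD1 (Ordinal NM)) //= coefZ coefXnM ltnn subnn.
rewrite addrAC subrr add0r mulr_sumr; apply: int2_sum => b bN.
rewrite coefZ coefXnM; case: ltnP => [_|le_bN]; first by rewrite !mulr0.
rewrite mulrA; apply: int2M; last by rewrite -[X in int2 X]mul1r; exact: Q_int.
by apply: hc; rewrite ltn_neqAle le_bN andbT.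
Qed.

Lemma triangular_int N : (forall i, (i < N)%N -> int2 (t * F`_i)) ->
  forall b, (b < N)%N -> (b < M)%N -> int2 (t * c b).
Proof.
move=> hF; elim/ltn_ind => b IH bN bM.
have h : int2 (t * (F`_b - c b * (Q b)`_0)).
  by apply: triangular_coef => // b' b'b; apply: IH => //; exact: ltn_trans b'b _.
have Q0 := unit2_neq0 (Q_unit b).
have -> : t * c b = (t * F`_b - t * (F`_b - c b * (Q b)`_0)) * ((Q b)`_0)^-1 by field.
apply: int2M; last by apply: unit2_int2; exact: unit2V.
by apply: int2B => //; exact: hF.
Qed.
End Triangular.

(* [eis_scale n] * w has 2-adic valuation v2 w - (s(n) - 2). *)
Definition eis_scale (n : nat) : rat := 4 / 2 ^+ bin_ones n.

(** With [o] the odd part of (2n)!, the number 4^(n-1) / (2n)! is the inverse of [o] times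
    [eis_scale n], so the Hurwitz congruence passes to the rescaled coefficients. Each factor -(X +
    X^2) / 35 supplies one X and leaves a unit constant term for [Q b]; and 1 - X, 2 + X, 3 reduce
    to 1 + X, X, 1 modulo 2. *)
Lemma eis_poly_triangular n : (2 <= n)%N ->
  exists (o : nat) (E : {poly rat}) (Q : nat -> {poly rat}),
  [/\ odd o, pint 2^-1 (E - ((1 + 'X) ^+ n + 'X ^+ n + 1)),
      forall b, pint 1 (Q b), forall b, unit2 (Q b)`_0
    & E = \sum_(b < n.+1) (o%:R * (eis_scale n * (eis_poly n)`_b)) *: ('X^b * Q b)].
Proof.
move=> n2; have [E [hE EE]] := eis_poly_hurwitz n2.
pose o := ((2 * n)`! %/ 2 ^ logn 2 (2 * n)`!)%N.
have oE : ((2 * n)`! = o * 2 ^ logn 2 (2 * n)`!)%N.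
  by rewrite /o divnK// pfactor_dvdn// fact_gt0.
have oo : odd o.
  rewrite /o -coprime2n; have := pfactor_coprime (isT : prime 2) (fact_gt0 (2 * n)).
  by case=> m cm e; rewrite {1}e mulnK ?expn_gt0.
pose Q b : {poly rat} := (15^-1 *: (1 + 'X + 'X ^+ 2)) ^+ ((n - 3 * b) %/ 2) *
   (- (35^-1 *: (1 + 'X))) ^+ b.
have i15 : int2 15^-1 by exact: (@int2_oddV 15).
have i35 : int2 35^-1 by exact: (@int2_oddV 35).
exists o, E, Q; split => //.
- have -> : E - ((1 + 'X) ^+ n + 'X ^+ n + 1) =
    (E - ((1 - 'X) ^+ n + (2 + 'X) ^+ n + 3 ^+ n)) - (((1 + 'X) ^+ n - (1 - 'X) ^+ n)
      + ('X ^+ n - (2 + 'X) ^+ n) + (1 ^+ n - 3 ^+ n)) by rewrite expr1n; ring.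
  have pX := pint_X; have p1 := pint_1; have pn := pint_nat.
  apply: pintB => //; apply: pintD; first apply: pintD.
  + apply: pint_cong_exp; [exact: pintD|exact: pintB|].
    by rewrite (_ : _ - _ = 2 * 'X); [exact: pint_double|ring].
  + apply: pint_cong_exp => //; [by apply: pintD|].
    by rewrite (_ : _ - _ = 2 * (-1)); [apply: pint_double; exact: pintN|ring].
  + apply: pint_cong_exp => //.
    by rewrite (_ : _ - _ = 2 * (-1)); [apply: pint_double; exact: pintN|ring].
- move=> b; apply: pint_1M; apply: pint_exp.
    apply: pint_Z => //; apply: pintD; last exact: pint_exp pint_X.
    by apply: pintD; [exact: pint_1|exact: pint_X].
  by apply: pintN; apply: pint_Z => //; apply: pintD; [exact: pint_1|exact: pint_X].
- move=> b; rewrite -horner_coef0 !(hornerE, horner_exp) /=.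
  apply: unit2M; apply: unit2X.
    by apply: unit2V; exact: (@unit2_odd 15).
  by apply: unit2N; apply: unit2V; exact: (@unit2_odd 35).
have -> : E = (o%:R * eis_scale n) *: ((4 ^+ n.-1 / (2 * n)`!%:R) *: E).
  rewrite scalerA -[LHS]scale1r; congr (_ *: _).
  have lE : (logn 2 (2 * n)`! + bin_ones n = 2 * n)%N.
    by rewrite -(bin_ones_double n) logn2_fact_bin_ones.
  have e4 : (4 * 4 ^+ n.-1 : rat) = 2 ^+ logn 2 (2 * n)`! * 2 ^+ bin_ones n.
    rewrite -exprD lE -exprS (_ : n.-1.+1 = n); last by lia.
    by rewrite exprM; congr (_ ^+ _); rewrite expr2; ring.
  have o0 : o%:R != 0 :> rat by rewrite pnatr_eq0; case: (o) oo.
  have t0 k : 2 ^+ k != 0 :> rat by rewrite expf_neq0.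
  move: oE e4; set L := logn 2 _ => -> e4; rewrite natrM natrX /eis_scale.
  transitivity ((4 * 4 ^+ n.-1) / (2 ^+ L * 2 ^+ bin_ones n) : rat).
    by rewrite e4 divff// mulf_neq0.
  by field; rewrite o0 !t0.
rewrite EE /heval scaler_sumr; apply: eq_bigr => b _.
rewrite -mul_polyC -[in RHS]mul_polyC !polyCM -!mulrA; do 4 congr (_ * _).
rewrite /Q [RHS]mulrCA; congr (_ * _); rewrite -exprMn; congr (_ ^+ _).
by rewrite mulrN -scalerAr; congr (- (_ *: _)); ring.
Qed.

(** * Low coefficients modulo 2 *)

Lemma frobenius2 j : pint 2^-1 ((1 + 'X) ^+ (2 ^ j) - (1 + 'X^(2 ^ j))).
Proof.
have p1X k : pint 1 (1 + 'X^k).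
  by apply: pintD; [exact: pint_1|exact: pint_exp pint_X].
elim: j => [|j IH]; first by rewrite expn0 !expr1 subrr; exact: pint_0.
rewrite expnSr !exprM.
have -> : ((1 + 'X) ^+ (2 ^ j)) ^+ 2 - (1 + 'X ^+ (2 ^ j) ^+ 2) =
  ((1 + 'X) ^+ (2 ^ j)) ^+ 2 - (1 + 'X^(2 ^ j)) ^+ 2 + 2 * 'X^(2 ^ j) :> {poly rat}.
  by ring.
apply: pintD; last by apply: pint_double; exact: pint_exp pint_X.
apply: pint_cong_exp => //; apply: pint_exp.
by apply: pintD; [exact: pint_1|exact: pint_X].
Qed.

Lemma coef_1DXn_exp q m l : (0 < q)%N -> (l <= q)%N ->
  ((1 + 'X^q) ^+ m : {poly rat})`_l = (l == 0%N)%:R + (l == q)%:R * m%:R.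
Proof.
move=> q0 lq; elim: m => [|m IH]; first by rewrite expr0 coef1 mulr0 addr0.
rewrite exprS mulrDl mul1r coefD IH coefXnM; case: ltnP => [ltq|leq_ql].
  by rewrite (ltn_eqF ltq) !mul0r !addr0.
have -> : l = q by apply/eqP; rewrite eqn_leq lq.
have -> : ((1 + 'X^q) ^+ m : {poly rat})`_(q - q) = 1.
  by rewrite subnn -horner_coef0 !(hornerE, horner_exp) expr0n (gtn_eqF q0) addr0 expr1n.
by rewrite eqxx -[m.+1%:R]natr1 (gtn_eqF q0) /=; ring.
Qed.

(** With q = 2^j one has (1 + X)^(q m) = (1 + X^q)^m = 1 + m X^q + ... modulo 2. The 1 is cancelled,
    and X^q survives unless m = 1, when X^(q m) cancels it. *)
Lemma power_sum_low_coef j m l : odd m -> (l <= 2 ^ j)%N ->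
  int2 (2^-1 * (((1 + 'X) ^+ (2 ^ j * m) + 'X^(2 ^ j * m) + 1 : {poly rat})`_l
                - ((1 < m) && (l == 2 ^ j))%N%:R)).
Proof.
move=> om lq; set q := (2 ^ j)%N in lq *; have q0 : (0 < q)%N by rewrite expn_gt0.
have m0 : (0 < m)%N by case: m om.
have h : pint 2^-1 ((1 + 'X) ^+ (q * m) - (1 + 'X^q) ^+ m).
  rewrite exprM; apply: pint_cong_exp; last exact: frobenius2.
    by apply: pint_exp; apply: pintD; [exact: pint_1|exact: pint_X].
  by apply: pintD; [exact: pint_1|exact: pint_exp pint_X].
have {h} := h l; rewrite coefB coef_1DXn_exp// => h.
rewrite !coefD coefXn coef1.
have [k mk] : exists k, m = k.*2.+1 by exists m./2; rewrite -[LHS]odd_double_half om.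
(* [r] is the integer left after halving the terms that cancel in pairs; its coefficient [k] is (m -
   1) / 2. *)
pose r : rat := (l == 0%N)%:R + (l == q)%:R * k%:R + ((l == q * m)%N && (m == 1%N))%:R.
have -> : 2^-1 * (((1 + 'X) ^+ (q * m) : {poly rat})`_l + (l == q * m)%N%:R + (l == 0%N)%:R
     - ((1 < m) && (l == q))%N%:R) =
  2^-1 * (((1 + 'X) ^+ (q * m) : {poly rat})`_l - ((l == 0%N)%:R + (l == q)%:R * m%:R)) + r.
  rewrite /r; have [m1|m1] := eqVneq m 1%N.
    have k0 : k = 0%N by lia.
    rewrite m1 k0 muln1 ltnn andbT /= !mulr0 !mulr1.
    by field.
  have -> : (l == q * m)%N = false.
    by apply/negP => /eqP e; move: lq; rewrite e; apply/negP; rewrite -ltnNge;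
      rewrite ltn_Pmulr //; lia.
  have -> : (1 < m)%N by lia.
  have -> : (m%:R : rat) = 2 * k%:R + 1 by rewrite mk -natr1 -mul2n natrM.
  by case: (l == q); case: (l == 0%N) => /=; field.
apply: int2D => //; rewrite /r; apply: int2D; first apply: int2D => //.
  exact: int2M.
exact: int2_nat.
Qed.

Lemma eis_poly_int2 n b : (2 <= n)%N -> int2 (eis_scale n * (eis_poly n)`_b).
Proof.
move=> n2; have [ o [E [Q [oo hE hQ uQ EE]]]] := eis_poly_triangular n2.
have [bn|nb] := leqP b n; last first.
  rewrite (_ : (eis_poly n)`_b = 0) ?mulr0 //; apply/eqP.
  by apply: contraLR nb => /weighted_eis_poly /andP[h _]; rewrite -leqNgt; lia.
have uo := unit2_odd oo; have o0 := unit2_neq0 uo.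
pose c b := o%:R * (eis_scale n * (eis_poly n)`_b).
have hE1 : pint 1 E.
  rewrite -[E](subrK ((1 + 'X) ^+ n + 'X ^+ n + 1)); apply: pintD; first exact: pint_half.
  apply: pintD; last exact: pint_1.
  apply: pintD; apply: pint_exp; last exact: pint_X.
  by apply: pintD; [exact: pint_1|exact: pint_X].
have h i : (i < n.+1)%N -> int2 (1 * E`_i) by move=> _; exact: hE1.
rewrite EE in h.
have := triangular_int (c := c) hQ uQ h (bn : (b < n.+1)%N) bn; rewrite mul1r => h'.
rewrite -[X in int2 X](mulKf o0); apply: int2M => //.
by apply: unit2_int2; exact: unit2V.
Qed.

(** For m > 1 the lowest odd coefficient of the power sum sits at X^(2^j), and triangularity puts
    the first unit of the rescaled [eis_poly n] at the same place. For k = 2n this index is mu(k).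
    The case m = 1, where everything is even, serves the indices that are powers of 2, for which
    s(n) - 2 = -1. *)
Lemma eis_poly_low_coef n j m : n = (2 ^ j * m)%N -> odd m -> (2 <= n)%N ->
  (forall b, (b < 2 ^ j)%N -> int2 (2^-1 * (eis_scale n * (eis_poly n)`_b))) /\
  ((1 < m)%N -> unit2 (eis_scale n * (eis_poly n)`_(2 ^ j))) /\
  (m = 1%N -> forall b, (b < n.+1)%N -> int2 (2^-1 * (eis_scale n * (eis_poly n)`_b))).
Proof.
move=> nE om n2; have [ o [E [Q [oo hE hQ uQ EE]]]] := eis_poly_triangular n2.
have uo := unit2_odd oo; have o0 := unit2_neq0 uo.
have m0 : (0 < m)%N by case: m om {nE}.
pose c b := o%:R * (eis_scale n * (eis_poly n)`_b).
have jn : (2 ^ j < n.+1)%N by rewrite ltnS nE leq_pmulr.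
have hlow l : (l <= 2 ^ j)%N ->
    int2 (2^-1 * (E`_l - ((1 < m) && (l == 2 ^ j))%N%:R)).
  move=> lj; have := int2D (hE l) (power_sum_low_coef om lj).
  by rewrite -nE -mulrDr coefB addrA subrK.
have fixo x : int2 (2^-1 * (o%:R * x)) -> int2 (2^-1 * x).
  move=> h; have -> : 2^-1 * x = (2^-1 * (o%:R * x)) * o%:R^-1 by field.
  by apply: int2M => //; apply: unit2_int2; exact: unit2V.
split; [|split].
- move=> b bj; apply: fixo; apply: (triangular_int (c := c) hQ uQ _ bj); last exact: ltn_trans bj jn.
  move=> i ij; rewrite -EE; have := hlow i (ltnW ij).
  by rewrite (ltn_eqF ij) andbF subr0.
- move=> m1; have := hlow _ (leqnn (2 ^ j)); rewrite m1 eqxx /= => h1.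
  have hb b : (b < 2 ^ j)%N -> int2 (2^-1 * (o%:R * (eis_scale n * (eis_poly n)`_b))).
    move=> bj; apply: (triangular_int (c := c) hQ uQ _ bj); last exact: ltn_trans bj jn.
    move=> i ij; rewrite -EE; have := hlow i (ltnW ij).
    by rewrite (ltn_eqF ij) andbF subr0.
  have h2 := triangular_coef (c := c) hQ jn hb; rewrite -EE /c in h2.
  set x := eis_scale n * _ in h2 *; set Q0 := (Q _)`_0 in h2.
  have uxQ : unit2 (o%:R * x * Q0).
    apply: (unit2_cong (unit2_odd (isT : odd 1))).
    by have := int2B h1 h2; congr int2; ring.
  have Q00 := unit2_neq0 (uQ (2 ^ j)%N).
  have -> : x = (o%:R * x * Q0) * (o%:R^-1 * Q0^-1) by field; rewrite o0 Q00.
  exact: unit2M uxQ (unit2M (unit2V uo) (unit2V (uQ _))).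
move=> m1 b bn; apply: fixo; apply: (triangular_int (c := c) hQ uQ _ bn bn).
move=> i; rewrite -EE nE m1 muln1 ltnS => ij; have := hlow i ij.
by rewrite m1 subr0.
Qed.

(** * Weights 6 * 2 ^ j *)

Lemma eis_scaleE n s : bin_ones n = s.+2 -> eis_scale n = (2 ^+ s)^-1.
Proof.
move=> e; rewrite /eis_scale e !exprS; field.
by rewrite expf_neq0.
Qed.

(** For s(n) >= 2 the bound s(n) - 2 is nonnegative. For n a power of 2 it is -1, and the extra
    factor 2 available there makes up for it. *)
Lemma eis_poly_pint n : (2 <= n)%N -> pint 1 (eis_poly n).
Proof.
move=> n2 b; rewrite mul1r; have [s1|s2] := leqP (bin_ones n) 1.
  have [n0|[a na]] := bin_ones_le1 s1; first by rewrite n0 in n2.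
  have := eis_poly_low_coef (n := n) (j := a) (m := 1); rewrite muln1.
  move=> /(_ na isT n2) [_ [_ /(_ erefl b)]] h.
  have [bn|nb] := ltnP b n.+1; last first.
    rewrite (_ : (eis_poly n)`_b = 0) //; apply/eqP.
    by apply: contraLR nb => /weighted_eis_poly /andP[h' _]; rewrite -ltnNge; lia.
  have s : bin_ones n = 1%N by have := @bin_ones_gt0 n; lia.
  by have := h bn; rewrite /eis_scale s; congr int2; field.
have [s sE] : exists s, bin_ones n = s.+2 by exists (bin_ones n - 2)%N; lia.
have := int2M (int2_nat (2 ^ s)) (eis_poly_int2 b n2); rewrite (eis_scaleE sE).
by rewrite natrX mulrA mulfV ?mul1r// expf_neq0.
Qed.

Lemma eis_poly_bin_ones3 n : (2 < bin_ones n)%N -> pint 2^-1 (eis_poly n).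
Proof.
move=> s3 b; have n2 : (2 <= n)%N.
  by case: n s3 => [|[|n]]; rewrite ?bin_ones0// bin_onesE bin_ones0.
have [s sE] : exists s, bin_ones n = s.+3 by exists (bin_ones n - 3)%N; lia.
have := int2M (int2_nat (2 ^ s)) (eis_poly_int2 b n2); rewrite (eis_scaleE sE).
rewrite natrX mulrA; congr (int2 (_ * _)).
by rewrite exprS invfM mulrC -mulrA mulVf ?mulr1 // expf_neq0.
Qed.

Lemma big_nat_reflect (V : nmodType) (F : nat -> V) (m n m' n' c : nat) :
  (m + n' = c.+1)%N -> (m' + n = c.+1)%N ->
  \sum_(m <= i < n) F i = \sum_(m' <= i < n') F (c - i)%N.
Proof.
move=> h1 h2; rewrite -{1}[m]add0n -{1}[m']add0n !big_addn big_nat_rev /=.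
have -> : (n' - m' = n - m)%N by lia.
by rewrite !big_nat; apply: eq_bigr => i hi; congr F; lia.
Qed.

Lemma eis_poly_double h : (2 <= h)%N ->
  eis_poly (2 * h) = eis_const (2 * h) *:
    (eis_poly h ^+ 2 + 2 * \sum_(2 <= p < h) eis_poly p * eis_poly (2 * h - p)%N).
Proof.
move=> h2; rewrite eis_polyS; last by lia.
congr (_ *: _); rewrite (@big_cat_nat _ _ _ h) /=; [|lia..].
rewrite [X in _ + X]big_ltn; last by lia.
rewrite (@big_nat_reflect _ _ h.+1 (2 * h).-1 2 h (2 * h)); [|lia..].
have -> : (2 * h - h = h)%N by lia.
have -> : \sum_(2 <= i < h) eis_poly (2 * h - i) * eis_poly (2 * h - (2 * h - i)) =
  \sum_(2 <= i < h) eis_poly i * eis_poly (2 * h - i).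
  rewrite !big_nat; apply: eq_bigr => i hi; rewrite mulrC; congr (eis_poly _ * _); lia.
by rewrite expr2; ring.
Qed.

Lemma eis_const_unit2 n : (4 <= n)%N -> ~~ odd n -> unit2 (eis_const n).
Proof.
move=> n4 en; apply: unit2M; first exact: (@unit2_odd 3).
by apply: unit2V; apply: unit2_odd; rewrite oddM /= oddB; lia.
Qed.

Lemma pintZ_unit2_half c p q : unit2 c -> pint 1 p -> pint 2^-1 (p - q) ->
  pint 2^-1 (c *: p - q).
Proof.
move=> uc hp hpq; have -> : c *: p - q = (c - 1) *: p + (p - q).
  by rewrite scalerBl scale1r addrA subrK.
apply: pintD => // i; rewrite coefZ mulrA.
apply: int2M; last by rewrite -[X in int2 X]mul1r.
case: uc => a [b [oa ob ab]].
have [k ak] : exists k : int, a - b%:Z = 2 * k by exists ((a - b%:Z) %/ 2)%Z; lia.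
exists k, b; split => //; rewrite -mulrA mulrBl ab mul1r.
have -> : a%:~R - b%:R = (a - b%:Z)%:~R :> rat by rewrite rmorphB.
by rewrite ak rmorphM /=; field.
Qed.

Lemma eis_poly_double_mod2 h : (2 <= h)%N ->
  pint 2^-1 (eis_poly (2 * h) - eis_poly h ^+ 2).
Proof.
move=> h2; rewrite eis_poly_double//.
have hS : pint 1 (\sum_(2 <= p < h) eis_poly p * eis_poly (2 * h - p)).
  rewrite big_nat; apply: pint_sum => p hp.
  by apply: pint_1M; apply: eis_poly_pint; lia.
have hh : pint 1 (eis_poly h) by exact: eis_poly_pint.
apply: pintZ_unit2_half.
- by apply: eis_const_unit2; lia.
- by apply: pintD; [exact: pint_exp|exact: pint_natMl].
by rewrite addrAC subrr add0r; exact: pint_double.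
Qed.

Lemma bin_ones_odd_le2 p : odd p -> (2 <= p)%N -> (bin_ones p <= 2)%N ->
  exists a, p = (2 ^ a.+1).+1.
Proof.
move=> op p2; rewrite bin_onesE => h.
have h1 : (bin_ones (p %/ 2) <= 1)%N by lia.
have [z|[a e]] := bin_ones_le1 h1; first by lia.
by exists a; rewrite expnS -e; lia.
Qed.

(* A sum (2^a + 1) + (2^b + 1) of distinct terms is never 3 * 2^(i+3), so modulo 2
   only the even indices contribute to [eis_cross]. *)
Lemma bin_ones_3pow2_odd i p : odd p -> (2 <= p)%N -> (p.+2 <= 3 * 2 ^ i.+3)%N ->
  p != (3 * 2 ^ i.+3 - p)%N ->
  (2 < bin_ones p)%N || (2 < bin_ones (3 * 2 ^ i.+3 - p))%N.
Proof.
move=> op p2 pn pq; apply/negPn/negP.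
rewrite negb_or -!leqNgt => /andP[sp sq].
have [a pa] := bin_ones_odd_le2 op p2 sp.
have e8 : (2 ^ i.+3 = 8 * 2 ^ i)%N by rewrite !expnS; lia.
have oq : odd (3 * 2 ^ i.+3 - p) by lia.
have q2 : (2 <= 3 * 2 ^ i.+3 - p)%N by lia.
have [b qb] := bin_ones_odd_le2 oq q2 sq.
have i0 : (0 < 2 ^ i)%N by rewrite expn_gt0.
have {sp sq} e : (2 ^ a.+1 + 2 ^ b.+1 + 2 = 24 * 2 ^ i)%N by lia.
have neq : a != b by apply: contraNneq pq => ab; rewrite qb -ab pa.
(* Each power is 2, 4 or a multiple of 8, and the two distinct powers plus 2 give a multiple of 8:
   only 2 + 4 + 2 = 8 remains, and it is smaller than 24. *)
have sh (x : nat) : x = 0%N \/ x = 1%N \/ exists k, (2 ^ x.+1 = 8 * k)%N.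
  case: x => [|[|x]]; [by left|by right; left|right; right].
  by exists (2 ^ x)%N; rewrite !expnS; lia.
by case: (sh a) => [a0|[a1|[k ak]]]; case: (sh b) => [b0|[b1|[l bl]]];
  move: e neq; rewrite ?a0 ?a1 ?b0 ?b1 ?ak ?bl ?expnS ?expn0; lia.
Qed.

(** Disposes of the term c_2 c_(n-2): its index 2 is even, but half of it lies below the range of
    the shorter sum. *)
Lemma bin_ones_3pow2_sub2 i : (2 < bin_ones (3 * 2 ^ i.+3 - 2))%N.
Proof.
have i0 : (0 < 2 ^ i)%N by rewrite expn_gt0.
have -> : (3 * 2 ^ i.+3 - 2 = 2 * (12 * 2 ^ i - 1))%N by rewrite !expnS; lia.
rewrite bin_ones_double ltnNge; apply/negP => h.
have o12 : odd (12 * 2 ^ i - 1) by lia.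
have g2 : (2 <= 12 * 2 ^ i - 1)%N by lia.
have [a e] := bin_ones_odd_le2 o12 g2 h.
case: a e => [|a]; rewrite !expnS; lia.
Qed.

Lemma pint_sum_sqr (I : eqType) (r : seq I) (F : I -> {poly rat}) :
  (forall i, i \in r -> pint 1 (F i)) ->
  pint 2^-1 ((\sum_(i <- r) F i) ^+ 2 - \sum_(i <- r) F i ^+ 2).
Proof.
elim: r => [|x r IH] h; first by rewrite !big_nil expr0n subrr; exact: pint_0.
rewrite !big_cons; set S := \sum_(j <- r) F j.
have hS : pint 1 S.
  by rewrite /S big_seq; apply: pint_sum => i ir; apply: h; rewrite inE ir orbT.
have hx : pint 1 (F x) by apply: h; rewrite inE eqxx.
set S2 := \sum_(j <- r) F j ^+ 2.
have -> : (F x + S) ^+ 2 - (F x ^+ 2 + S2) = (S ^+ 2 - S2) + 2 * (F x * S) by ring.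
apply: pintD; last by apply: pint_double; exact: pint_1M.
by apply: IH => i ir; apply: h; rewrite inE ir orbT.
Qed.

Lemma big_nat_parity (V : nmodType) (F : nat -> V) h : (0 < h)%N ->
  \sum_(2 <= p < 2 * h) F p =
  \sum_(1 <= p < h) F (2 * p)%N + \sum_(1 <= p < h) F (2 * p).+1.
Proof.
elim: h => // h IH _; have [->|h0] := posnP h; first by rewrite muln1 !big_geq// addr0.
have -> : (2 * h.+1 = (2 * h).+2)%N by lia.
rewrite !big_nat_recr /=; [|lia..]; rewrite IH// addrACA -!addrA.
by congr (_ + _); rewrite addrCA.
Qed.

Definition eis_cross h := \sum_(2 <= p < h) eis_poly p * eis_poly (2 * h - p)%N.

Lemma eis_cross_pint h : pint 1 (eis_cross h).
Proof.
rewrite /eis_cross big_nat; apply: pint_sum => p hp.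
by apply: pint_1M; apply: eis_poly_pint; lia.
Qed.

(** At even indices c_(2p) = c_p^2 modulo 2, so these terms are squares of the terms for half the
    index, and modulo 2 a sum of squares is the square of the sum. *)
Lemma eis_cross_step i : pint 2^-1
  (eis_cross (3 * 2 ^ i.+2) - eis_cross (3 * 2 ^ i.+1) ^+ 2).
Proof.
have i0 : (0 < 2 ^ i)%N by rewrite expn_gt0.
set h := (3 * 2 ^ i.+1)%N; have h2 : (3 * 2 ^ i.+2 = 2 * h)%N by rewrite /h !expnS; lia.
have h6 : (6 <= h)%N by rewrite /h !expnS; lia.
have hn : (3 * 2 ^ i.+3 = 2 * (2 * h))%N by rewrite /h !expnS; lia.
rewrite h2 /eis_cross big_nat_parity; last by lia.
set A := \sum_(1 <= p < h) _; set B := \sum_(1 <= p < h) _; set S := \sum_(2 <= p < h) _.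
have hB : pint 2^-1 B.
  rewrite /B big_nat; apply: pint_sum => p hp.
  have : (2 < bin_ones (2 * p).+1)%N || (2 < bin_ones (3 * 2 ^ i.+3 - (2 * p).+1))%N.
    by apply: bin_ones_3pow2_odd; lia.
  rewrite hn => /orP[/eis_poly_bin_ones3 c|/eis_poly_bin_ones3 c].
    by apply: pint_M1 => //; apply: eis_poly_pint; lia.
  by apply: pint_1M => //; apply: eis_poly_pint; lia.
have hA : pint 2^-1 (A - \sum_(2 <= p < h) (eis_poly p * eis_poly (2 * h - p)) ^+ 2).
  rewrite /A big_ltn; last by lia.
  rewrite -addrA -sumrB; apply: pintD.
    apply: pint_1M; first exact: eis_poly_pint.
    by rewrite -hn; apply: eis_poly_bin_ones3; exact: bin_ones_3pow2_sub2.
  rewrite big_nat; apply: pint_sum => p hp.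
  have -> : (2 * (2 * h) - 2 * p = 2 * (2 * h - p))%N by lia.
  have p2 : (2 <= p)%N by lia.
  have q2 : (2 <= 2 * h - p)%N by lia.
  rewrite exprMn.
  have -> : forall a b c d : {poly rat}, a * b - c * d = a * (b - d) + (a - c) * d.
    by move=> a b c d; ring.
  apply: pintD.
    by apply: pint_1M; [apply: eis_poly_pint; lia|exact: eis_poly_double_mod2].
  by apply: pint_M1; [exact: eis_poly_double_mod2|apply: pint_exp; exact: eis_poly_pint].
have hS : pint 2^-1 (S ^+ 2 - \sum_(2 <= p < h) (eis_poly p * eis_poly (2 * h - p)) ^+ 2).
  apply: pint_sum_sqr => p; rewrite mem_index_iota => hp.
  by apply: pint_1M; apply: eis_poly_pint; lia.
have := pintD hB (pintB hA hS); congr (pint _ _); ring.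
Qed.

Lemma eis_poly4 : eis_poly 4 = 3%:P.
Proof.
rewrite eis_polyS// big_nat1 eis_poly2 -polyCM -mul_polyC -polyCM.
by congr (_%:P); rewrite /eis_const; field.
Qed.

Lemma eis_poly5 : eis_poly 5 = (45 / 11) *: 'X.
Proof.
rewrite eis_polyS// big_ltn// big_nat1 eis_poly2 eis_poly3 mul_polyC -scalerAl.
rewrite [_ * 3%:P]mulrC mul_polyC !scalerA -scalerDl scalerA.
by congr (_ *: _); rewrite /eis_const; field.
Qed.

Lemma pint_congM p p' q q' : pint 1 p -> pint 1 q' ->
  pint 2^-1 (p - p') -> pint 2^-1 (q - q') -> pint 2^-1 (p * q - p' * q').
Proof.
move=> hp hq' h h'; have -> : p * q - p' * q' = p * (q - q') + (p - p') * q' by ring.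
by apply: pintD; [exact: pint_1M|exact: pint_M1].
Qed.

(** The doubling argument can start only here: from h = 3 it would meet 12 = 3 + 9, two numbers with
    two binary digits 1, and this very pair contributes X^4. Hence the entries up to c_10 are
    reduced modulo 2 by hand. *)
Lemma eis_cross_12 : pint 2^-1 (eis_cross 6 - (1 + 'X^4)).
Proof.
have pX k : pint 1 'X^k := pint_exp k pint_X.
have pE n : (2 <= n)%N -> pint 1 (eis_poly n) by exact: eis_poly_pint.
have cC (a : rat) : int2 (2^-1 * (a - 1)) -> forall p, pint 1 p -> pint 2^-1 (a *: p - p).
  move=> ha p hp; have -> : a *: p - p = (a - 1) *: p by rewrite scalerBl scale1r.
  by move=> i; rewrite coefZ mulrA; apply: int2M => //; rewrite -[X in int2 X]mul1r.
have c2 : pint 2^-1 (eis_poly 2 - 1).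
  rewrite eis_poly2 -alg_polyC; apply: cC; last exact: pint_1.
  by rewrite (_ : _ * _ = 1)//; field.
have c3 : pint 2^-1 (eis_poly 3 - 'X).
  rewrite eis_poly3; apply: cC; last exact: pint_X.
  by rewrite (_ : _ * _ = 2%:R)//; field.
have c4 : pint 2^-1 (eis_poly 4 - 1) by rewrite eis_poly4 -eis_poly2.
have c5 : pint 2^-1 (eis_poly 5 - 'X).
  rewrite eis_poly5; apply: cC; last exact: pint_X.
  rewrite (_ : _ * _ = 17%:R * 11%:R^-1); last by field.
  by apply: int2M => //; exact: int2_oddV.
have csq h q : (2 <= h)%N -> pint 1 q -> pint 2^-1 (eis_poly h - q) ->
    pint 2^-1 (eis_poly (2 * h) - q ^+ 2).
  move=> h2 hq hpq; have := pintD (eis_poly_double_mod2 h2) (pint_cong_exp 2 (pE _ h2) hq hpq).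
  by rewrite addrA subrK.
have c6 : pint 2^-1 (eis_poly 6 - 'X ^+ 2) := csq 3 _ isT pint_X c3.
have c8 := csq 4 _ isT pint_1 c4.
have c10 := csq 5 _ isT pint_X c5.
have c7 : pint 2^-1 (eis_poly 7 - 0).
  rewrite subr0; apply: eis_poly_bin_ones3.
  by rewrite !(bin_onesE 7, bin_onesE 3, bin_onesE 1) bin_ones0.
have c9 : pint 2^-1 (eis_poly 9 - (1 * 0 + 'X * 'X ^+ 2 + 1 * 'X)).
  have -> : eis_poly 9 = 19^-1 *: (eis_poly 2 * eis_poly 7 + eis_poly 3 * eis_poly 6
      + eis_poly 4 * eis_poly 5).
    rewrite eis_polyS// 6?big_ltn// big_geq//=.
    have -> : (9 - 2 = 7)%N by []. have -> : (9 - 3 = 6)%N by []. have -> : (9 - 4 = 5)%N by [].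
    have -> : (9 - 5 = 4)%N by []. have -> : (9 - 6 = 3)%N by []. have -> : (9 - 7 = 2)%N by [].
    (* For an odd index the constant is not a unit; its factor 1/2 is absorbed by the symmetry of
       the sum under p -> 9 - p. *)
    have -> : eis_const 9 = 19^-1 / 2.
      by rewrite /eis_const (_ : (9 - 3) * (2 * 9).+1 = 114)%N//; field.
    rewrite -scalerA; congr (_ *: _); apply: (@scalerI _ _ 2) => //.
    by rewrite scalerA mulfV// scale1r scaler_nat; ring.
  apply: pintZ_unit2_half; first by apply: unit2V; exact: (@unit2_odd 19).
    by apply: pintD; first apply: pintD; apply: pint_1M; exact: pE.
  rewrite !opprD !addrA; set a := _ * _; set b := _ * _; set c := eis_poly 4 * _.
  have -> : forall x y z, a + b + c - x - y - z = (a - x) + (b - y) + (c - z).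
    by move=> x y z; ring.
  apply: pintD; first apply: pintD; apply: pint_congM => //; try exact: pE.
  - exact: pint_0.
  - exact: pint_X.
rewrite /eis_cross 4?big_ltn// big_geq//.
have -> : (2 * 6 - 2 = 2 * 5)%N by []. have -> : (2 * 6 - 3 = 9)%N by [].
have -> : (2 * 6 - 4 = 2 * 4)%N by []. have -> : (2 * 6 - 5 = 7)%N by [].
set a := _ * _; set b := _ * _; set c := eis_poly 4 * _; set d := eis_poly 5 * _.
(* Modulo 2, c_2 c_10 is X^2, c_3 c_9 is X (X^3 + X), c_4 c_8 is 1 and c_5 c_7 is 0; the two X^2
   cancel. *)
have -> : a + (b + (c + (d + 0))) - (1 + 'X^4) =
  (a - 1 * 'X ^+ 2) + (b - 'X * (1 * 0 + 'X * 'X ^+ 2 + 1 * 'X)) + (c - 1 * 1 ^+ 2)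
   + (d - 'X * 0) + 2 * 'X^2 by ring.
apply: pintD; last exact: pint_double.
apply: pintD; first apply: pintD; first apply: pintD; apply: pint_congM => //; try exact: pE.
- by apply: pintD; first apply: pintD; apply: pint_1M => //; exact: pint_0 || exact: pint_1 || exact: pint_X.
- exact: pint_exp pint_1.
- exact: pint_0.
Qed.

Lemma eis_cross_mod2 i : pint 2^-1 (eis_cross (3 * 2 ^ i.+1) - (1 + 'X^(2 ^ i.+2))).
Proof.
elim: i => [|i IH]; first exact: eis_cross_12.
have -> : eis_cross (3 * 2 ^ i.+2) - (1 + 'X^(2 ^ i.+3)) =
  (eis_cross (3 * 2 ^ i.+2) - eis_cross (3 * 2 ^ i.+1) ^+ 2) +
  (eis_cross (3 * 2 ^ i.+1) ^+ 2 - (1 + 'X^(2 ^ i.+2)) ^+ 2) + 2 * 'X^(2 ^ i.+2).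
  have -> : 'X^(2 ^ i.+3) = 'X^(2 ^ i.+2) ^+ 2 :> {poly rat} by rewrite -exprM -expnSr.
  ring.
have hX k : pint 1 'X^k by exact: pint_exp pint_X.
apply: pintD; last exact: pint_double.
apply: pintD; first exact: eis_cross_step.
apply: pint_cong_exp => //; first exact: eis_cross_pint.
by apply: pintD => //; exact: pint_1.
Qed.

Lemma pint_cst_half p : pint 2^-1 p -> pint 4^-1 (2 * p).
Proof.
move=> hp i; rewrite -(polyC_natr _ 2) coefCM mulrA.
by rewrite (_ : 4^-1 * 2%:R = 2^-1) //; field.
Qed.

Lemma eis_poly_3pow2_mod2 i : pint 2^-1 (eis_poly (3 * 2 ^ i) - 'X^(2 ^ i)).
Proof.
have i0 k : (0 < 2 ^ k)%N by rewrite expn_gt0.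
elim: i => [|i IH].
  rewrite muln1 expr1 eis_poly3.
  have -> : 5 *: 'X - 'X = 2 * (2%:R * 'X) :> {poly rat}.
    by rewrite scaler_nat; ring.
  by apply: pint_double; apply: pint_natMl; exact: pint_X.
have -> : (3 * 2 ^ i.+1 = 2 * (3 * 2 ^ i))%N by rewrite expnS; lia.
have -> : 'X^(2 ^ i.+1) = 'X^(2 ^ i) ^+ 2 :> {poly rat} by rewrite -exprM -expnSr.
have h2 : (2 <= 3 * 2 ^ i)%N by have := i0 i; lia.
have := pintD (eis_poly_double_mod2 h2)
  (pint_cong_exp 2 (eis_poly_pint h2) (pint_exp (2 ^ i) pint_X) IH).
by rewrite addrA subrK.
Qed.

Lemma eis_cross_3pow2 i : exists c : nat,
  pint 2^-1 (eis_cross (3 * 2 ^ i) - (1 + c%:R * 'X^(2 ^ i.+1))).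
Proof.
case: i => [|i]; last by exists 1%N; rewrite mul1r; exact: eis_cross_mod2.
exists 0%N; rewrite mul0r addr0 /eis_cross muln1 big_nat1 eis_poly2 eis_poly4.
have -> : 3%:P * 3%:P - 1 = 2 * 4%:R :> {poly rat} by rewrite polyC_natr; ring.
by apply: pint_double; exact: pint_nat.
Qed.

(** A congruence modulo 2 squares to one modulo 4: c_h = X^(2^i) modulo 2 gives c_h^2 = X^Q modulo
    4, and the doubled cross terms add 2 (1 + c X^Q). Whatever the integer [c], X^Q keeps a unit
    coefficient, the constant one is twice a unit, and 4 divides the others. *)
Lemma eis_poly_3pow2_coef i (n := (3 * 2 ^ i.+1)%N) :
  [/\ unit2 (eis_poly n)`_(2 ^ i.+1), unit2 (2^-1 * (eis_poly n)`_0)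
    & forall b, b != 0%N -> b != (2 ^ i.+1)%N -> int2 (4^-1 * (eis_poly n)`_b)].
Proof.
have i0 : (0 < 2 ^ i)%N by rewrite expn_gt0.
set Q := (2 ^ i.+1)%N; pose h := (3 * 2 ^ i)%N.
have nE : n = (2 * h)%N by rewrite /n /h expnS; lia.
have h2 : (2 <= h)%N by rewrite /h; lia.
have Q0 : (0 == Q)%N = false by rewrite /Q expnS; lia.
have [c hc] := eis_cross_3pow2 i.
pose D := (eis_poly h ^+ 2 + 2 * eis_cross h) - ('X^Q + 2 * (1 + c%:R * 'X^Q)).
have hD : pint 4^-1 D.
  have -> : D = ((eis_poly h - 'X^(2 ^ i)) ^+ 2 + 2 * ('X^(2 ^ i) * (eis_poly h - 'X^(2 ^ i))))
     + 2 * (eis_cross h - (1 + c%:R * 'X^Q)).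
    by rewrite /D /Q expnSr exprM; ring.
  have hm := eis_poly_3pow2_mod2 i.
  apply: pintD; last exact: pint_cst_half.
  apply: pintD; last by apply: pint_cst_half; apply: pint_1M => //; exact: pint_exp pint_X.
  by have := pintM hm hm; congr (pint _ _); field.
pose eps := eis_const n.
have ueps : unit2 eps by apply: eis_const_unit2; rewrite nE; lia.
have coefE b : (eis_poly n)`_b = eps * ((b == Q)%:R + 2 * ((b == 0%N)%:R + c%:R * (b == Q)%:R)
    + 4 * (4^-1 * D`_b)).
  rewrite nE eis_poly_double// -nE coefZ; congr (_ * _).
  have -> : eis_poly h ^+ 2 + 2 * \sum_(2 <= p < h) eis_poly p * eis_poly (n - p)%N =
     'X^Q + 2 * (1 + c%:R * 'X^Q) + D by rewrite /D /eis_cross nE; ring.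
  rewrite coefD coefD coefXn -(polyC_natr _ 2) coefCM coefD coef1.
  by rewrite -(polyC_natr _ c) coefCM coefXn; field.
have hDb b := hD b.
split=> [||b b0 bQ]; rewrite coefE ?eqxx ?Q0 ?(gtn_eqF i0).
- have -> : (Q == 0)%N = false by rewrite eq_sym.
  apply: unit2M => //.
  have -> : 1%:R + 2 * (0%:R + c%:R * 1%:R) + 4 * (4^-1 * D`_Q) =
    1 + 2 * (c%:R + 2 * (4^-1 * D`_Q)) by field.
  by apply: unit2_1D; apply: int2D => //; exact: int2M.
- have -> : 2^-1 * (eps * (0%:R + 2 * (1%:R + c%:R * 0%:R) + 4 * (4^-1 * D`_0))) =
    eps * (1 + 2 * (4^-1 * D`_0)) by field.
  by apply: unit2M => //; exact: unit2_1D.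
rewrite (negPf b0) (negPf bQ).
have -> : 4^-1 * (eps * (0%:R + 2 * (0%:R + c%:R * 0%:R) + 4 * (4^-1 * D`_b))) =
  eps * (4^-1 * D`_b) by field.
by apply: int2M => //; exact: unit2_int2.
Qed.

(** * From the coefficients to the stated valuations *)

Lemma valuation_of_coef (k : nat) (w : nat -> rat) :
  (6 <= k)%N -> ~~ odd k -> ~~ is_pow2 k ->
  (forall b, admissible k b -> W w k b = (eis_poly (k %/ 2))`_b / k.-1%:R) ->
  (v2 (W w k (mu k)) = (lambda k)%:E%E /\
     (forall b : nat, admissible k b -> (b < mu k)%N ->
        ((lambda k)%:E < v2 (W w k b))%E)) /\
  (forall n : nat, is_pow2 n -> k = (6 * n)%N ->
     v2 (W w k n) = 0%:E%E /\
     ((2 <= n)%N -> v2 (W w k 0) = 1%:E%E) /\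
     (forall b : nat, admissible k b -> b <> 0%N -> b <> n ->
        (1%:E < v2 (W w k b))%E)).
Proof.
move=> k6 ek kp hW; set n := (k %/ 2)%N in hW.
have kE : k = (2 * n)%N by rewrite /n; lia.
have n2 : (2 <= n)%N by lia.
(* Dividing (k - 1) G_k by the odd number k - 1 changes no valuation. *)
have uk : unit2 (k.-1%:R^-1) by apply: unit2V; apply: unit2_odd; lia.
split.
  have [j [m [nE om jE]]] : exists j m, [/\ n = (2 ^ j * m)%N, odd m & j = logn 2 n].
    have n0 : (0 < n)%N by lia.
    have [m cm e] := pfactor_coprime (isT : prime 2) n0.
    by exists (logn 2 n), m; rewrite mulnC -coprime2n.
  have m1 : (1 < m)%N.
    case: (ltnP 1 m) => // m1; case/negP: kp; apply/is_pow2P; exists j.+1.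
    have mE : m = 1%N by case: (m) om m1 => [|[]].
    by rewrite kE nE expnS mE muln1.
  have [hlow [/(_ m1) hmu _]] := eis_poly_low_coef nE om n2.
  have j0 : (0 < 2 ^ j)%N by rewrite expn_gt0.
  have muE : mu k = (2 ^ j)%N.
    by rewrite /mu (negPf kp) kE lognM ?jE//; lia.
  have [s sE] : exists s, bin_ones n = s.+2.
    exists (bin_ones n - 2)%N; suff : (1 < bin_ones n)%N by lia.
    rewrite ltnNge; apply/negP => /bin_ones_le1[n0|[a na]]; first by lia.
    by case/negP: kp; apply/is_pow2P; exists a.+1; rewrite kE na expnS.
  have lE : lambda k = s%:Z.
    by rewrite /lambda (negPf kp) kE bin_ones_double sE; lia.
  have t0 : 2 ^+ s != 0 :> rat by rewrite expf_neq0.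
  have wE b : (eis_poly n)`_b / k.-1%:R =
     2 ^+ s * (eis_scale n * (eis_poly n)`_b * k.-1%:R^-1).
    by rewrite (eis_scaleE sE) !mulrA mulfV// mul1r.
  rewrite muE lE; split.
    rewrite hW; last first.
      (* An odd m > 1 is at least 3 with m - 3 even, which is the admissibility of 2^j. *)
      have [l ml] : exists l, m = (l.*2 + 3)%N by exists ((m - 3) %/ 2)%N; lia.
      rewrite /admissible kE nE ml; apply/andP; split; first by nia.
      have -> : (2 * (2 ^ j * (l.*2 + 3)) - 6 * 2 ^ j = 4 * (2 ^ j * l))%N by nia.
      exact: dvdn_mulr.
    by rewrite wE; apply: v2_unit2; exact: unit2M.
  move=> b ab bj; rewrite hW// wE.
  have -> : 2 ^+ s * (eis_scale n * (eis_poly n)`_b * k.-1%:R^-1) =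
    2 ^+ s.+1 * (2^-1 * (eis_scale n * (eis_poly n)`_b) * k.-1%:R^-1).
    by rewrite exprSr -[RHS]mulrA; congr (_ * _); rewrite !mulrA mulfV// mul1r.
  apply: lt_le_trans (v2_int2 _ _); first by rewrite lte_fin; lia.
  by apply: int2M; [exact: hlow|exact: unit2_int2].
move=> n' /is_pow2P[i n'E] kn'.
have nE : n = (3 * 2 ^ i)%N by rewrite -n'E; lia.
have an : admissible k n' by rewrite /admissible kn' leqnn subnn dvdn0.
case: i n'E nE => [|i] n'E nE.
  have k6E : k = 6%N by rewrite kn' n'E.
  split; [|split].
  - rewrite hW// -[_ / _]mul1r -(expr0 2) (v2_unit2 0)//.
    apply: unit2M => //; rewrite nE n'E muln1 eis_poly3 coefZ coefX mulr1.
    exact: (@unit2_odd 5).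
  - by rewrite n'E.
  move=> b; rewrite /admissible k6E n'E; case: b => [|[|b]] // /andP[]; lia.
have [u1 u2 u3] := eis_poly_3pow2_coef i; rewrite -nE in u1 u2 u3.
split; [|split].
- rewrite hW// -[_ / _]mul1r -(expr0 2) (v2_unit2 0)//.
  by apply: unit2M => //; rewrite n'E.
- move=> _; rewrite hW.
    have -> : (eis_poly n)`_0 / k.-1%:R = 2 ^+ 1 * (2^-1 * (eis_poly n)`_0 * k.-1%:R^-1).
      by rewrite expr1 !mulrA mulfV// mul1r.
    by apply: (v2_unit2 1); exact: unit2M.
  by rewrite /admissible muln0 leq0n subn0 kn' n'E expnS; apply/dvdnP; exists (3 * 2 ^ i)%N; lia.
move=> b ab /eqP b0 /eqP bn; rewrite hW//.
have -> : (eis_poly n)`_b / k.-1%:R = 2 ^+ 2 * (4^-1 * (eis_poly n)`_b * k.-1%:R^-1).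
  by rewrite !mulrA (_ : 2 ^+ 2 * 4^-1 = 1) ?mul1r//; field.
apply: lt_le_trans (v2_int2 2 _); first by rewrite lte_fin.
by apply: int2M; [apply: u3 => //; rewrite -n'E|exact: unit2_int2].
Qed.

(** * Unconditional sums of complex families *)

Section ComplexModulus.
Variable R : realType.
Implicit Types (x y z : R[i]) (r : R).

(** The norm of [R[i]] takes its values in [R[i]]; a real-valued copy allows order arguments in
    [R]. *)
Definition cmod (z : R[i]) : R := Normc.normc z.

Lemma normr_cmod z : `|z| = (cmod z)%:C.
Proof. by case: z. Qed.
Lemma cmod_ge0 z : 0 <= cmod z.
Proof. by case: z => a b; rewrite /cmod /=; exact: sqrtr_ge0. Qed.
Lemma cmodM x y : cmod (x * y) = cmod x * cmod y.
Proof. exact: Normc.normcM. Qed.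
Lemma cmodV x : cmod x^-1 = (cmod x)^-1.
Proof. exact: Normc.normcV. Qed.
Lemma cmod0 : cmod (0 : R[i]) = 0.
Proof. exact: Normc.normc0. Qed.
Lemma cmod_eq0 x : (cmod x == 0) = (x == 0).
Proof.
by apply/eqP/eqP => [|->]; [exact: Normc.eq0_normc|exact: cmod0].
Qed.
Lemma cmodD x y : cmod (x + y) <= cmod x + cmod y.
Proof. exact: le_normcD. Qed.
Lemma cmodN x : cmod (- x) = cmod x.
Proof. exact: normcN. Qed.
Lemma cmodB x y : cmod (x - y) <= cmod x + cmod y.
Proof. by rewrite -[cmod y]cmodN; exact: cmodD. Qed.
Lemma cmod1 : cmod (1 : R[i]) = 1.
Proof. exact: Normc.normc1. Qed.
Lemma cmodX x n : cmod (x ^+ n) = cmod x ^+ n.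
Proof. by elim: n => [|n IH]; rewrite ?expr0 ?cmod1// !exprS cmodM IH. Qed.
Lemma cmodR r : cmod r%:C = `|r|.
Proof. by rewrite /cmod /= expr0n /= addr0 sqrtr_sqr. Qed.
Lemma cmod_sum (I : Type) (s : seq I) (F : I -> R[i]) :
  cmod (\sum_(i <- s) F i) <= \sum_(i <- s) cmod (F i).
Proof.
elim: s => [|i s IH]; first by rewrite !big_nil cmod0.
by rewrite !big_cons (le_trans (cmodD _ _))// lerD2l.
Qed.

Lemma Re_sum (I : Type) (s : seq I) (F : I -> R[i]) :
  complex.Re (\sum_(i <- s) F i) = \sum_(i <- s) complex.Re (F i).
Proof.
elim: s => [|i s IH]; first by rewrite !big_nil.
by rewrite !big_cons -IH; case: (F i); case: (\sum_(i <- s) _).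
Qed.
Lemma ReD x y : complex.Re (x + y) = complex.Re x + complex.Re y.
Proof. by case: x; case: y. Qed.
Lemma ReN x : complex.Re (- x) = - complex.Re x.
Proof. by case: x. Qed.
Lemma ReB x y : complex.Re (x - y) = complex.Re x - complex.Re y.
Proof. by rewrite ReD ReN. Qed.
Lemma Re_cmod z : `|complex.Re z| <= cmod z.
Proof.
case: z => a b; rewrite /cmod /= -sqrtr_sqr ler_wsqrtr// lerDl sqr_ge0//.
Qed.
Lemma Im_cmod z : `|complex.Im z| <= cmod z.
Proof.
case: z => a b; rewrite /cmod /= -sqrtr_sqr ler_wsqrtr// lerDr sqr_ge0//.
Qed.
Lemma sum_realC (I : Type) (s : seq I) (F : I -> R) :
  (\sum_(i <- s) F i)%:C = \sum_(i <- s) (F i)%:C.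
Proof. exact: rmorph_sum. Qed.
End ComplexModulus.

Section HasSum.
Variable R : realType.
Local Notation C := R[i].

(** Unconditional summation phrased with duplicate-free lists, which keeps filters out of all
    rearrangements. *)
Definition has_sum (I : eqType) (f : I -> C) (s : C) : Prop :=
  forall e : R, 0 < e -> exists A : seq I, forall B : seq I,
    uniq B -> {subset A <= B} -> cmod (\sum_(i <- B) f i - s) < e.

Definition bounded_sum (I : eqType) (g : I -> R) : Prop :=
  exists M : R, forall B : seq I, uniq B -> \sum_(i <- B) g i <= M.

Definition abs_summable (I : eqType) (f : I -> C) : Prop :=
  bounded_sum (fun i => cmod (f i)).

Section OneIndex.
Variable I : eqType.
Implicit Types (f g : I -> C) (s t : C).

Lemma has_sum_unique f s t : has_sum f s -> has_sum f t -> s = t.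
Proof.
move=> hs ht; apply/eqP; rewrite -subr_eq0 -cmod_eq0; apply/eqP.
apply/eqP; rewrite eq_le cmod_ge0 andbT; apply/ler_addgt0Pl => e e0; rewrite addr0.
have e2 : 0 < e / 2 by rewrite divr_gt0.
have [A hA] := hs _ e2; have [B hB] := ht _ e2.
pose D := undup (A ++ B).
have uD : uniq D by exact: undup_uniq.
have := hA D uD; have := hB D uD => h2 h1.
have {}h1 : cmod (\sum_(i <- D) f i - s) < e / 2.
  by apply: h1 => i iA; rewrite mem_undup mem_cat iA.
have {}h2 : cmod (\sum_(i <- D) f i - t) < e / 2.
  by apply: h2 => i iA; rewrite mem_undup mem_cat iA orbT.
have -> : s - t = (\sum_(i <- D) f i - t) - (\sum_(i <- D) f i - s) by ring.
rewrite (le_trans (cmodB _ _))// [e]splitr lerD// ltW//.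
Qed.

Lemma has_sum_ext f g s : f =1 g -> has_sum f s -> has_sum g s.
Proof. by move=> /funext ->. Qed.

Lemma has_sum0 : has_sum (fun _ : I => 0) 0.
Proof. by move=> e e0; exists [::] => B _ _; rewrite big1 ?subrr ?cmod0. Qed.

Lemma has_sumD f g s t : has_sum f s -> has_sum g t ->
  has_sum (fun i => f i + g i) (s + t).
Proof.
move=> hs ht e e0; have e2 : 0 < e / 2 by rewrite divr_gt0.
have [A hA] := hs _ e2; have [B hB] := ht _ e2.
exists (A ++ B) => D uD sD; rewrite big_split /= opprD addrACA.
rewrite (le_lt_trans (cmodD _ _))// [e]splitr ltrD//.
  by apply: hA => // i iA; apply: sD; rewrite mem_cat iA.
by apply: hB => // i iA; apply: sD; rewrite mem_cat iA orbT.
Qed.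

Lemma has_sumZ c f s : has_sum f s -> has_sum (fun i => c * f i) (c * s).
Proof.
move=> hs e e0; have c0 : 0 < cmod c + 1 by rewrite ltr_wpDl ?cmod_ge0.
have [A hA] := hs _ (divr_gt0 e0 c0).
exists A => B uB sB; rewrite -mulr_sumr -mulrBr cmodM.
rewrite (@le_lt_trans _ _ ((cmod c + 1) * cmod (\sum_(i <- B) f i - s)))//.
  by rewrite ler_wpM2r ?cmod_ge0// lerDl.
by rewrite mulrC -ltr_pdivlMr//; exact: hA.
Qed.

Lemma has_sumN f s : has_sum f s -> has_sum (fun i => - f i) (- s).
Proof.
move=> /(has_sumZ (-1)); rewrite mulN1r; congr has_sum.
by apply/funext => i; rewrite mulN1r.
Qed.

Lemma has_sumB f g s t : has_sum f s -> has_sum g t ->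
  has_sum (fun i => f i - g i) (s - t).
Proof. by move=> hs /has_sumN; exact: has_sumD. Qed.

Lemma bounded_sum_le (g h : I -> R) :
  (forall i, g i <= h i) -> bounded_sum h -> bounded_sum g.
Proof.
move=> gh [M hM]; exists M => B uB; apply: le_trans (hM B uB).
by apply: ler_sum => i _.
Qed.

Lemma bounded_sumD (g h : I -> R) :
  bounded_sum g -> bounded_sum h -> bounded_sum (fun i => g i + h i).
Proof.
move=> [M hM] [N hN]; exists (M + N) => B uB; rewrite big_split /=.
by apply: lerD; [exact: hM|exact: hN].
Qed.

Lemma bounded_sumZ (c : R) (g : I -> R) : 0 <= c ->
  bounded_sum g -> bounded_sum (fun i => c * g i).
Proof.
move=> c0 [M hM]; exists (c * M) => B uB; rewrite -mulr_sumr.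
by rewrite ler_wpM2l// hM.
Qed.

Lemma ler_sum_subset (g : I -> R) (A B : seq I) : (forall i, 0 <= g i) ->
  uniq A -> uniq B -> {subset A <= B} -> \sum_(i <- A) g i <= \sum_(i <- B) g i.
Proof.
move=> g0 uA uB sAB; rewrite [leRHS](bigID (mem A)) /=.
rewrite [X in X + _](_ : _ = \sum_(i <- A) g i) ?lerDl ?sumr_ge0//.
rewrite -big_filter; apply: perm_big; apply: uniq_perm => //; first exact: filter_uniq.
by move=> i; rewrite mem_filter; apply/andP/idP => [[]//|iA]; rewrite sAB.
Qed.

Lemma bounded_has_sum (g : I -> R) : (forall i, 0 <= g i) -> bounded_sum g ->
  exists s : R, has_sum (fun i => (g i)%:C) s%:C.
Proof.
move=> g0 [M hM].
pose S := [set x : R | exists B : seq I, uniq B /\ x = \sum_(i <- B) g i]%classic.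
have hS : has_sup S.
  split; first by exists 0, [::]; rewrite big_nil.
  by exists M => _ [B [uB ->]]; exact: hM.
exists (sup S) => e e0; have [_ [A [uA ->]] hA] := sup_adherent e0 hS.
exists A => B uB sAB; rewrite -sum_realC -rmorphB cmodR.
have le1 : \sum_(i <- B) g i <= sup S.
  by apply: ub_le_sup; [case: hS|exists B].
have := ler_sum_subset g0 uA uB sAB; rewrite ler0_norm ?subr_le0// opprB.
by move: hA; set a := \sum_(i <- A) _; set b := \sum_(i <- B) _ => ? ?; lra.
Qed.

Lemma abs_summable_has_sum f : abs_summable f -> exists s, has_sum f s.
Proof.
move=> hf.
(* A real family u is the difference of |u| + u and |u|, which are nonnegative with bounded sums. *)
have part (u : I -> R) : (forall i, `|u i| <= cmod (f i)) ->
    exists s : R, has_sum (fun i => (u i)%:C) s%:C.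
  move=> hu.
  have [s hs] : exists s : R, has_sum (fun i => (`|u i| + u i)%:C) s%:C.
    apply: bounded_has_sum => [i|]; first by have := ler_norm (- u i); rewrite normrN; lra.
    apply: bounded_sum_le (bounded_sumZ (ler0n _ 2) hf) => i /=.
    by have := hu i; have := ler_norm (u i); lra.
  have [t ht] : exists s : R, has_sum (fun i => `|u i|%:C) s%:C.
    by apply: bounded_has_sum => //; apply: bounded_sum_le hf.
  exists (s - t); have := has_sumB hs ht; rewrite -rmorphB; congr has_sum.
  by apply/funext => i; rewrite -rmorphB /= addrAC subrr add0r.
have [s hs] := part _ (fun i => Re_cmod (f i)).
have [t ht] := part _ (fun i => Im_cmod (f i)).
exists (s%:C + 'i * t%:C); have := has_sumD hs (has_sumZ 'i ht).
by congr has_sum; apply/funext => i; rewrite -complexE.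
Qed.

Lemma has_sum_cmod_le f s M : has_sum f s ->
  (forall B : seq I, uniq B -> \sum_(i <- B) cmod (f i) <= M) -> cmod s <= M.
Proof.
move=> hs hM; apply/ler_addgt0Pr => e e0; have [A hA] := hs _ e0.
have uA := undup_uniq A.
set S := \sum_(i <- undup A) f i.
have h : cmod (S - s) < e by apply: hA => // i iA; rewrite mem_undup.
have -> : s = S - (S - s) by ring.
apply: le_trans (cmodB _ _) _; apply: lerD; last exact: ltW.
by apply: le_trans (cmod_sum _ _) _; exact: hM.
Qed.

Lemma has_sum_Re_le f g s t : has_sum f s -> has_sum g t ->
  (forall i, complex.Re (f i) <= complex.Re (g i)) -> complex.Re s <= complex.Re t.
Proof.
move=> hs ht fg; apply/ler_addgt0Pl => e e0; have e2 : 0 < e / 2 by rewrite divr_gt0.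
have [A hA] := hs _ e2; have [B hB] := ht _ e2.
pose D := undup (A ++ B).
have uD : uniq D by exact: undup_uniq.
have h1 : cmod (\sum_(i <- D) f i - s) < e / 2.
  by apply: hA => // i iA; rewrite mem_undup mem_cat iA.
have h2 : cmod (\sum_(i <- D) g i - t) < e / 2.
  by apply: hB => // i iA; rewrite mem_undup mem_cat iA orbT.
have h3 : complex.Re (\sum_(i <- D) f i) <= complex.Re (\sum_(i <- D) g i).
  by rewrite !Re_sum; apply: ler_sum => i _.
have := le_lt_trans (Re_cmod _) h1; have := le_lt_trans (Re_cmod _) h2.
by rewrite !ReB !ltr_norml => /andP[? ?] /andP[? ?]; lra.
Qed.

End OneIndex.

Lemma has_sum_conj (I : eqType) (f : I -> C) s : has_sum f s ->
  has_sum (fun i => (f i)^*%C) (s^*%C).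
Proof.
have mJ z : cmod (z^*%C : C) = cmod z by case: z => a b; rewrite /cmod /= sqrrN.
by move=> hs e /hs[A hA]; exists A => B uB sB; rewrite -rmorph_sum -rmorphB mJ hA.
Qed.

End HasSum.

Section SumTransfer.
Variable R : realType.
Local Notation C := R[i].

Lemma has_sum_reindex (I J : eqType) (phi : I -> J) (psi : J -> I)
    (P : pred I) (Q : pred J) (f : J -> C) (g : I -> C) (s : C) :
  (forall i, P i -> Q (phi i) && (psi (phi i) == i)) ->
  (forall j, Q j -> P (psi j) && (phi (psi j) == j)) ->
  (forall i, P i -> f (phi i) = g i) ->
  (forall i, ~~ P i -> g i = 0) -> (forall j, ~~ Q j -> f j = 0) ->
  has_sum g s -> has_sum f s.
Proof.
move=> hP hQ fg g0 f0 hg e /hg[A hA].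
exists (map phi [seq i <- A | P i]) => B uB sB.
(* The indices of [A] outside [P] are added so that [D] contains [A]; they contribute 0. *)
pose D := map psi [seq j <- B | Q j] ++ [seq i <- undup A | ~~ P i].
have uD : uniq D.
  rewrite cat_uniq filter_uniq ?undup_uniq// andbT; apply/andP; split.
    rewrite map_inj_in_uniq ?filter_uniq// => x y.
    rewrite !mem_filter => /andP[/hQ /andP[_ /eqP ex] _] /andP[/hQ /andP[_ /eqP ey] _] e1.
    by rewrite -ex -ey e1.
  apply/hasPn => i; rewrite mem_filter => /andP[/= nPi _].
  apply: contra nPi => /mapP[j]; rewrite mem_filter => /andP[/hQ /andP[Pj _] _] ->//.
have sD : {subset A <= D}.
  move=> i iA; rewrite mem_cat; apply/orP.
  have [Pi|nPi] := boolP (P i); [left|right]; last first.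
    by rewrite mem_filter /= nPi mem_undup.
  have /andP[Qi /eqP <-] := hP _ Pi; apply: map_f; rewrite mem_filter Qi.
  by apply: sB; apply: map_f; rewrite mem_filter Pi.
suff <- : \sum_(i <- D) g i = \sum_(j <- B) f j by exact: hA.
rewrite /D big_cat big_map !big_filter /= [X in _ + X]big1 ?addr0 => [|i nPi]; last exact: g0.
rewrite [RHS](bigID Q) /= [X in _ = _ + X]big1 ?addr0 => [|j]; last exact: f0.
by apply: eq_bigr => j Qj; have /andP[Pj /eqP ej] := hQ _ Qj; rewrite -(fg _ Pj) ej.
Qed.

Lemma has_sum_bij (I J : eqType) (phi : I -> J) (psi : J -> I) (f : J -> C) (s : C) :
  cancel phi psi -> cancel psi phi ->
  has_sum (fun i => f (phi i)) s -> has_sum f s.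
Proof.
move=> k1 k2; apply: (@has_sum_reindex _ _ phi psi xpredT xpredT) => //.
  by move=> i _ /=; rewrite k1.
by move=> j _ /=; rewrite k2.
Qed.

Lemma bounded_sum_inj (I J : eqType) (phi : I -> J) (g : J -> R) :
  injective phi -> bounded_sum g -> bounded_sum (fun i => g (phi i)).
Proof.
move=> inj [M hM]; exists M => B uB; rewrite -(big_map phi xpredT g).
by apply: hM; rewrite map_inj_uniq.
Qed.

Lemma bounded_sum_prod (I J : eqType) (g : I -> R) (h : J -> R) :
  (forall i, 0 <= g i) -> (forall j, 0 <= h j) ->
  bounded_sum g -> bounded_sum h -> bounded_sum (fun ij : I * J => g ij.1 * h ij.2).
Proof.
move=> g0 h0 [M hM] [N hN]; exists (M * N) => B uB.
pose A1 := undup (map fst B); pose A2 := undup (map snd B).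
pose D := [seq (i, j) | i <- A1, j <- A2].
have uD : uniq D by apply: allpairs_uniq; rewrite ?undup_uniq// => -[? ?] [? ?].
apply: (@le_trans _ _ (\sum_(ij <- D) g ij.1 * h ij.2)).
  apply: ler_sum_subset => // [ij|[i j] ijB]; first exact: mulr_ge0.
  by apply/allpairsP; exists (i, j); rewrite !mem_undup; split=> //=;
    [apply: (map_f fst ijB)|apply: (map_f snd ijB)].
rewrite big_allpairs /=.
have -> : \sum_(i <- A1) \sum_(j <- A2) g i * h j =
    (\sum_(i <- A1) g i) * (\sum_(j <- A2) h j).
  by rewrite mulr_suml; apply: eq_bigr => i _; rewrite mulr_sumr.
apply: ler_pM; [exact: sumr_ge0|exact: sumr_ge0| |].
  by apply: hM; exact: undup_uniq.
by apply: hN; exact: undup_uniq.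
Qed.

Lemma abs_summable_prod (I J : eqType) (f : I -> C) (g : J -> C) :
  abs_summable f -> abs_summable g -> abs_summable (fun ij : I * J => f ij.1 * g ij.2).
Proof.
move=> hf hg; have := bounded_sum_prod (fun i => cmod_ge0 (f i)) (fun j => cmod_ge0 (g j)) hf hg.
by congr bounded_sum; apply/funext => ij; rewrite cmodM.
Qed.

(** Absolute convergence provides some sum [u] over the pairs; its value is tested on a rectangle,
    where the finite sum factors, chosen large enough to contain the finite set controlling [u]. *)
Lemma has_sum_prod (I J : eqType) (f : I -> C) (g : J -> C) (s t : C) :
  abs_summable f -> abs_summable g -> has_sum f s -> has_sum g t ->
  has_sum (fun ij : I * J => f ij.1 * g ij.2) (s * t).
Proof.
move=> af ag hs ht; have [u hu] := abs_summable_has_sum (abs_summable_prod af ag).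
suff -> : s * t = u by [].
apply/eqP; rewrite -subr_eq0 -cmod_eq0 eq_le cmod_ge0 andbT.
apply/ler_addgt0Pl => e e0; rewrite addr0.
(* For d <= 1 the error |a b - s t| is at most d (1 + |s| + |t|), which d c dominates. *)
pose c := 2 * (1 + cmod s + cmod t); have c0 : 0 < c.
  by rewrite /c; have := cmod_ge0 s; have := cmod_ge0 t; lra.
pose d := Num.min 1 (e / 2 / c).
have d0 : 0 < d by rewrite /d lt_min ltr01 !divr_gt0.
have d1 : d <= 1 by rewrite /d ge_min lexx.
have dc : d * c <= e / 2 by rewrite -ler_pdivlMr// /d ge_min lexx orbT.
have e2 : 0 < e / 2 by rewrite divr_gt0.
have [A hA] := hs _ d0; have [B hB] := ht _ d0; have [D hD] := hu _ e2.
pose A1 := undup (A ++ map fst D); pose B1 := undup (B ++ map snd D).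
have ha : cmod (\sum_(i <- A1) f i - s) < d.
  by apply: hA; rewrite ?undup_uniq// => i iA; rewrite mem_undup mem_cat iA.
have hb : cmod (\sum_(i <- B1) g i - t) < d.
  by apply: hB; rewrite ?undup_uniq// => i iA; rewrite mem_undup mem_cat iA.
have := hD [seq (i, j) | i <- A1, j <- B1].
have uD : uniq [seq (i, j) | i <- A1, j <- B1].
  by apply: allpairs_uniq; rewrite ?undup_uniq// => -[? ?] [? ?].
move=> /(_ uD) h; have {}h : cmod ((\sum_(i <- A1) f i) * (\sum_(j <- B1) g j) - u) < e / 2.
  have -> : (\sum_(i <- A1) f i) * (\sum_(j <- B1) g j) =
     \sum_(ij <- [seq (i, j) | i <- A1, j <- B1]) f ij.1 * g ij.2.
    by rewrite big_allpairs /= mulr_suml; apply: eq_bigr => i _; rewrite mulr_sumr.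
  apply: h => -[i j] ijB; apply/allpairsP; exists (i, j).
  by rewrite !mem_undup !mem_cat; split=> //=; apply/orP; right;
    [apply: (map_f fst ijB)|apply: (map_f snd ijB)].
move: ha hb h; set a := \sum_(i <- A1) _; set b := \sum_(j <- B1) _ => ha hb h.
have -> : s * t - u = (a * b - u) - ((a - s) * (b - t) + (a - s) * t + s * (b - t)) by ring.
apply: le_trans (cmodB _ _) _; rewrite [e]splitr; apply: lerD; first exact: ltW.
apply: le_trans (cmodD _ _) _; rewrite cmodM.
apply: le_trans (lerD (cmodD _ _) (lexx _)) _; rewrite !cmodM.
apply: le_trans dc; rewrite /c.
have := cmod_ge0 s; have := cmod_ge0 t; have := cmod_ge0 (a - s); have := cmod_ge0 (b - t).
move: (cmod (a - s)) (cmod (b - t)) (cmod s) (cmod t) ha hb => x y S T ? ? ? ? ? ?.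
have : x * y <= d * 1 by apply: ler_pM => //; lra.
have : x * T <= d * T by apply: ler_wpM2r => //; lra.
have : S * y <= d * S by rewrite mulrC; apply: ler_wpM2r => //; lra.
have : 0 <= d * S by apply: mulr_ge0 => //; lra.
have : 0 <= d * T by apply: mulr_ge0 => //; lra.
by lra.
Qed.

End SumTransfer.

(** * Convergence of lattice sums *)

Section LatticeConvergence.
Variable R : realType.
Local Notation C := R[i].

Lemma sum_nat_le (g : nat -> R) (M : R) : (forall n, 0 <= g n) ->
  (forall N, \sum_(i < N) g i <= M) ->
  forall B : seq nat, uniq B -> \sum_(i <- B) g i <= M.
Proof.
move=> g0 hM B uB; pose N := (\max_(i <- B) i).+1.
apply: le_trans (hM N); rewrite -(big_mkord xpredT g).
apply: ler_sum_subset => //; first exact: iota_uniq.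
move=> i iB; rewrite mem_index_iota /= ltnS.
exact: (@leq_bigmax_seq _ B xpredT id i iB isT).
Qed.

Lemma bounded_sum_nat (g : nat -> R) (M : R) : (forall n, 0 <= g n) ->
  (forall N, \sum_(i < N) g i <= M) -> bounded_sum g.
Proof. by move=> g0 hM; exists M; exact: sum_nat_le. Qed.

Lemma sum_int_le (g : int -> R) (M N : R) : (forall n, 0 <= g n) ->
  (forall B : seq nat, uniq B -> \sum_(n <- B) g (Posz n) <= M) ->
  (forall B : seq nat, uniq B -> \sum_(n <- B) g (Negz n) <= N) ->
  forall B : seq int, uniq B -> \sum_(n <- B) g n <= M + N.
Proof.
move=> g0 hM hN B uB.
rewrite (bigID (fun n : int => (0 <= n))) /= -big_filter -[X in _ + X]big_filter; apply: lerD.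
  set B0 := [seq i <- B | 0 <= i].
  have -> : \sum_(i <- B0) g i = \sum_(n <- map absz B0) g (Posz n).
    by rewrite big_map !big_filter; apply: eq_bigr => i i0; rewrite gez0_abs.
  apply: hM; rewrite map_inj_in_uniq ?filter_uniq// => i j.
  rewrite !mem_filter => /andP[i0 _] /andP[j0 _] e.
  by rewrite -(gez0_abs i0) -(gez0_abs j0) e.
set B1 := [seq i <- B | ~~ (0 <= i)].
have -> : \sum_(i <- B1) g i = \sum_(n <- map (fun i : int => `|i|.-1)%N B1) g (Negz n).
  by rewrite big_map !big_filter; apply: eq_bigr => -[].
apply: hN; rewrite map_inj_in_uniq ?filter_uniq// => i j.
by rewrite !mem_filter; case: i => // i; case: j => //= j _ _ ->.
Qed.

Lemma bounded_sum_int (g : int -> R) : (forall n, 0 <= g n) ->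
  bounded_sum (fun n => g (Posz n)) -> bounded_sum (fun n => g (Negz n)) ->
  bounded_sum g.
Proof. by move=> g0 [M hM] [N hN]; exists (M + N); exact: sum_int_le. Qed.

(** Comparison with the integral of t^(-3/2): between consecutive square roots t < s the right-hand
    side grows by 2/t - 2/s, and s^2 - t^2 = 1 shows that this is at least s^-3. *)
Lemma sum_sqrt_cubeV N :
  \sum_(i < N.+1) (Num.sqrt i.+1%:R ^- 3) <= 3 - 2 / Num.sqrt N.+1%:R :> R.
Proof.
elim: N => [|N IH].
  by rewrite big_ord1 sqrtr1 expr1n invr1; lra.
rewrite big_ord_recr /=; apply: le_trans (lerD IH (lexx _)) _.
set t := Num.sqrt N.+1%:R; set s := Num.sqrt N.+2%:R.
have t0 : 0 < t by rewrite sqrtr_gt0 ltr0n.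
have ts : t <= s by rewrite ler_wsqrtr// ler_nat.
have s0 : 0 < s by exact: lt_le_trans ts.
have st : s ^+ 2 = t ^+ 2 + 1.
  by rewrite !sqr_sqrtr ?ler0n// -natr1.
have e : 2 / t - 2 / s - s ^- 3 = (2 * s ^+ 2 * (s - t) - t) / (t * s ^+ 3).
  by field; rewrite !gt_eqF.
have e0 : 0 <= 2 / t - 2 / s - s ^- 3.
  rewrite e divr_ge0 ?mulr_ge0 ?exprn_ge0 ?(ltW t0) ?(ltW s0)//.
  have h1 : (s + t) * (s - t) = 1 by rewrite mulrC -subr_sqr st; ring.
  have h2 : 0 <= s - t by rewrite subr_ge0.
  have h3 : (s + t) * (s - t) <= 2 * s * (s - t) by apply: ler_wpM2r => //; lra.
  rewrite h1 in h3.
  have : s * 1 <= s * (2 * s * (s - t)) by apply: ler_wpM2l => //; exact: ltW.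
  have -> : s * (2 * s * (s - t)) = 2 * s ^+ 2 * (s - t) by ring.
  by lra.
by lra.
Qed.

Definition lat_norm (v : int * int) : R := Num.max `|v.1|%:~R `|v.2|%:~R.
(* The inverse of the sup norm, with value 0 at the origin. *)
Definition lat_inv (v : int * int) : R := (lat_norm v)^-1.

Lemma lat_norm_ge1 v : v != 0 -> 1 <= lat_norm v.
Proof.
case: v => m n mn; rewrite /lat_norm le_max /= !ler1z.
have : (m != 0) || (n != 0) by rewrite -negb_and; move: mn; rewrite xpair_eqE.
by case/orP => h; apply/orP; [left|right]; rewrite -gtz0_ge1 normr_gt0.
Qed.

Lemma lat_norm0 : lat_norm 0 = 0.
Proof. by rewrite /lat_norm /= normr0 maxxx. Qed.

Lemma lat_norm_ge0 v : 0 <= lat_norm v.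
Proof. by rewrite /lat_norm le_max ler0z normr_ge0. Qed.

Lemma lat_inv_ge0 v : 0 <= lat_inv v.
Proof. by rewrite invr_ge0 lat_norm_ge0. Qed.

Lemma lat_inv_le1 v : lat_inv v <= 1.
Proof.
have [->|v0] := eqVneq v 0; first by rewrite /lat_inv lat_norm0 invr0 ler01.
by rewrite invf_le1 ?lat_norm_ge1// (lt_le_trans ltr01)// lat_norm_ge1.
Qed.

(** Reduced to dimension one by max(p, q)^3 >= p^(3/2) q^(3/2), where the absolute values of the
    coordinates are first raised to at least 1. *)
Lemma bounded_sum_lat_inv3 : bounded_sum (fun v => lat_inv v ^+ 3).
Proof.
pose q (n : int) : R := Num.max 1 `|n|%:~R.
have q1 n : 1 <= q n by rewrite /q le_max lexx.
pose al (n : int) : R := Num.sqrt (q n) ^- 3.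
have al0 n : 0 <= al n by rewrite invr_ge0 exprn_ge0// sqrtr_ge0.
have bal : bounded_sum al.
  have bb : bounded_sum (fun n : nat => (Num.sqrt n.+1%:R ^- 3 : R)).
    apply: (@bounded_sum_nat _ 3) => [n|[|N]]; first by rewrite invr_ge0 exprn_ge0// sqrtr_ge0.
      by rewrite big_ord0.
    apply: le_trans (sum_sqrt_cubeV N) _.
    have : 0 <= 2 / Num.sqrt N.+1%:R :> R by rewrite divr_ge0// sqrtr_ge0.
    by lra.
  apply: bounded_sum_int => //.
    (* The index is off by one on this side: n + 1 <= 4 max(1, n), whence the factor 8 = 4^(3/2). *)
    apply: bounded_sum_le (bounded_sumZ (ler0n R 8) bb) => n.
    have s0 : 0 < Num.sqrt n.+1%:R :> R by rewrite sqrtr_gt0 ltr0n.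
    have sq0 : 0 < Num.sqrt (q n) by rewrite sqrtr_gt0 (lt_le_trans ltr01).
    rewrite -[leLHS]mul1r ler_pdivrMr ?exprn_gt0// mulrAC ler_pdivlMr ?exprn_gt0// mul1r.
    have -> : 8 = 2 ^+ 3 :> R by ring.
    rewrite -exprMn lerXn2r ?nnegrE ?sqrtr_ge0 ?mulr_ge0//.
    have -> : 2 * Num.sqrt (q n) = Num.sqrt (2 ^+ 2 * q n).
      by rewrite sqrtrM ?exprn_ge0// sqrtr_sqr ger0_norm.
    rewrite ler_wsqrtr//; have := q1 n; have : n%:R <= q n by rewrite /q le_max lexx orbT.
    by rewrite -natr1 expr2; lra.
  apply: bounded_sum_le bb => n; rewrite /al lef_pV2 ?posrE ?exprn_gt0 ?sqrtr_gt0 ?ltr0n//.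
    rewrite lerXn2r ?nnegrE ?sqrtr_ge0// ler_wsqrtr// /q le_max; apply/orP; right.
    by rewrite NegzE normrN.
  exact: lt_le_trans ltr01 (q1 _).
apply: bounded_sum_le (bounded_sum_prod al0 al0 bal bal) => v.
have [->|v0] := eqVneq v 0.
  by rewrite /lat_inv lat_norm0 invr0 expr0n /= mulr_ge0.
have h1 := lat_norm_ge1 v0; have h0 : 0 < lat_norm v by exact: lt_le_trans h1.
have a0 : 0 < q v.1 by exact: lt_le_trans ltr01 (q1 _).
have b0 : 0 < q v.2 by exact: lt_le_trans ltr01 (q1 _).
rewrite /al /lat_inv exprVn -invfM -exprMn -sqrtrM ?(ltW a0)//.
rewrite lef_pV2 ?posrE ?exprn_gt0 ?sqrtr_gt0 ?mulr_gt0//.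
rewrite lerXn2r ?nnegrE ?sqrtr_ge0 ?(ltW h0)//.
rewrite -[lat_norm v]ger0_norm ?(ltW h0)// -sqrtr_sqr ler_wsqrtr// expr2.
apply: ler_pM; rewrite ?(ltW a0) ?(ltW b0)// /q ge_max h1 /= /lat_norm le_max lexx ?orbT//.
Qed.

Lemma pow3_le2 (p q r : R) a b c : 0 <= r -> r <= q -> q <= p -> p <= 1 ->
  (3 <= b + c)%N -> (6 <= a + b + c)%N -> p ^+ a * q ^+ b * r ^+ c <= p ^+ 3 * q ^+ 3.
Proof.
move=> r0 rq qp p1 bc abc; have q0 : 0 <= q by exact: le_trans rq.
have p0 : 0 <= p by exact: le_trans qp.
have q1 : q <= 1 by exact: le_trans p1.
apply: (@le_trans _ _ (p ^+ a * q ^+ (b + c))).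
  rewrite exprD mulrA ler_wpM2l ?mulr_ge0 ?exprn_ge0// lerXn2r ?nnegrE//.
rewrite -(subnK bc) exprD mulrA; apply: ler_pM; rewrite ?mulr_ge0 ?exprn_ge0//.
apply: (@le_trans _ _ (p ^+ a * p ^+ (b + c - 3))).
  by rewrite ler_wpM2l ?exprn_ge0// lerXn2r ?nnegrE.
by rewrite -exprD ler_wiXn2l//; lia.
Qed.

(** In [0, 1] a product grows when exponents move to larger bases. The two smaller bases carry at
    least 3 together and all three at least 6, so the two larger ones can receive 3 each; the
    summands on the right cover the possible orders. *)
Lemma pow3_le3 (p q r : R) a b c : 0 <= p <= 1 -> 0 <= q <= 1 -> 0 <= r <= 1 ->
  (3 <= a + b)%N -> (3 <= a + c)%N -> (3 <= b + c)%N -> (6 <= a + b + c)%N ->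
  p ^+ a * q ^+ b * r ^+ c <= p ^+ 3 * q ^+ 3 + p ^+ 3 * r ^+ 3 + q ^+ 3 * r ^+ 3.
Proof.
move=> /andP[p0 p1] /andP[q0 q1] /andP[r0 r1] ab ac bc abc.
have [ba ca cb] : [/\ (3 <= b + a)%N, (3 <= c + a)%N & (3 <= c + b)%N].
  by rewrite ![(_ + a)%N]addnC [(c + b)%N]addnC.
have [cba bca bac] : [/\ (6 <= c + b + a)%N, (6 <= b + c + a)%N & (6 <= b + a + c)%N].
  by clear -abc; split; lia.
have [cab acb] : (6 <= c + a + b)%N /\ (6 <= a + c + b)%N by clear -abc; split; lia.
have hpq : 0 <= p ^+ 3 * q ^+ 3 by rewrite mulr_ge0 ?exprn_ge0.
have hpr : 0 <= p ^+ 3 * r ^+ 3 by rewrite mulr_ge0 ?exprn_ge0.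
have hqr : 0 <= q ^+ 3 * r ^+ 3 by rewrite mulr_ge0 ?exprn_ge0.
set A := p ^+ 3 * q ^+ 3 in hpq *; set B := p ^+ 3 * r ^+ 3 in hpr *.
set D := q ^+ 3 * r ^+ 3 in hqr *.
have fin X : [\/ X <= A, X <= B | X <= D] -> X <= A + B + D.
  by move: (A) (B) (D) hpq hpr hqr => A' B' D' ? ? ? [] ?; lra.
apply: fin; have [pq|/ltW qp] := leP p q; have [pr|/ltW rp] := leP p r;
  have [qr|/ltW rq] := leP q r.
- apply: Or33; rewrite /D [leRHS]mulrC.
  have -> : p ^+ a * q ^+ b * r ^+ c = r ^+ c * q ^+ b * p ^+ a by ring.
  exact: pow3_le2.
- apply: Or33; rewrite /D.
  have -> : p ^+ a * q ^+ b * r ^+ c = q ^+ b * r ^+ c * p ^+ a by ring.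
  exact: pow3_le2.
- apply: Or33; rewrite /D [leRHS]mulrC.
  have -> : p ^+ a * q ^+ b * r ^+ c = r ^+ c * q ^+ b * p ^+ a by ring.
  exact: pow3_le2.
- apply: Or31; rewrite /A [leRHS]mulrC.
  have -> : p ^+ a * q ^+ b * r ^+ c = q ^+ b * p ^+ a * r ^+ c by ring.
  exact: pow3_le2.
- apply: Or32; rewrite /B [leRHS]mulrC.
  have -> : p ^+ a * q ^+ b * r ^+ c = r ^+ c * p ^+ a * q ^+ b by ring.
  exact: pow3_le2.
- apply: Or31; rewrite /A.
  exact: pow3_le2.
- apply: Or32; rewrite /B.
  have -> : p ^+ a * q ^+ b * r ^+ c = p ^+ a * r ^+ c * q ^+ b by ring.
  exact: pow3_le2.
- by apply: Or31; exact: pow3_le2.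
Qed.

End LatticeConvergence.

(** * The recurrence between lattice sums *)

(* Convergence of the sum of x^-a y^-b z^-c over the nonzero x, y, z of a
   lattice with x + y + z = 0. *)
Definition triple_conv (a b c : nat) :=
  [&& 3 <= a + b, 3 <= a + c, 3 <= b + c & 6 <= a + b + c]%N.

Section PartialFractions.
Variables (K : comNzRingType) (br : nat -> nat -> nat -> K).
Hypothesis br12 : forall a b c, triple_conv a b c -> br a b c = br b a c.
Hypothesis br13 : forall a b c, triple_conv a b c -> br a b c = br c b a.
Hypothesis br_rel : forall a b c,
  triple_conv a b.+1 c.+1 -> triple_conv a.+1 b c.+1 -> triple_conv a.+1 b.+1 c ->
  br a b.+1 c.+1 + br a.+1 b c.+1 + br a.+1 b.+1 c = 0.

Lemma br_step a b b' c c' : b' = b.+1 -> c' = c.+1 ->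
  triple_conv a b' c' -> triple_conv a.+1 b c' -> triple_conv a.+1 b' c ->
  br a.+1 b' c = - (br a b' c' + br a.+1 b c').
Proof.
move=> -> -> h1 h2 h3; apply/eqP; rewrite -addr_eq0 addrC; apply/eqP.
exact: br_rel.
Qed.

(** The relation [br_rel] is x + y + z = 0 divided by x^(a+1) y^(b+1) z^(c+1). The sum starts at j =
    3 because j = 2 would involve the conditionally convergent series of weight 2; the right-hand
    side is a boundary term. *)
Lemma triple_recurrence k : ~~ odd k -> (8 <= k)%N ->
  \sum_(3 <= j < k - 2) ((j - 1) * (k - 1 - j))%:R * ((-1) ^+ j * br j (k - j) 0)
  = - 4 * br 3 (k - 3) 0.
Proof.
move=> ek k8.
pose tau i := br i (k - 1 - i) 1; pose sig i := br i (k - 2 - i) 2.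
pose ups i := br i (k - 3 - i) 3.
(* Summation by parts: the three levels c = 1, 2, 3 are successive primitives
   of j |-> (-1) ^ j br j (k - j) 0, and the weight (j - 1) (k - 1 - j) is quadratic. *)
pose Phi i := (-1) ^+ i * (2 * ups i - (i * (k - 2 - i))%:R * tau i
                - (k%:R - (2 * i + 3)%:R) * sig i).
have R1 i : (2 <= i)%N -> (i <= k - 4)%N -> br i.+1 (k - i.+1) 0 = - (tau i + tau i.+1).
  move=> i2 ik; rewrite /tau (_ : k - i.+1 = k - 1 - i)%N; last by lia.
  by apply: br_step; rewrite /triple_conv; lia.
have R2 i : (1 <= i)%N -> (i <= k - 4)%N -> tau i.+1 = - (sig i + sig i.+1).
  move=> i2 ik; rewrite /tau /sig (_ : k - 1 - i.+1 = k - 2 - i)%N; last by lia.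
  by apply: br_step; rewrite /triple_conv; lia.
have R3 i : (2 <= i)%N -> (i <= k - 4)%N -> sig i.+1 = - (ups i + ups i.+1).
  move=> i2 ik; rewrite /ups /sig (_ : k - 2 - i.+1 = k - 3 - i)%N; last by lia.
  by apply: br_step; rewrite /triple_conv; lia.
have -> : (k - 2 = (k - 3).+1)%N by lia.
rewrite big_add1 /= (eq_big_nat _ _ (F2 := fun i => Phi i.+1 - Phi i)).
  rewrite telescope_sumr; last by lia.
  (* The symmetries express all boundary values through [tau 2] and [br 3 (k - 3) 0], and [tau 2]
     cancels in the end. *)
  have s1 : sig 1 = tau 2.
    rewrite /sig /tau (_ : k - 2 - 1 = k - 1 - 2)%N; last by lia.
    by apply: br13; rewrite /triple_conv; lia.
  have t2 : tau 2 = - (sig 1 + sig 2) by apply: R2; lia.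
  have s2 : sig 2 = - 2 * tau 2.
    by rewrite s1 in t2; rewrite -[sig 2](addKr (tau 2)) -[tau 2 + sig 2]opprK -t2; ring.
  have d3 : br 3 (k - 3) 0 = - (tau 2 + tau 3) by apply: R1; lia.
  have t3 : tau 3 = - (sig 2 + sig 3) by apply: R2; lia.
  have u2 : ups 2 = 3 * tau 2 + br 3 (k - 3) 0.
    have -> : ups 2 = sig 3.
      rewrite /ups /sig (_ : k - 3 - 2 = k - 2 - 3)%N; last by lia.
      by apply: br13; rewrite /triple_conv; lia.
    by rewrite d3 t3 s2; ring.
  have tk : tau (k - 3)%N = tau 2.
    rewrite /tau (_ : k - 1 - (k - 3) = 2)%N; last by lia.
    rewrite br12; last by rewrite /triple_conv; lia.
    by congr br; lia.
  have sk : sig (k - 3)%N = tau 2.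
    rewrite -s1 /sig (_ : k - 2 - (k - 3) = 1)%N; last by lia.
    rewrite br12; last by rewrite /triple_conv; lia.
    by congr br; lia.
  have ku : ups (k - 3)%N = br 3 (k - 3) 0.
    rewrite /ups (_ : k - 3 - (k - 3) = 0)%N; last by lia.
    rewrite br12; last by rewrite /triple_conv; lia.
    by apply: br13; rewrite /triple_conv; lia.
  rewrite /Phi tk sk ku u2 s2 -signr_odd (_ : odd (k - 3) = true); last by lia.
  have -> : (k - 2 - (k - 3) = 1)%N by lia.
  rewrite muln1 expr1 sqrrN expr1n.
  have -> : ((k - 3)%:R = k%:R - 3 :> K) by rewrite natrB//; lia.
  have -> : (2 * (k - 2 - 2))%:R = 2 * (k%:R - 4) :> K.
    by rewrite natrM -subnDA natrB//; lia.
  have -> : (2 * (k - 3) + 3)%:R = 2 * (k%:R - 3) + 3 :> K.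
    by rewrite natrD natrM natrB//; lia.
  by ring.
move=> i /andP[i2 ik]; have {ik} ik : (i <= k - 4)%N by lia.
rewrite /Phi R1// R2 ?(ltnW i2)// R3// exprS.
have -> : tau i = - (sig i.-1 + sig i).
  have -> : i = i.-1.+1 by lia.
  by apply: R2; lia.
have -> : (i.+1 - 1 = i)%N by lia.
have -> : (k - 1 - i.+1 = k - (i + 2))%N by lia.
have -> : (k - 2 - i.+1 = k - (i + 3))%N by lia.
have -> : (k - 2 - i = k - (i + 2))%N by lia.
rewrite !natrM !natrB; [|lia..].
have nE : i.+1%:R = i%:R + 1 :> K by rewrite -natr1.
have iE a : (i + a)%:R = i%:R + a%:R :> K by rewrite natrD.
have jE a : (2 * a + 3)%:R = 2 * a%:R + 3 :> K by rewrite natrD natrM.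
by rewrite !jE !iE !nE; ring.
Qed.

End PartialFractions.

Section Lattice.
Variables (R : realType).
Local Notation C := R[i].
Implicit Type z : C.

Definition usum (I : eqType) (f : I -> C) : C := xget 0 [set s | has_sum f s]%classic.

Lemma usumP (I : eqType) (f : I -> C) : abs_summable f -> has_sum f (usum f).
Proof.
by move=> /abs_summable_has_sum hf; exact: (xgetPex 0 hf).
Qed.

Definition lat z (v : int * int) : C := v.1%:~R * z + v.2%:~R.

Lemma latD z v w : lat z (v + w) = lat z v + lat z w.
Proof. by rewrite /lat /= !rmorphD /=; ring. Qed.
Lemma latN z v : lat z (- v) = - lat z v.
Proof. by rewrite /lat /= !rmorphN /=; ring. Qed.
Lemma lat0 z : lat z 0 = 0.
Proof. by rewrite /lat /= mul0r addr0. Qed.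

Lemma intC (n : int) : (n%:~R : C) = (n%:~R : R)%:C.
Proof. by rewrite rmorph_int. Qed.

Lemma cmod_int (n : int) : cmod (n%:~R : C) = `|n|%:~R.
Proof. by rewrite intC cmodR intr_norm. Qed.

Lemma Im_lat z v : complex.Im (lat z v) = v.1%:~R * complex.Im z.
Proof. by case: z => x y; rewrite /lat !intC /=; ring. Qed.

(** The imaginary part bounds the first coordinate m, and n = (m z + n) - m z then bounds the
    second. *)
Lemma lat_ge z : 0 < complex.Im z ->
  exists2 c : R, 0 < c & forall v, c * lat_norm R v <= cmod (lat z v).
Proof.
move=> z0; set y := complex.Im z in z0.
pose M := 1 + (1 + cmod z) / y.
have zy : 0 <= cmod z / y by rewrite divr_ge0 ?cmod_ge0// ltW.
have yV : 0 < y^-1 by rewrite invr_gt0.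
have M0 : 0 < M by rewrite /M mulrDl mul1r; lra.
exists M^-1; first by rewrite invr_gt0.
move=> v; rewrite mulrC ler_pdivrMr// /lat_norm ge_max.
set W := cmod (lat z v); have W0 : 0 <= W by exact: cmod_ge0.
have h1 : `|v.1|%:~R <= W / y.
  rewrite ler_pdivlMr// intr_norm -[y]gtr0_norm// -normrM -Im_lat; exact: Im_cmod.
have Wy : 0 <= W / y by rewrite divr_ge0// ltW.
have e : W * M = W + W / y + (W / y) * cmod z by rewrite /M; ring.
have t0 : 0 <= W / y * cmod z by rewrite mulr_ge0// cmod_ge0.
apply/andP; split; first by rewrite e; lra.
rewrite -cmod_int; have -> : (v.2%:~R : C) = lat z v - v.1%:~R * z by rewrite /lat; ring.
apply: le_trans (cmodB _ _) _; rewrite -/W cmodM cmod_int.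
have := ler_wpM2r (cmod_ge0 z) h1; rewrite e; lra.
Qed.

Section FixedPoint.
Variables (z : C) (z_gt0 : 0 < complex.Im z).
Local Notation x := (lat z).

Lemma lat_inv_bound : exists2 d : R, 0 <= d &
  forall v, cmod (x v)^-1 <= d * lat_inv R v.
Proof.
have [c c0 hc] := lat_ge z_gt0; exists c^-1; first by rewrite invr_ge0 ltW.
move=> v; have [->|v0] := eqVneq v 0.
  by rewrite lat0 invr0 cmod0 mulr_ge0 ?lat_inv_ge0// invr_ge0 ltW.
have h1 := lat_norm_ge1 R v0; have h0 : 0 < lat_norm R v by exact: lt_le_trans h1.
rewrite cmodV /lat_inv -invfM lef_pV2 ?posrE ?mulr_gt0//.
by apply: lt_le_trans (hc v); rewrite mulr_gt0.
Qed.

Lemma lat_eq0 v : (x v == 0) = (v == 0).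
Proof.
apply/eqP/eqP => [h|->]; last exact: lat0.
have [c c0 hc] := lat_ge z_gt0; apply/eqP; apply: contraTT (hc v) => v0.
by rewrite h cmod0 -ltNge mulr_gt0// (lt_le_trans ltr01)// lat_norm_ge1.
Qed.

Lemma lat_abs_summable k : (3 <= k)%N -> abs_summable (fun v => x v ^- k).
Proof.
move=> k3; have [d d0 hd] := lat_inv_bound.
apply: bounded_sum_le (bounded_sumZ (exprn_ge0 k d0) (bounded_sum_lat_inv3 R)) => v /=.
rewrite -exprVn cmodX; apply: le_trans (_ : (d * lat_inv R v) ^+ k <= _).
  by rewrite lerXn2r ?nnegrE ?cmod_ge0 ?mulr_ge0 ?lat_inv_ge0.
rewrite exprMn ler_wpM2l ?exprn_ge0// ler_wiXn2l ?lat_inv_ge0 ?lat_inv_le1//.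
Qed.

Definition lat_sum k : C := usum (fun v => x v ^- k).

Lemma has_lat_sum k : (3 <= k)%N -> has_sum (fun v => x v ^- k) (lat_sum k).
Proof. by move=> k3; apply: usumP; exact: lat_abs_summable. Qed.

Lemma lat_sum_odd k : (3 <= k)%N -> odd k -> lat_sum k = 0.
Proof.
move=> k3 ok; have h := has_lat_sum k3.
have : lat_sum k = - lat_sum k.
  apply: (has_sum_unique h).
  apply: (@has_sum_bij _ _ _ (fun v : int * int => - v) (fun v => - v));
    [exact: opprK|exact: opprK|].
  apply: has_sum_ext (has_sumN h) => v.
  by rewrite latN -!exprVn invrN exprNn -signr_odd ok mulN1r.
by move/eqP; rewrite -addr_eq0 -mulr2n mulrn_eq0 /= => /eqP.
Qed.

(** The guard matters when an exponent is 0, since a zero vector would then contribute a factor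
    1. *)
Definition triple_term a b c (vw : (int * int) * (int * int)) : C :=
  if [&& vw.1 != 0, vw.2 != 0 & vw.1 + vw.2 != 0] then
    x vw.1 ^- a * x vw.2 ^- b * (- x (vw.1 + vw.2)) ^- c else 0.

(** The majorant consists of products of cubes for the pairs (v, w), (v, v + w) and (w, v + w); each
    pair determines (v, w), so all three families are summable. *)
Lemma triple_abs_summable a b c : triple_conv a b c -> abs_summable (triple_term a b c).
Proof.
move=> /and4P[ab ac bc abc]; have [d d0 hd] := lat_inv_bound.
pose p v := lat_inv R v; have p0 v : 0 <= p v by exact: lat_inv_ge0.
pose g v := p v ^+ 3.
have g0 v : 0 <= g v by rewrite exprn_ge0// lat_inv_ge0.
have bg := bounded_sum_lat_inv3 R.
have h1 := bounded_sum_prod g0 g0 bg bg.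
pose phi (vw : (int * int) * (int * int)) := (vw.1, vw.1 + vw.2).
pose psi (vw : (int * int) * (int * int)) := (vw.2, vw.1 + vw.2).
have phi_inj : injective phi.
  move=> [v w] [v' w'] e; have /= e1 := congr1 fst e; have /= e2 := congr1 snd e.
  by rewrite e1 in e2 *; move/addrI: e2 => ->.
have psi_inj : injective psi.
  move=> [v w] [v' w'] e; have /= e1 := congr1 fst e; have /= e2 := congr1 snd e.
  by rewrite e1 in e2 *; move/addIr: e2 => ->.
have h2 := bounded_sum_inj phi_inj h1; have h3 := bounded_sum_inj psi_inj h1.
apply: bounded_sum_le (bounded_sumZ (exprn_ge0 (a + b + c) d0)
  (bounded_sumD (bounded_sumD h1 h2) h3)) => -[v w] /=.
rewrite /triple_term /=; case: ifP => [_|_]; last first.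
  rewrite cmod0; apply: mulr_ge0; first exact: exprn_ge0.
  by rewrite !addr_ge0 // mulr_ge0 // g0.
rewrite -!exprVn invrN !cmodM !cmodX cmodN.
apply: (@le_trans _ _ ((d * p v) ^+ a * (d * p w) ^+ b * (d * p (v + w)) ^+ c)).
  have hX v' m : 0 <= cmod (x v')^-1 ^+ m <= (d * p v') ^+ m.
    rewrite exprn_ge0 ?cmod_ge0//= lerXn2r ?nnegrE ?cmod_ge0 ?mulr_ge0 ?p0//.
  have /andP[a0 ha] := hX v a; have /andP[b0 hb] := hX w b.
  have /andP[c0 hc] := hX (v + w) c.
  by apply: ler_pM => //; [exact: mulr_ge0|exact: ler_pM].
have -> : (d * p v) ^+ a * (d * p w) ^+ b * (d * p (v + w)) ^+ c =
  d ^+ (a + b + c) * (p v ^+ a * p w ^+ b * p (v + w) ^+ c).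
  by rewrite !exprMn !exprD; ring.
rewrite ler_wpM2l ?exprn_ge0//.
by apply: pow3_le3; rewrite ?lat_inv_ge0 ?lat_inv_le1.
Qed.

Definition triple_sum a b c : C := usum (triple_term a b c).

Lemma has_triple_sum a b c : triple_conv a b c ->
  has_sum (triple_term a b c) (triple_sum a b c).
Proof. by move=> h; apply: usumP; exact: triple_abs_summable. Qed.

Lemma triple_sum12 a b c : triple_conv a b c -> triple_sum a b c = triple_sum b a c.
Proof.
move=> h; apply: (has_sum_unique (has_triple_sum h)).
have h' : triple_conv b a c by move: h; rewrite /triple_conv; lia.
apply: (@has_sum_bij _ _ _ (fun vw : (int * int) * (int * int) => (vw.2, vw.1))
  (fun vw => (vw.2, vw.1))) => [[]//|[]//|].
apply: has_sum_ext (has_triple_sum h') => -[v w].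
rewrite /triple_term /= andbCA [v + w]addrC; case: ifP => // _.
by rewrite [X in X * _]mulrC.
Qed.

Lemma triple_sum13 a b c : triple_conv a b c -> triple_sum a b c = triple_sum c b a.
Proof.
move=> h; apply: (has_sum_unique (has_triple_sum h)).
have h' : triple_conv c b a by move: h; rewrite /triple_conv; lia.
pose phi (vw : (int * int) * (int * int)) := (- (vw.1 + vw.2), vw.2).
have phiK : cancel phi phi by move=> [v w]; rewrite /phi /=; rewrite opprD opprK addrK.
apply: (@has_sum_bij _ _ _ phi phi) => //.
apply: has_sum_ext (has_triple_sum h') => -[v w].
have e : - (v + w) + w = - v by rewrite opprD subrK.
rewrite /triple_term /phi /= e !oppr_eq0.
have -> : [&& v + w != 0, w != 0 & v != 0] = [&& v != 0, w != 0 & v + w != 0].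
  by rewrite andbCA [RHS]andbCA; congr (_ && _); rewrite andbC.
case: ifP => // _; rewrite !latN opprK; ring.
Qed.

Lemma triple_sum_rel a b c :
  triple_conv a b.+1 c.+1 -> triple_conv a.+1 b c.+1 -> triple_conv a.+1 b.+1 c ->
  triple_sum a b.+1 c.+1 + triple_sum a.+1 b c.+1 + triple_sum a.+1 b.+1 c = 0.
Proof.
move=> h1 h2 h3.
apply: (@has_sum_unique _ ((int * int) * (int * int))%type (fun=> 0)); last exact: has_sum0.
apply: has_sum_ext (has_sumD (has_sumD (has_triple_sum h1) (has_triple_sum h2))
  (has_triple_sum h3)) => -[v w]; rewrite /triple_term /=.
case: ifP => [|_]; last by rewrite !addr0.
move=> /and3P[v0 w0 vw0]; rewrite latD.
have x0 : x v != 0 by rewrite lat_eq0.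
have y0 : x w != 0 by rewrite lat_eq0.
have z0 : x v + x w != 0 by rewrite -latD lat_eq0.
by rewrite -!exprVn !exprS invrN; field; rewrite x0 y0 z0.
Qed.

(** The product of two lattice sums consists of the admissible triples and the antidiagonal w = -v;
    zero vectors contribute 0 because both exponents are positive. *)
Lemma triple_sum0 a b : (3 <= a)%N -> (3 <= b)%N ->
  triple_sum a b 0 = lat_sum a * lat_sum b - (-1) ^+ b * lat_sum (a + b).
Proof.
move=> a3 b3; have h : triple_conv a b 0 by rewrite /triple_conv; lia.
have hp := has_sum_prod (lat_abs_summable a3) (lat_abs_summable b3)
  (has_lat_sum a3) (has_lat_sum b3).
have ab3 : (3 <= a + b)%N by lia.
pose diag (vw : (int * int) * (int * int)) : C :=
  if vw.1 + vw.2 == 0 then x vw.1 ^- a * x vw.2 ^- b else 0.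
have hd : has_sum diag ((-1) ^+ b * lat_sum (a + b)).
  apply: (@has_sum_reindex _ _ _ (fun v => (v, - v)) fst xpredT (fun vw => vw.1 + vw.2 == 0)
    _ _ _ _ _ _ _ _ (has_sumZ ((-1) ^+ b) (has_lat_sum ab3))) => //.
  - by move=> v _; rewrite /= subrr eqxx.
  - by move=> [v w] /=; rewrite addrC addr_eq0 => /eqP->.
  - by move=> v _; rewrite /diag /= subrr eqxx latN -!exprVn invrN (exprNn (x v)^-1) exprD; ring.
  - by move=> vw /negPf h'; rewrite /diag h'.
apply: (has_sum_unique (has_triple_sum h)).
apply: has_sum_ext (has_sumB hp hd) => -[v w].
rewrite /triple_term /diag /= expr0 invr1 mulr1.
have a0 : (a == 0)%N = false by lia.
have b0 : (b == 0)%N = false by lia.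
have [->|v0] := eqVneq v 0.
  by rewrite lat0 expr0n a0 invr0 !mul0r; case: ifP => _; rewrite subrr.
have [->|w0] := eqVneq w 0.
  by rewrite lat0 expr0n b0 invr0 !mulr0; case: ifP => _; rewrite subrr.
by case: eqP => _; rewrite /= ?subrr ?subr0.
Qed.

(** Odd lattice sums vanish, so only j = 2p leaves products, with weight (2p - 1) (2(n - p) - 1).
    The multiples of G_k come from all j and from the boundary term. *)
Lemma lat_sum_recurrence n : (4 <= n)%N ->
  ((n - 3) * (2 * n).+1)%:R * ((2 * n).-1%:R * lat_sum (2 * n)) =
  3 * \sum_(2 <= p < n.-1)
    ((2 * p).-1%:R * lat_sum (2 * p)) * ((2 * (n - p)).-1%:R * lat_sum (2 * (n - p))).
Proof.
move=> n4; set k := (2 * n)%N; have ek : ~~ odd k by rewrite /k; lia.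
have k8 : (8 <= k)%N by rewrite /k; lia.
have := triple_recurrence triple_sum12 triple_sum13 triple_sum_rel ek k8.
have D j : (3 <= j < k - 2)%N -> triple_sum j (k - j) 0 =
    lat_sum j * lat_sum (k - j) - (-1) ^+ j * lat_sum k.
  move=> /andP[j3 jk]; rewrite triple_sum0//; last by lia.
  rewrite subnKC; last by lia.
  by rewrite -[(-1) ^+ (k - j)]signr_odd -[(-1) ^+ j]signr_odd oddB; [|lia];
    rewrite (negPf ek).
rewrite (eq_big_nat _ _ (F2 := fun j => ((j - 1) * (k - 1 - j))%:R *
   ((-1) ^+ j * (lat_sum j * lat_sum (k - j)) - lat_sum k))); last first.
  move=> j hj; rewrite D//; congr (_ * _); by rewrite mulrBr signrMK.
rewrite D; last by lia.
rewrite (@lat_sum_odd 3)// mul0r sub0r.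
pose F j := ((j - 1) * (k - 1 - j))%:R * ((-1) ^+ j * (lat_sum j * lat_sum (k - j))).
pose S := \sum_(2 <= p < n.-1)
    ((2 * p).-1%:R * lat_sum (2 * p)) * ((2 * (n - p)).-1%:R * lat_sum (2 * (n - p))).
have FS : \sum_(3 <= j < k - 2) F j = S.
  (* The index 2 is added on both sides because the splitting by parity starts there. *)
  have F2 : F 2%N + \sum_(3 <= j < k - 2) F j = F 2%N + S.
    rewrite -[LHS]big_ltn; last by lia.
    have -> : (k - 2 = 2 * n.-1)%N by rewrite /k; lia.
    rewrite big_nat_parity; last by lia.
    rewrite [X in _ + X]big_nat [X in _ + X]big1 => [|p hp]; last first.
      by rewrite /F lat_sum_odd ?mul0r ?mulr0//=; lia.
    rewrite addr0 big_ltn; last by lia.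
    congr (_ + _); rewrite /S !big_nat; apply: eq_bigr => p hp.
    rewrite /F -signr_odd (_ : odd (2 * p) = false); last by lia.
    rewrite mul1r mulrACA -natrM; congr (_%:R * (_ * lat_sum _)); rewrite /k; last by lia.
    by congr (_ * _)%N; lia.
  exact: (addrI _ F2).
have W m : (m + 3 <= k - 1)%N ->
    6 * \sum_(3 <= j < m + 3) ((j - 1) * (k - 1 - j))%:R =
    3 * (k%:R - 2) * ((m%:R + 1) * (m%:R + 2) - 2)
     - ((m%:R + 1) * (m%:R + 2) * (2 * m%:R + 3) - 6) :> C.
  elim: m => [|m IH] hm; first by rewrite big_geq//; ring.
  rewrite addSn big_nat_recr/=; last by lia.
  rewrite mulrDr IH; last by lia.
  have -> : (m + 3 - 1 = m + 2)%N by lia.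
  have -> : (k - 1 - (m + 3) = k - (m + 4))%N by lia.
  rewrite natrM natrB; last by lia.
  by rewrite !natrD -[m.+1%:R]natr1; ring.
have /W : (k - 5 + 3 <= k - 1)%N by lia.
have -> : (k - 5 + 3 = k - 2)%N by lia.
set V := \sum_(3 <= j < k - 2) _ => VE.
have -> : \sum_(3 <= j < k - 2) ((j - 1) * (k - 1 - j))%:R *
    ((-1) ^+ j * (lat_sum j * lat_sum (k - j)) - lat_sum k) = S - V * lat_sum k.
  by rewrite -FS /V mulr_suml -sumrB; apply: eq_bigr => j _; rewrite mulrBr.
move=> h; rewrite -/S.
have -> : S = V * lat_sum k - 4 * lat_sum k.
  by rewrite -[S](subrK (V * lat_sum k)) h; ring.
apply: (@mulfI _ 2); first by rewrite pnatr_eq0.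
transitivity (6 * V * lat_sum k - 24 * lat_sum k); last by ring.
rewrite VE natrM !natrB; [|lia..].
have -> : (k.-1%:R = k%:R - 1 :> C) by rewrite -subn1 natrB//; lia.
rewrite -[k.+1%:R]natr1.
have -> : (k%:R = 2 * n%:R :> C) by rewrite natrM.
by ring.
Qed.
End FixedPoint.
End Lattice.

(** * Eisenstein series as lattice sums *)

Section EisensteinLattice.
Variable R : realType.
Local Notation C := R[i].

Lemma has_sum_summability (I : choiceType) (f : I -> C) (s : C) : has_sum f s ->
  summability.sum (f : I -> R[i]^o) = s.
Proof.
move=> hs; apply: (@cvg_lim R[i]^o); [exact: norm_hausdorff|exact: summability.totally_filter|].
have FF := @summability.totally_filter I.
apply/cvgrPdist_lt => e e0.
have eE : e = (complex.Re e)%:C by rewrite RRe_real// gtr0_real.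
have e1 : 0 < complex.Re e by move: e0; rewrite {1}eE ltcR.
have [A hA] := hs _ e1.
exists [fset i in A]%fset => // B /= /fsubsetP sB.
rewrite -/(summability.partial_sum f B) /summability.partial_sum.
rewrite -(big_seq_fsetE _ B xpredT f) /= distrC normr_cmod eE ltcR.
by apply: hA => // i iA; apply: sB; rewrite inE.
Qed.

Lemma has_sum_zeta k : (3 <= k)%N ->
  has_sum (fun n : nat => ((n.+1%:R ^- k) : R)%:C) (zeta R k)%:C /\
  abs_summable (fun n : nat => ((n.+1%:R ^- k) : R)%:C).
Proof.
move=> k3; pose g (n : nat) : R := n.+1%:R ^- k.
have g0 n : 0 <= g n by rewrite invr_ge0 exprn_ge0.
have bg : bounded_sum g.
  apply: (@bounded_sum_nat _ _ 3) => // -[|N]; first by rewrite big_ord0.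
  have h : 3 - 2 / Num.sqrt N.+1%:R <= 3 :> R.
    have : 0 <= 2 / Num.sqrt N.+1%:R :> R by rewrite divr_ge0// sqrtr_ge0.
    by lra.
  apply: le_trans (le_trans (sum_sqrt_cubeV R N) h); apply: ler_sum => i _.
  have i1 : 1 <= i.+1%:R :> R by rewrite ler1n.
  have s1 : 1 <= Num.sqrt i.+1%:R :> R by rewrite -[leLHS]sqrtr1 ler_wsqrtr.
  have si : Num.sqrt i.+1%:R <= i.+1%:R :> R.
    by rewrite -[leRHS]sqr_sqrtr// ler_eXnr.
  rewrite /g lef_pV2 ?posrE ?exprn_gt0 ?sqrtr_gt0//.
  apply: (@le_trans _ _ (i.+1%:R ^+ 3)); first by rewrite lerXn2r ?nnegrE ?sqrtr_ge0.
  by rewrite ler_weXn2l.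
have [s hs] := bounded_has_sum g0 bg.
have zs : zeta R k = s.
  rewrite /zeta; apply: cvg_lim; first exact: norm_hausdorff.
  apply/cvgrPdist_lt => e e0; have [A hA] := hs _ e0.
  exists (\max_(i <- A) i).+1 => // n /= An; rewrite distrC.
  rewrite -cmodR (_ : _ - s = \sum_(0 <= i < n) g i - s)// rmorphB rmorph_sum; apply: hA; first exact: iota_uniq.
  move=> i iA; rewrite mem_index_iota /=; apply: leq_trans An; rewrite ltnS.
  exact: (@leq_bigmax_seq _ A xpredT id i iA isT).
split; first by rewrite zs.
apply: bounded_sum_le bg => n; rewrite cmodR ger0_norm//; exact: g0.
Qed.

Definition coprime_term k (z : C) (v : int * int) : C :=
  if coprimez v.1 v.2 then lat z v ^- k else 0.

Lemma lat_scale (z : C) (n : nat) (v : int * int) :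
  lat z (n%:Z * v.1, n%:Z * v.2) = n%:R * lat z v.
Proof. by rewrite /lat /= !rmorphM /=; ring. Qed.

(** Every nonzero vector is in exactly one way a positive integer, its gcd, times a coprime pair;
    [nv.1] is that integer minus 1. *)
Lemma has_sum_lat_gcd k (z t : C) : (0 < k)%N ->
  has_sum (fun nv : nat * (int * int) =>
    ((nv.1.+1%:R ^- k) : R)%:C * coprime_term k z nv.2) t ->
  has_sum (fun v => lat z v ^- k) t.
Proof.
move=> k0; pose phi (nv : nat * (int * int)) := (nv.1.+1%:Z * nv.2.1, nv.1.+1%:Z * nv.2.2).
pose g (v : int * int) := gcdn `|v.1| `|v.2|.
pose psi (v : int * int) := ((g v).-1, ((v.1 %/ (g v)%:Z)%Z, (v.2 %/ (g v)%:Z)%Z)).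
apply: (@has_sum_reindex _ _ _ phi psi (fun nv => coprimez nv.2.1 nv.2.2) (fun v => v != 0)).
- move=> [n [a b]] /= cab; have gE : g (phi (n, (a, b))) = n.+1.
    rewrite /g /phi /= !abszM /= -muln_gcdr.
    by move: cab; rewrite coprimezE => /eqP ->; rewrite muln1.
  rewrite /psi gE /phi /= !mulKz// eqxx andbT xpair_eqE !mulf_eq0 /=.
  apply: contraTN cab => /andP[/eqP-> /eqP->]; by [].
- move=> [a b] /= v0; have g0 : (0 < g (a, b))%N.
    rewrite /g /= gcdn_gt0 !absz_gt0 -negb_and.
    by apply: contra v0 => /andP[/eqP-> /eqP->].
  have ea : (a %/ (g (a, b))%:Z)%Z * (g (a, b))%:Z = a.
    by apply: divzK; rewrite dvdzE /= dvdn_gcdl.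
  have eb : (b %/ (g (a, b))%:Z)%Z * (g (a, b))%:Z = b.
    by apply: divzK; rewrite dvdzE /= dvdn_gcdr.
  rewrite /phi /psi /= prednK// ![(g (a, b))%:Z * _]mulrC ea eb eqxx andbT.
  rewrite coprimezE /coprime -(eqn_pmul2l g0) muln1 muln_gcdr.
  have := congr1 absz ea; have := congr1 absz eb; rewrite !abszM /= ![(_ * g _)%N]mulnC.
  by move=> -> ->.
- move=> [n v] /= cv; rewrite /coprime_term cv lat_scale exprMn invfM.
  by rewrite fmorphV rmorphXn /= rmorph_nat.
- by move=> [n v] /= /negPf cv; rewrite /coprime_term cv mulr0.
- move=> v /=; rewrite negbK => /eqP->.
  by rewrite lat0 expr0n; case: k k0 => //= k _; rewrite invr0.
Qed.

Lemma eisG_lat_sum k (z : C) : (3 <= k)%N -> 0 < complex.Im z -> eisG k z = lat_sum z k.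
Proof.
move=> k3 z0; have ac : abs_summable (coprime_term k z).
  apply: bounded_sum_le (lat_abs_summable z0 k3) => v.
  by rewrite /coprime_term; case: ifP => // _; rewrite cmod0 cmod_ge0.
have [s hs] := abs_summable_has_sum ac; have [hz az] := has_sum_zeta k3.
have := has_sum_lat_gcd (ltnW (ltnW k3)) (has_sum_prod az ac hz hs).
move=> /(has_sum_unique (has_lat_sum z0 k3)) ->.
rewrite /eisG /eisE (has_sum_summability hs) mulrA; congr (_ * _).
by rewrite rmorphM /= rmorph_nat mulrAC mulfV ?mul1r// pnatr_eq0.
Qed.

End EisensteinLattice.

(** * The lattices generated by 1 and iy *)

Section ImaginaryAxis.
Variable R : realType.
Local Notation C := R[i].

Definition axis (y : R) : C := 0 +i* y.

Lemma lat_axis y v : lat (axis y) v = (v.2%:~R : R) +i* (v.1%:~R * y).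
Proof.
rewrite /lat /axis !intC; apply/eqP; rewrite eq_complex /=.
by apply/andP; split; apply/eqP; ring.
Qed.

Lemma lat_norm_axis y v : 1 <= y -> lat_norm R v <= cmod (lat (axis y) v).
Proof.
move=> y1; rewrite /lat_norm ge_max; apply/andP; split.
  apply: le_trans (Im_cmod _); rewrite lat_axis /= normrM -intr_norm.
  rewrite ler_peMr ?ler0z ?normr_ge0//.
  by rewrite ger0_norm// (le_trans ler01).
by apply: le_trans (Re_cmod _); rewrite lat_axis /= -intr_norm.
Qed.

Lemma lat_inv_axis y v : 1 <= y -> cmod (lat (axis y) v)^-1 <= lat_inv R v.
Proof.
move=> y1; have [->|v0] := eqVneq v 0; first by rewrite lat0 invr0 cmod0 lat_inv_ge0.
have h0 : 0 < lat_norm R v by apply: lt_le_trans (lat_norm_ge1 R v0).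
rewrite cmodV /lat_inv lef_pV2 ?posrE//; last exact: lt_le_trans (lat_norm_axis v y1).
exact: lat_norm_axis.
Qed.

Lemma Im_axis y : complex.Im (axis y) = y. Proof. by []. Qed.

Lemma lat_sum_axis_real k y : (3 <= k)%N -> 0 < y ->
  lat_sum (axis y) k = (complex.Re (lat_sum (axis y) k))%:C.
Proof.
move=> k3 y0; have hs := has_lat_sum (z := axis y) y0 k3.
suff e : lat_sum (axis y) k = (lat_sum (axis y) k)^*%C.
  move: e; case: (lat_sum _ _) => a b [/eqP]; rewrite -addr_eq0.
  by rewrite -mulr2n mulrn_eq0 /= => /eqP ->.
apply: (has_sum_unique hs).
pose phi (v : int * int) := (- v.1, v.2).
have phiK : cancel phi phi by move=> [m n]; rewrite /phi /= opprK.
apply: (has_sum_bij phiK phiK); apply: has_sum_ext (has_sum_conj hs) => v.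
rewrite fmorphV rmorphXn /=; congr (_ ^- _).
by apply/eqP; rewrite !lat_axis eq_complex /= eqxx mulrNz mulNr eqxx.
Qed.

(** In A^-1 - B^-1 = (B - A) / (A B) the growth of B - A with the first coordinate is compensated by
    one of the two inverses. The bound is uniform for y >= 1, so it can be summed over the
    lattice. *)
Lemma lat_axis_expV_lip k y y' v : 1 <= y -> 1 <= y' ->
  cmod (lat (axis y) v ^- k - lat (axis y') v ^- k) <=
  k%:R * `|y - y'| * lat_inv R v ^+ k.
Proof.
move=> y1 y1'; case: k => [|k].
  by rewrite !expr0 subrr cmod0 !mul0r.
have [->|v0] := eqVneq v 0.
  by rewrite !lat0 subrr cmod0 !mulr_ge0 ?exprn_ge0 ?lat_inv_ge0.
set p := lat_inv R v; have p0 : 0 <= p by exact: lat_inv_ge0.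
have n0 : 0 < lat_norm R v by apply: lt_le_trans (lat_norm_ge1 R v0).
have nz x : 1 <= x -> lat (axis x) v != 0.
  by move=> x1; rewrite lat_eq0//; exact: lt_le_trans x1.
set A := lat (axis y) v; set B := lat (axis y') v.
have A0 : A != 0 by exact: nz. have B0 : B != 0 by exact: nz.
have hA : cmod A^-1 <= p by exact: lat_inv_axis.
have hB : cmod B^-1 <= p by exact: lat_inv_axis.
have hAB : cmod (B - A) <= lat_norm R v * `|y - y'|.
  have -> : B - A = (v.1%:~R : R)%:C * (0 +i* (y' - y)).
    apply/eqP; rewrite /A /B !lat_axis eq_complex /=.
    by apply/andP; split; apply/eqP; ring.
  rewrite cmodM cmodR -intr_norm.
  have -> : cmod (0 +i* (y' - y)) = `|y - y'|.
    by rewrite /cmod /= expr0n /= add0r sqrtr_sqr distrC.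
  by rewrite ler_wpM2r// /lat_norm le_max lexx.
rewrite -!exprVn subrXX cmodM.
have -> : A^-1 - B^-1 = (B - A) * A^-1 * B^-1 by field; rewrite A0 B0.
have hd : cmod ((B - A) * A^-1 * B^-1) <= `|y - y'| * p.
  rewrite !cmodM; apply: (@le_trans _ _ (lat_norm R v * `|y - y'| * p * p)).
    by apply: ler_pM; rewrite ?mulr_ge0 ?cmod_ge0//; apply: ler_pM; rewrite ?cmod_ge0.
  rewrite /p /lat_inv; set N := lat_norm R v.
  have -> : N * `|y - y'| * N^-1 * N^-1 = `|y - y'| * N^-1 by field; rewrite gt_eqF.
  by [].
have hs : cmod (\sum_(i < k.+1) A^-1 ^+ (k.+1.-1 - i) * B^-1 ^+ i) <= k.+1%:R * p ^+ k.
  apply: le_trans (cmod_sum _ _) _; apply: (@le_trans _ _ (\sum_(i < k.+1) p ^+ k)).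
    apply: ler_sum => i _; rewrite cmodM !cmodX -[in leRHS](subnK (leq_ord i)) exprD.
    by apply: ler_pM; rewrite ?exprn_ge0 ?cmod_ge0// lerXn2r ?nnegrE ?cmod_ge0.
  by rewrite sumr_const card_ord mulr_natl.
apply: (@le_trans _ _ (`|y - y'| * p * (k.+1%:R * p ^+ k))).
  by apply: ler_pM; rewrite ?cmod_ge0.
by rewrite exprS; have -> : forall a b c d : R, a * b * (c * d) = c * a * (b * d)
  by move=> a b c d; ring.
Qed.

Lemma lat_sum_axis_lip k : (3 <= k)%N -> exists2 M : R, 0 <= M &
  forall y y', 1 <= y -> 1 <= y' ->
  cmod (lat_sum (axis y) k - lat_sum (axis y') k) <= M * `|y - y'|.
Proof.
move=> k3; have [M hM] := bounded_sum_lat_inv3 R.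
have M0 : 0 <= M by have := hM [::] isT; rewrite big_nil.
exists (k%:R * M); first by rewrite mulr_ge0.
move=> y y' y1 y1'.
have y0 : 0 < complex.Im (axis y) by exact: lt_le_trans y1.
have y0' : 0 < complex.Im (axis y') by exact: lt_le_trans y1'.
apply: has_sum_cmod_le (has_sumB (has_lat_sum y0 k3) (has_lat_sum y0' k3)) _ => B uB.
apply: (@le_trans _ _ (\sum_(v <- B) k%:R * `|y - y'| * lat_inv R v ^+ 3)).
  apply: ler_sum => v _; apply: le_trans (lat_axis_expV_lip k v y1 y1') _.
  by rewrite ler_wpM2l ?mulr_ge0// ler_wiXn2l ?lat_inv_ge0 ?lat_inv_le1.
rewrite -mulr_sumr [leRHS]mulrAC ler_wpM2l ?mulr_ge0//; exact: hM.
Qed.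

(* Truncating at y = 1 makes this Lipschitz on the whole real line. *)
Definition axis_sum k (y : R) : R := complex.Re (lat_sum (axis (Num.max 1 y)) k).

Lemma axis_sum_continuous k : (3 <= k)%N -> continuous (axis_sum k).
Proof.
move=> k3 y; have [M M0 hM] := lat_sum_axis_lip k3.
have m1 x : 1 <= Num.max 1 x :> R by rewrite le_max lexx.
apply/cvgrPdist_lt => e e0; have M1 : 0 < M + 1 by rewrite ltr_wpDl.
near=> x.
apply: (@le_lt_trans _ _ (M * `|y - x|)).
  rewrite /axis_sum -ReB; apply: le_trans (Re_cmod _) _.
  apply: le_trans (hM _ _ (m1 y) (m1 x)) _; rewrite ler_wpM2l//.
  have [y1|/ltW y1] := leP 1 y; have [x1|/ltW x1] := leP 1 x; first by [].
  - by rewrite !ger0_norm ?subr_ge0//; [lra|exact: le_trans y1].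
  - by rewrite !ler0_norm ?subr_le0//; [lra|exact: le_trans x1].
  - by rewrite subrr normr0.
apply: (@le_lt_trans _ _ ((M + 1) * `|y - x|)).
  by rewrite ler_wpM2r// lerDl.
rewrite mulrC -ltr_pdivlMr//.
near: x; apply: cvgr_dist_lt; [exact: cvg_id|exact: divr_gt0].
Unshelve. all: by end_near.
Qed.

End ImaginaryAxis.

Section AxisBounds.
Variable R : realType.
Local Notation C := R[i].

Lemma has_sum_ge (I : eqType) (g : I -> R) (s : R) (B : seq I) : (forall i, 0 <= g i) ->
  uniq B -> has_sum (fun i => (g i)%:C) s%:C -> \sum_(i <- B) g i <= s.
Proof.
move=> g0 uB hs; apply/ler_addgt0Pl => e e0; have [A hA] := hs _ e0.
pose D := undup (A ++ B); have uD : uniq D by exact: undup_uniq.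
have := hA D uD; rewrite -sum_realC -rmorphB cmodR => h.
have {}h : `|\sum_(i <- D) g i - s| < e.
  by apply: h => i iA; rewrite mem_undup mem_cat iA.
have : \sum_(i <- B) g i <= \sum_(i <- D) g i.
  by apply: ler_sum_subset => // i iB; rewrite mem_undup mem_cat iB orbT.
by move: h; rewrite ltr_norml => /andP[? ?] ?; lra.
Qed.

Definition inv_sqr (n : int) : R := n%:~R ^- 2.

Lemma inv_sqr_ge0 n : 0 <= inv_sqr n.
Proof. by rewrite invr_ge0 sqr_ge0. Qed.

Lemma sum_inv_sqr N : \sum_(i < N.+1) (i.+1%:R ^- 2 : R) <= 2 - N.+1%:R^-1.
Proof.
elim: N => [|N IH]; first by rewrite big_ord1 expr1n invr1; lra.
rewrite big_ord_recr /=; apply: le_trans (lerD IH (lexx _)) _.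
set t : R := N.+1%:R; have -> : N.+2%:R = t + 1 :> R by rewrite -natr1.
have t0 : 0 < t by rewrite ltr0n.
have t1 : 0 < t + 1 by lra.
rewrite -subr_ge0; have -> : 2 - (t + 1)^-1 - (2 - t^-1 + (t + 1) ^- 2) = (t * (t + 1) ^+ 2)^-1.
  by field; rewrite !gt_eqF.
by rewrite invr_ge0 mulr_ge0 ?exprn_ge0// ltW.
Qed.

Lemma sum_inv_sqr_le2 N : \sum_(i < N) (i.+1%:R ^- 2 : R) <= 2.
Proof.
case: N => [|N]; first by rewrite big_ord0.
by apply: le_trans (sum_inv_sqr N) _; rewrite gerBl invr_ge0.
Qed.

Lemma sum_inv_sqr_int (B : seq int) : uniq B -> \sum_(n <- B) inv_sqr n <= 4.
Proof.
have -> : 4 = 2 + 2 :> R by ring.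
apply: sum_int_le => [n|D uD|D uD]; first exact: inv_sqr_ge0.
  apply: sum_nat_le uD => [n|[|N]]; first exact: inv_sqr_ge0.
    by rewrite big_ord0.
  rewrite big_ord_recl /inv_sqr /= expr0n /= invr0 add0r.
  by apply: le_trans (sum_inv_sqr_le2 N); apply: ler_sum => i _.
apply: sum_nat_le uD => [n|N]; first exact: inv_sqr_ge0.
apply: le_trans (sum_inv_sqr_le2 N); apply: ler_sum => i _.
by rewrite /inv_sqr NegzE rmorphN sqrrN.
Qed.

Lemma has_sum_inv_sqr : exists2 S : R, 0 <= S <= 4 &
  has_sum (fun n => (inv_sqr n)%:C) S%:C.
Proof.
have bd : bounded_sum inv_sqr by exists 4; exact: sum_inv_sqr_int.
have [S hS] := bounded_has_sum inv_sqr_ge0 bd; exists S => //.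
apply/andP; split.
  by have := has_sum_ge (B := [::]) inv_sqr_ge0 isT hS; rewrite big_nil.
apply: le_trans (ler_norm S) _; rewrite -cmodR.
apply: has_sum_cmod_le hS _ => B uB; rewrite (eq_bigr inv_sqr); first exact: sum_inv_sqr_int.
by move=> n _; rewrite cmodR ger0_norm ?inv_sqr_ge0.
Qed.

Lemma abs_summable_real (I : eqType) (g : I -> R) : (forall i, 0 <= g i) ->
  bounded_sum g -> abs_summable (fun i => (g i)%:C).
Proof. by move=> g0; apply: bounded_sum_le => i; rewrite cmodR ger0_norm. Qed.

(** A factor [delta0] places a one-dimensional family on a coordinate axis of the lattice, so that
    the minorants of the lattice sums are built from product families. *)
Definition delta0 (n : int) : R := (n == 0)%:R.

Lemma has_sum_delta0 : has_sum (fun n => (delta0 n)%:C) 1 /\ bounded_sum delta0.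
Proof.
have e (B : seq int) : uniq B -> \sum_(n <- B) delta0 n = (0 \in B)%:R.
  move=> uB; have [iB|niB] := boolP (0 \in B).
    rewrite (big_rem 0)//= {1}/delta0 eqxx big_seq big1 ?addr0// => n.
    by rewrite mem_rem_uniq// !inE => /andP[/negPf h _]; rewrite /delta0 h.
  rewrite big_seq big1// => n nB; rewrite /delta0.
  by case: eqP => // n0; move: niB; rewrite -n0 nB.
split=> [x x0|]; last by exists 1 => B /e ->; rewrite lern1 leq_b1.
exists [:: 0] => B uB sB; rewrite -sum_realC e// sB ?inE// subrr cmod0//.
Qed.

Lemma Re_realC (r : R) : complex.Re r%:C = r. Proof. by []. Qed.

Lemma bounded_inv_pow (k : nat) : (2 <= k)%N ->
  bounded_sum (fun n : int => (`|n|%:~R ^- k : R)).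
Proof.
move=> k2; have bd : bounded_sum inv_sqr by exists 4; exact: sum_inv_sqr_int.
apply: bounded_sum_le bd => n; have [->|n0] := eqVneq n 0.
  by rewrite normr0 expr0n; case: k k2 => //= k _; rewrite invr0 inv_sqr_ge0.
have n1 : 1 <= `|n|%:~R :> R by rewrite ler1z -gtz0_ge1 normr_gt0.
have -> : inv_sqr n = `|n|%:~R ^- 2 by rewrite /inv_sqr intr_norm -normrX ger0_norm ?sqr_ge0.
rewrite lef_pV2 ?posrE ?exprn_gt0 ?(lt_le_trans ltr01)//.
by rewrite ler_weXn2l.
Qed.

Lemma cmod_sqr (a b : R) : cmod (a +i* b) ^+ 2 = a ^+ 2 + b ^+ 2.
Proof. by rewrite /cmod /= sqr_sqrtr ?addr_ge0 ?sqr_ge0. Qed.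

(* |m i y + n|^2 = (m y)^2 + n^2 >= 2 y |m n|. *)
Lemma lat_axis_cross l (y : R) (v : int * int) : 0 < y -> v.1 != 0 -> v.2 != 0 ->
  cmod (lat (axis y) v ^- (2 * l)) <=
  (2 * y) ^- l * (`|v.1|%:~R ^- l * `|v.2|%:~R ^- l).
Proof.
move=> y0 m0 n0; set m : R := `|v.1|%:~R; set n : R := `|v.2|%:~R.
have m1 : 0 < m by rewrite ltr0z normr_gt0.
have n1 : 0 < n by rewrite ltr0z normr_gt0.
have h : 2 * y * (m * n) <= cmod (lat (axis y) v) ^+ 2.
  rewrite lat_axis cmod_sqr -[_ ^+ 2 in leRHS]real_normK ?num_real// -intr_norm -/n.
  rewrite exprMn -[v.1%:~R ^+ 2]real_normK ?num_real// -intr_norm -/m.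
  by rewrite -subr_ge0 (_ : _ - _ = (n - m * y) ^+ 2) ?sqr_ge0//; ring.
have p0 : 0 < 2 * y * (m * n) by rewrite !mulr_gt0.
rewrite -!exprVn -!exprMn -!invfM cmodX cmodV exprM; rewrite lerXn2r ?nnegrE ?invr_ge0 ?(ltW p0)//.
  by rewrite exprn_ge0// invr_ge0 cmod_ge0.
by rewrite exprVn lef_pV2 ?posrE//; exact: lt_le_trans h.
Qed.

Lemma Re_realC_expV (r : R) k : complex.Re (r%:C ^- k) = r ^- k.
Proof. by rewrite (_ : r%:C ^- k = (r ^- k)%:C)// fmorphV rmorphXn. Qed.

Lemma imag_sqr (t : R) : (0 +i* t) ^+ 2 = (- t ^+ 2)%:C :> C.
Proof. by apply/eqP; rewrite expr2 eq_complex /= !mul0r !mulr0 addr0 sub0r expr2 !eqxx. Qed.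

Lemma imag_exp (t : R) l : (0 +i* t) ^+ (2 * l) = ((- t ^+ 2) ^+ l)%:C :> C.
Proof. by rewrite exprM imag_sqr -rmorphXn. Qed.

Lemma Re_imag_expV (t : R) l : complex.Re ((0 +i* t) ^- (2 * l)) = (- t ^+ 2) ^- l.
Proof.
by rewrite imag_exp -[X in complex.Re X]expr1 -[_^-1]/(_ ^- 1) Re_realC_expV expr1.
Qed.

Lemma lat_axis0l (y : R) (n : int) : lat (axis y) (0, n) = (n%:~R : R)%:C.
Proof. by rewrite lat_axis /= mul0r. Qed.

Lemma lat_axis0r (y : R) (m : int) : lat (axis y) (m, 0) = 0 +i* (m%:~R * y).
Proof. by rewrite lat_axis. Qed.

Lemma has_sum_prodR (g h : int -> R) (s t : R) : (forall i, 0 <= g i) -> (forall i, 0 <= h i) ->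
  bounded_sum g -> bounded_sum h ->
  has_sum (fun i => (g i)%:C) s%:C -> has_sum (fun i => (h i)%:C) t%:C ->
  has_sum (fun v : int * int => (g v.1 * h v.2)%:C) (s * t)%:C.
Proof.
move=> g0 h0 bg bh hs ht; rewrite rmorphM.
have := has_sum_prod (abs_summable_real g0 bg) (abs_summable_real h0 bh) hs ht.
by apply: has_sum_ext => v; rewrite rmorphM.
Qed.

Lemma delta0_ge0 n : 0 <= delta0 n.
Proof. exact: ler0n. Qed.

Lemma inv_pow_ge0 k (n : int) : 0 <= `|n|%:~R ^- k :> R.
Proof. by rewrite invr_ge0 exprn_ge0// ler0z. Qed.

Lemma norm_expV2 (n : int) l : `|n|%:~R ^- (2 * l) = n%:~R ^- (2 * l) :> R.
Proof. by rewrite !exprM intr_norm real_normK ?num_real. Qed.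

Lemma inv_sqrE n : inv_sqr n = `|n|%:~R ^- 2.
Proof. by rewrite (norm_expV2 n 1). Qed.

Lemma delta0_neq0 n : n != 0 -> delta0 n = 0.
Proof. by rewrite /delta0 => /negPf ->. Qed.

Lemma delta00 : delta0 0 = 1. Proof. by rewrite /delta0 eqxx. Qed.

Lemma inv_sqr0 : inv_sqr 0 = 0. Proof. by rewrite /inv_sqr expr0n invr0. Qed.

(* The terms with m = 0 or n = 0 contribute positively and outweigh the others,
   each of which is at most 1 / (2 y m n)^2 in modulus. *)
Lemma lat_sum4_axis_gt0 (y : R) : 1 <= y -> 0 < complex.Re (lat_sum (axis y) 4).
Proof.
move=> y1; have y0 : 0 < y by exact: lt_le_trans y1.
have [S /andP[S0 S4] hS] := has_sum_inv_sqr.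
have bi : bounded_sum inv_sqr by exists 4; exact: sum_inv_sqr_int.
have b4 := bounded_inv_pow (isT : (2 <= 4)%N).
have [s hs] := bounded_has_sum (inv_pow_ge0 4) b4.
(* The terms at 1 and -1 alone give s >= 2, which leaves 2 (1 - u)^2, not positive at y = 1; those
   at 2 and -2 raise the bound to 2 (1 + 1/16). *)
have s4 : 17 / 8 <= s.
  have := has_sum_ge (B := [:: 1; -1; 2; -2]) (inv_pow_ge0 4) isT hs.
  rewrite !big_cons big_nil /= !normrN.
  have -> : (`|1|%:~R : R) = 1 by [].
  have -> : (`|2|%:~R : R) = 2 by [].
  have -> : 2 ^- 4 = 1 / 16 :> R by field.
  by rewrite expr1n invr1; apply: le_trans; lra.
have [hd bd] := has_sum_delta0.
have h1 := has_sum_prodR delta0_ge0 (inv_pow_ge0 4) bd b4 hd hs.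
have h2 := has_sum_prodR (inv_pow_ge0 4) delta0_ge0 b4 bd hs hd.
have h3 := has_sum_prodR inv_sqr_ge0 inv_sqr_ge0 bi bi hS hS.
have hg := has_sumB (has_sumD h1 (has_sumZ (y ^- 4)%:C h2)) (has_sumZ ((2 * y) ^- 2)%:C h3).
have h := has_sum_Re_le hg (has_lat_sum (z := axis y) (k := 4) y0 isT).
pose u := y ^- 2; have u0 : 0 < u by rewrite invr_gt0 exprn_gt0.
apply: lt_le_trans (h _).
  rewrite -!rmorphM -rmorphD -rmorphB Re_realC mul1r mulr1.
  have -> : y ^- 4 = u ^+ 2 by rewrite /u exprVn -exprM.
  have -> : (2 * y) ^- 2 = u / 4 by rewrite /u exprMn invfM; field; rewrite gt_eqF.
  have h16 : S * S <= 4 * 4 by apply: ler_pM.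
  have : u / 4 * (S * S) <= u / 4 * (4 * 4) by apply: ler_wpM2l => //; rewrite divr_ge0 ?ltW.
  have : 17 / 8 * (1 + u ^+ 2) <= s * (1 + u ^+ 2).
    by apply: ler_wpM2r => //; rewrite addr_ge0 ?sqr_ge0.
  (* What remains is 17/8 (1 + u^2) >= 17/4 u > 4 u. *)
  have := sqr_ge0 (1 - u); nra.
move=> [m n]; cbv beta; rewrite -!rmorphM -rmorphD -rmorphB Re_realC [(_, _).1]/= [(_, _).2]/=.
have [->|m0] := eqVneq m 0.
  rewrite lat_axis0l Re_realC_expV delta00 inv_sqr0 normr0 expr0n /= invr0.
  by rewrite (norm_expV2 n 2) !mul0r !mulr0 mul1r addr0 subr0.
have [->|n0] := eqVneq n 0.
  rewrite lat_axis0r (Re_imag_expV _ 2) sqrrN.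
  rewrite delta0_neq0// delta00 inv_sqr0 (norm_expV2 m 2) mul0r !mulr0 mulr1 add0r subr0.
  rewrite le_eqVlt; apply/orP; left; apply/eqP; field.
  by rewrite gt_eqF//= intr_eq0.
rewrite !delta0_neq0// mul0r !mulr0 addr0 sub0r !inv_sqrE.
have := lat_axis_cross 2 (v := (m, n)) y0 m0 n0; rewrite /=.
by have := Re_cmod (lat (axis y) (m, n) ^- 4); rewrite ler_norml => /andP[? _] ?; lra.
Qed.

(* Multiplication by i preserves the lattice and changes the sign of x ^- 6. *)
Lemma lat_sum6_i : complex.Re (lat_sum (axis (1 : R)) 6) = 0.
Proof.
have i0 : 0 < complex.Im (axis (1 : R)) by rewrite Im_axis.
have hs := has_lat_sum i0 (isT : (3 <= 6)%N).
suff -> : lat_sum (axis (1 : R)) 6 = 0 by [].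
have : lat_sum (axis (1 : R)) 6 = - lat_sum (axis (1 : R)) 6.
  apply: (has_sum_unique hs).
  pose phi (v : int * int) := (v.2, - v.1); pose psi (v : int * int) := (- v.2, v.1).
  have k1 : cancel phi psi by move=> [m n]; rewrite /phi /psi /= opprK.
  have k2 : cancel psi phi by move=> [m n]; rewrite /phi /psi /= opprK.
  apply: (has_sum_bij k1 k2); apply: has_sum_ext (has_sumN hs) => v.
  have -> : lat (axis (1 : R)) (phi v) = (0 +i* 1) * lat (axis (1 : R)) v.
    rewrite !lat_axis /phi /=; apply/eqP; rewrite eq_complex /=.
    by apply/andP; split; apply/eqP; rewrite ?rmorphN /=; ring.
  rewrite exprMn (imag_exp _ 3) expr1n -signr_odd expr1 rmorphN rmorph1.
  by rewrite mulN1r invrN.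
by move/eqP; rewrite -addr_eq0 -mulr2n mulrn_eq0 /= => /eqP.
Qed.

(* The terms with m = 0 sum to at least 2; the rest is at most (S + S^2) / 64 <= 20 / 64,
   where S <= 4 is the sum of n ^- 2 over all n. *)
Lemma lat_sum6_2i : 0 < complex.Re (lat_sum (axis (2 : R)) 6).
Proof.
have y0 : 0 < 2 :> R by [].
have [S /andP[S0 S4] hS] := has_sum_inv_sqr.
have bi : bounded_sum inv_sqr by exists 4; exact: sum_inv_sqr_int.
have b6 := bounded_inv_pow (isT : (2 <= 6)%N).
have [s hs] := bounded_has_sum (inv_pow_ge0 6) b6.
have s6 : 2 <= s.
  have := has_sum_ge (B := [:: 1; -1]) (inv_pow_ge0 6) isT hs.
  rewrite !big_cons big_nil /= !normrN.
  have -> : (`|1|%:~R : R) = 1 by [].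
  by rewrite expr1n invr1; apply: le_trans; lra.
have [hd bd] := has_sum_delta0.
have h1 := has_sum_prodR delta0_ge0 (inv_pow_ge0 6) bd b6 hd hs.
have h2 := has_sum_prodR inv_sqr_ge0 delta0_ge0 bi bd hS hd.
have h3 := has_sum_prodR inv_sqr_ge0 inv_sqr_ge0 bi bi hS hS.
have hg := has_sumB h1 (has_sumZ (64^-1)%:C (has_sumD h2 h3)).
have h := has_sum_Re_le hg (has_lat_sum (z := axis 2) (k := 6) y0 isT).
have am1 (m : int) : m != 0 -> 1 <= `|m|%:~R :> R.
  by move=> m0; rewrite ler1z -gtz0_ge1 normr_gt0.
have am k (m : int) : (2 <= k)%N -> m != 0 -> `|m|%:~R ^- k <= inv_sqr m.
  move=> k2 m0; have m1 := am1 m m0.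
  by rewrite inv_sqrE lef_pV2 ?posrE ?exprn_gt0 ?(lt_le_trans ltr01)// ler_weXn2l.
apply: lt_le_trans (h _).
  rewrite -rmorphD -!rmorphM -rmorphB Re_realC mul1r mulr1.
  have : S * S <= 4 * 4 by apply: ler_pM.
  lra.
move=> [m n]; cbv beta; rewrite -rmorphD -!rmorphM -rmorphB Re_realC [(_, _).1]/= [(_, _).2]/=.
have [->|m0] := eqVneq m 0.
  rewrite lat_axis0l Re_realC_expV delta00 inv_sqr0 (norm_expV2 n 3).
  by rewrite !mul0r !addr0 mulr0 mul1r subr0.
have [->|n0] := eqVneq n 0.
  rewrite lat_axis0r (Re_imag_expV _ 3).
  rewrite (delta0_neq0 m0) delta00 inv_sqr0 !mulr0 mul0r mulr1 addr0 sub0r.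
  have -> : (- (m%:~R * 2) ^+ 2) ^- 3 = - (64^-1 * `|m|%:~R ^- 6) :> R.
    rewrite (norm_expV2 m 3) exprNn -signr_odd expr1 mulN1r invrN -exprM exprMn invfM.
    by rewrite mulrC; congr (- (_ * _)); field.
  by rewrite lerN2 ler_wpM2l//; exact: am.
rewrite !delta0_neq0// !mul0r !mulr0 !add0r.
have := lat_axis_cross 3 (v := (m, n)) y0 m0 n0; rewrite /=.
have : `|m|%:~R ^- 3 * `|n|%:~R ^- 3 <= inv_sqr m * inv_sqr n :> R.
  by apply: ler_pM; rewrite ?inv_pow_ge0 ?am.
have -> : (2 * 2) ^- 3 = 64^-1 :> R by field.
by have := Re_cmod (lat (axis (2 : R)) (m, n) ^- 6); rewrite ler_norml => /andP[? _] ? ?; lra.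
Qed.

End AxisBounds.

(** * Uniqueness of the coefficients *)

Section Uniqueness.
Variable R : realType.
Local Notation C := R[i].

Lemma ratrC (q : rat) : (ratr q : C) = (ratr q : R)%:C.
Proof. by rewrite -(fmorph_eq_rat (real_complex R \o ratr)). Qed.

(** This is G_6 / G_4^(3/2), of weight 0. With s = sqrt G_4, dividing a form of weight 2n by s^n
    leaves its dehomogenised polynomial at this ratio, whatever the parity of the exponents of
    G_6. *)
Definition axis_ratio (y : R) : R := axis_sum 6 y / Num.sqrt (axis_sum 4 y) ^+ 3.

Lemma axis_sum4_gt0 (y : R) : 0 < axis_sum 4 y.
Proof. by apply: lat_sum4_axis_gt0; rewrite le_max lexx. Qed.

Lemma axis_ratio_continuous : continuous axis_ratio.
Proof.
move=> y; have s0 : Num.sqrt (axis_sum 4 y) ^+ 3 != 0.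
  by rewrite expf_neq0// gt_eqF// sqrtr_gt0 axis_sum4_gt0.
apply: cvgM; first exact: axis_sum_continuous.
apply: cvgV => //.
have hs : (Num.sqrt (axis_sum 4 x) @[x --> y] --> Num.sqrt (axis_sum 4 y))%classic.
  by apply: continuous_comp; [exact: axis_sum_continuous|exact: sqrt_continuous].
by rewrite !exprS expr0 mulr1; apply: cvg_trans; last exact: (cvgM hs (cvgM hs hs)).
Qed.

Lemma axis_ratio_onto (v : R) : 0 <= v -> v <= axis_ratio 2 ->
  exists y, axis_ratio y = v.
Proof.
move=> v0 v2; have r1 : axis_ratio 1 = 0.
  by rewrite /axis_ratio /axis_sum maxxx lat_sum6_i mul0r.
have [c _ hc] := @IVT R axis_ratio 1 2 v ltac:(by rewrite ler1n)
  (continuous_subspaceT axis_ratio_continuous)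
  ltac:(by rewrite r1 ge_min v0 le_max v2 orbT).
by exists c.
Qed.

Lemma axis_ratio2_gt0 : 0 < axis_ratio 2.
Proof.
apply: divr_gt0; last by apply: exprn_gt0; rewrite sqrtr_gt0; exact: axis_sum4_gt0.
have -> : axis_sum 6 (2 : R) = complex.Re (lat_sum (axis (2 : R)) 6).
  by rewrite /axis_sum (_ : Num.max 1 2 = 2)// max_r// ler1n.
exact: lat_sum6_2i.
Qed.

Lemma heval_lat_sum_inj n (d : {poly rat}) : weighted n d ->
  (forall z : C, 0 < complex.Im z -> heval ratr (lat_sum z 4) (lat_sum z 6) n d = 0) ->
  d = 0.
Proof.
move=> wd h0; apply/eqP; apply/negPn/negP => d0.
pose P : {poly R} := map_poly ratr d.
have P0 : P != 0 by rewrite map_poly_eq0.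
have rootP y : root P (axis_ratio y).
  have m1 : 1 <= Num.max 1 y by rewrite le_max lexx.
  have my0 : 0 < Num.max 1 y by exact: lt_le_trans m1.
  have := h0 (axis (Num.max 1 y)) my0.
  rewrite (lat_sum_axis_real (isT : (3 <= 4)%N) my0) (lat_sum_axis_real (isT : (3 <= 6)%N) my0).
  rewrite -/(axis_sum 4 y) -/(axis_sum 6 y).
  set s := Num.sqrt (axis_sum 4 y).
  have s0 : s != 0 by rewrite gt_eqF// sqrtr_gt0 axis_sum4_gt0.
  have -> : axis_sum 4 y = s ^+ 2 by rewrite sqr_sqrtr// ltW// axis_sum4_gt0.
  have -> : heval ratr (s ^+ 2)%:C (axis_sum 6 y)%:C n d = (s ^+ n * P.[axis_ratio y])%:C.
    have -> : P = \sum_(b < n.+1) ratr d`_b *: 'X^b.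
      by rewrite /P {1}(weighted_sumXn wd) rmorph_sum /=; apply: eq_bigr => b _;
        rewrite map_polyZ map_polyXn.
    rewrite horner_sum mulr_sumr rmorph_sum; apply: eq_bigr => b _.
    rewrite hornerZ hornerXn.
    transitivity ((ratr d`_b)%:C * (s ^+ 2)%:C ^+ ((n - 3 * b) %/ 2) * (axis_sum 6 y)%:C ^+ b).
      by congr (_ * _ * _); exact: ratrC.
    rewrite -!rmorphXn -!rmorphM; congr (_%:C).
    have [->|/wd /andP[b1 b2]] := eqVneq d`_b 0; first by rewrite rmorph0 !mul0r mulr0.
    rewrite /axis_ratio -/s expr_div_n -exprM -exprM.
    have -> : (2 * ((n - 3 * b) %/ 2) = n - 3 * b)%N by lia.
    have -> : s ^+ n = s ^+ (n - 3 * b) * s ^+ (3 * b) by rewrite -exprD subnK.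
    by field; rewrite expf_neq0.
  move=> /(congr1 (@complex.Re R)) /= /eqP.
  by rewrite mulf_eq0 expf_eq0 (negPf s0) andbF.
(* The ratio takes every value between 0 and its value at 2i; [size P] distinct ones already exceed
   the possible number of roots. *)
pose N := size P; pose rs := [seq axis_ratio 2 / j.+1%:R | j <- iota 0 N].
have r0 := axis_ratio2_gt0.
have urs : uniq rs.
  rewrite map_inj_uniq ?iota_uniq// => i j /mulfI e.
  have /invr_inj/eqP := e ltac:(by rewrite gt_eqF).
  by rewrite eqr_nat => /eqP[].
have ars : all (root P) rs.
  apply/allP => _ /mapP[j _ ->].
  have [|| y <-] := @axis_ratio_onto (axis_ratio 2 / j.+1%:R).
  - by rewrite divr_ge0// ltW.
  - by rewrite ler_pdivrMr ?ltr0n// ler_peMr ?ler1n// ltW.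
  exact: rootP.
by have := max_poly_roots P0 ars urs; rewrite size_map size_iota ltnn.
Qed.

Lemma lat_sum_heval (z : C) n : 0 < complex.Im z -> (2 <= n)%N ->
  (2 * n).-1%:R * lat_sum z (2 * n) = heval ratr (lat_sum z 4) (lat_sum z 6) n (eis_poly n).
Proof.
move=> z0 n2.
apply: (@heval_eis_poly C ratr (lat_sum z 4) (lat_sum z 6)
  (fun m => (2 * m).-1%:R * lat_sum z (2 * m))) => // m m4.
exact: lat_sum_recurrence.
Qed.

Lemma eisenstein_coefE (k : nat) (w : nat -> rat) : (6 <= k)%N -> ~~ odd k ->
  eisenstein_coef R k w ->
  forall b, admissible k b -> W w k b = (eis_poly (k %/ 2))`_b / k.-1%:R.
Proof.
move=> k6 ek hw; set n := (k %/ 2)%N.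
have kE : k = (2 * n)%N by rewrite /n; lia.
have n3 : (3 <= n)%N by lia.
(* The hypothesis constrains [w] only at the exponents of monomials of weight k; [D] collects these
   values. *)
pose D : {poly rat} := \poly_(b < n.+1) (if admissible k b then W w k b else 0).
have DE b : D`_b = if admissible k b then W w k b else 0.
  rewrite coef_poly; case: ltnP => // nb; case: ifP => // /andP[h _]; exfalso; lia.
have wD : weighted n D.
  move=> b; rewrite DE; case: ifP => [/andP[h1 h2] _|_]; last by rewrite eqxx.
  by lia.
have k0 : (k.-1%:R : rat) != 0 by rewrite pnatr_eq0; lia.
pose d := D + (- k.-1%:R^-1) *: eis_poly n.
suff d0 : d = 0.
  move=> b ab; have := congr1 (fun p : {poly rat} => p`_b) d0.
  rewrite coef0 coefD coefZ DE ab => /eqP; rewrite addr_eq0 => /eqP ->.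
  by rewrite mulNr opprK mulrC.
apply: (@heval_lat_sum_inj n).
  move=> b; rewrite coefD coefZ => h.
  have [Db|] := eqVneq D`_b 0; last exact: wD.
  apply: weighted_eis_poly; apply: contraNneq h => ->.
  by rewrite Db mulr0 addr0.
move=> z z0; have -> : heval ratr (lat_sum z 4) (lat_sum z 6) n d =
    heval ratr (lat_sum z 4) (lat_sum z 6) n D +
    heval ratr (lat_sum z 4) (lat_sum z 6) n (- k.-1%:R^-1 *: eis_poly n).
  rewrite /heval -big_split; apply: eq_bigr => b _ /=.
  by rewrite coefD rmorphD !mulrDl.
rewrite hevalZ -lat_sum_heval//; last by lia.
rewrite -kE rmorphN fmorphV rmorph_nat mulNr mulKf; last by rewrite pnatr_eq0; lia.
have -> : heval ratr (lat_sum z 4) (lat_sum z 6) n D = lat_sum z k; last exact: subrr.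
have k3 : (3 <= k)%N by lia.
(* For given b at most one a satisfies 4a + 6b = k, so after exchanging the sums the inner one has
   at most one term. *)
rewrite -(eisG_lat_sum k3 z0) hw// (exchange_big_dep xpredT)//= /heval.
rewrite (big_ord_widen k.+1 (fun b => ratr D`_b * lat_sum z 4 ^+ ((n - 3 * b) %/ 2) *
   lat_sum z 6 ^+ b)); last by lia.
rewrite big_mkcond /=; apply: eq_bigr => b _; rewrite DE.
have [/andP[h1 h2]|nab] := boolP (admissible k b); last first.
  rewrite rmorph0 !mul0r if_same; symmetry; apply: big1 => a /eqP e; exfalso; move/negP: nab; apply.
  apply/andP; split; first by lia.
  have -> : (k - 6 * b = 4 * a)%N by lia.
  exact: dvdn_mulr.
have bn : (b < n.+1)%N by lia.
have ak : ((k - 6 * b) %/ 4 < k.+1)%N by lia.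
rewrite bn (big_pred1 (Ordinal ak)) => [|a]; last first.
  rewrite /= -val_eqE /=; apply/eqP/eqP; lia.
rewrite !eisG_lat_sum// /W /=; congr (_ * _ ^+ _ * _); lia.
Qed.

End Uniqueness.

Theorem proposition5 (R : realType) (k : nat) (w : nat -> rat)
    (hk6 : (6 <= k)%N) (hk_even : ~~ odd k) (hk_pow2 : ~~ is_pow2 k)
    (hw : eisenstein_coef R k w) :
  ((forall n : nat, is_pow2 n -> k <> (6 * n)%N) ->
     v2 (W w k (mu k)) = (lambda k)%:E%E /\
     (forall b : nat, admissible k b -> (b < mu k)%N ->
        ((lambda k)%:E < v2 (W w k b))%E))
  /\
  (forall n : nat, is_pow2 n -> k = (6 * n)%N ->
     v2 (W w k n) = 0%:E%E /\
     ((2 <= n)%N -> v2 (W w k 0) = 1%:E%E) /\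
     (forall b : nat, admissible k b -> b <> 0%N -> b <> n ->
        (1%:E < v2 (W w k b))%E)).
Proof.
have [ha hb] := valuation_of_coef hk6 hk_even hk_pow2 (eisenstein_coefE hk6 hk_even hw).
by split.
Qed.
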